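(* Let $m\ge 1$ and $a,b,c_1,\dots,c_m\in\mathbb{C}$. For $I=(i_1,\dots,i_m)\in\{0,1\}^m$ put $a^I=a+\sum_{k=1}^m i_k(1-c_k)$ and $b^I=b+\sum_{k=1}^m i_k(1-c_k)$. Suppose that there exists $I\in\{0,1\}^m$ such that either ($a^I\in\mathbb{Z}$ and $b^I\notin\mathbb{Z}$) or ($a^I\notin\mathbb{Z}$ and $b^I\in\mathbb{Z}$). If $a^{I'}\notin\mathbb{Z}$ and $b^{I'}\notin\mathbb{Z}$ for every $I'\in\{0,1\}^m$ with $I'\ne I$, then the monodromy representation $\mathcal{M}:\pi_1(X,\dot x)\to GL(Sol_{\dot x})$ of $E_C(a,b,c)$ is reducible, that is, there exists a non-trivial subspace of $Sol_{\dot x}$ (different from $0$ and $Sol_{\dot x}$) invariant under $\mathcal{M}$.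
   Context: Write $\partial_k=\partial/\partial x_k$, $\theta_k=x_k\partial_k$, $\theta=\sum_{k=1}^m\theta_k$. Lauricella's system $E_C(a,b,c)$, $c=(c_1,\dots,c_m)$, is the system of linear partial differential equations $$\left[\theta_k(\theta_k+c_k-1)-x_k(\theta+a)(\theta+b)\right]f(x)=0,\qquad k=1,\dots,m,$$ in the variables $x=(x_1,\dots,x_m)\in\mathbb{C}^m$. It is holonomic of rank $2^m$ with singular locus $$S=\Big\{x\in\mathbb{C}^m : \prod_{k=1}^m x_k\cdot R(x)=0\Big\},\qquad R(x)=\prod_{\varepsilon_1,\dots,\varepsilon_m=\pm1}\Big(1+\sum_{k=1}^m\varepsilon_k\sqrt{x_k}\Big)$$ ($R$ is a polynomial in $x_1,\dots,x_m$). Put $X=\mathbb{C}^m\setminus S$ and $\dot x=\left(\frac1{2m^2},\dots,\frac1{2m^2}\right)\in X$. $Sol_{\dot x}$ is the $2^m$-dimensional $\mathbb{C}$-vector space of germs at $\dot x$ of holomorphic solutions of $E_C(a,b,c)$. For $\rho\in\pi_1(X,\dot x)$, $\mathcal{M}(\rho)\in GL(Sol_{\dot x})$ is analytic continuation of solutions along $\rho$; products of loops $\rho\cdot\rho'$ mean first $\rho$ and then $\rho'$, and $\mathcal{M}(\rho\cdot\rho')=\mathcal{M}(\rho')\circ\mathcal{M}(\rho)$. *)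

(* Defs.v *)
From HB Require Import structures.
From mathcomp Require Import all_boot all_order all_algebra.
From mathcomp Require Import complex.
From mathcomp Require Import all_classical all_reals all_analysis.
Import Order.TTheory GRing.Theory Num.Theory.
Import numFieldNormedType.Exports.

Set Implicit Arguments.
Unset Strict Implicit.
Unset Printing Implicit Defensive.

Local Open Scope classical_set_scope.
Local Open Scope ring_scope.
Local Open Scope quotient_scope.

(* Germs at [p] of arbitrary [K]-valued functions on a topological space, as a
   module over [K]. *)
Section Germs.
Context {T : topologicalType} {K : comPzRingType}.
Variable p : T.

Definition germ_eq : rel (T -> K) :=
  fun f g => `[< \forall z \near p, f z = g z >].

Lemma germ_eqP (f g : T -> K) :
  reflect (\forall z \near p, f z = g z) (germ_eq f g).
Proof. exact: asboolP. Qed.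

Lemma germ_eq_refl : reflexive germ_eq.
Proof. by move=> f; apply/germ_eqP; near=> z. Unshelve. all: by end_near. Qed.

Lemma germ_eq_sym : symmetric germ_eq.
Proof.
by move=> f g; apply/germ_eqP/germ_eqP; apply: filterS => z ->.
Qed.

Lemma germ_eq_trans : transitive germ_eq.
Proof.
move=> g f h /germ_eqP fg /germ_eqP gh; apply/germ_eqP.
by apply: filterS2 fg gh => z -> ->.
Qed.

Canonical germ_equiv :=
  EquivRel germ_eq germ_eq_refl germ_eq_sym germ_eq_trans.

Definition germ := {eq_quot germ_eq}.

HB.instance Definition _ := Choice.on germ.
HB.instance Definition _ : EqQuotient _ germ_eq germ := EqQuotient.on germ.

Definition germ_of (f : T -> K) : germ := \pi_germ f.

Lemma germ_ofP (f g : T -> K) :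
  germ_of f = germ_of g <-> \forall z \near p, f z = g z.
Proof.
split=> [/eqP|fg]; first by rewrite /germ_of piE => /germ_eqP.
by apply/eqP; rewrite /germ_of piE; apply/germ_eqP.
Qed.

Lemma germ_of_repr (u : germ) : germ_of (repr u) = u.
Proof. exact: reprK. Qed.

Definition germ_zero : germ := germ_of (fun=> 0).
Definition germ_opp (u : germ) : germ := germ_of (fun z => - repr u z).
Definition germ_add (u v : germ) : germ :=
  germ_of (fun z => repr u z + repr v z).
Definition germ_scale (k : K) (u : germ) : germ :=
  germ_of (fun z => k * repr u z).

Lemma repr_germ_of (f : T -> K) :
  \forall z \near p, repr (germ_of f) z = f z.
Proof. by apply/germ_ofP; rewrite germ_of_repr. Qed.

Lemma germ_oppE f : germ_opp (germ_of f) = germ_of (fun z => - f z).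
Proof.
by apply/germ_ofP; apply: filterS (repr_germ_of f) => z ->.
Qed.

Lemma germ_addE f g :
  germ_add (germ_of f) (germ_of g) = germ_of (fun z => f z + g z).
Proof.
apply/germ_ofP.
by apply: filterS2 (repr_germ_of f) (repr_germ_of g) => z -> ->.
Qed.

Lemma germ_scaleE k f :
  germ_scale k (germ_of f) = germ_of (fun z => k * f z).
Proof.
by apply/germ_ofP; apply: filterS (repr_germ_of f) => z ->.
Qed.

Lemma germ_addA : associative germ_add.
Proof.
move=> u v w; rewrite -(germ_of_repr u) -(germ_of_repr v) -(germ_of_repr w).
by rewrite !germ_addE; congr germ_of; apply/funext => z; rewrite addrA.
Qed.

Lemma germ_addC : commutative germ_add.
Proof.
by move=> u v; congr germ_of; apply/funext => z; rewrite addrC.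
Qed.

Lemma germ_add0 : left_id germ_zero germ_add.
Proof.
move=> u; rewrite -(germ_of_repr u) germ_addE.
by congr germ_of; apply/funext => z; rewrite add0r.
Qed.

Lemma germ_addN : left_inverse germ_zero germ_opp germ_add.
Proof.
move=> u; rewrite -(germ_of_repr u) germ_oppE germ_addE.
by congr germ_of; apply/funext => z; rewrite addNr.
Qed.

HB.instance Definition _ :=
  GRing.isZmodule.Build germ germ_addA germ_addC germ_add0 germ_addN.

Lemma germ_scaleA k l u : germ_scale k (germ_scale l u) = germ_scale (k * l) u.
Proof.
rewrite -(germ_of_repr u) !germ_scaleE.
by congr germ_of; apply/funext => z; rewrite mulrA.
Qed.

Lemma germ_scale1 : left_id 1 germ_scale.
Proof.
move=> u; rewrite -(germ_of_repr u) germ_scaleE.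
by congr germ_of; apply/funext => z; rewrite mul1r.
Qed.

Lemma germ_scaleDr : right_distributive germ_scale +%R.
Proof.
move=> k u v; rewrite -(germ_of_repr u) -(germ_of_repr v).
rewrite /GRing.add /= !(germ_addE, germ_scaleE).
by congr germ_of; apply/funext => z; rewrite mulrDr.
Qed.

Lemma germ_scaleDl u : {morph germ_scale^~ u : k l / k + l}.
Proof.
move=> k l; rewrite -(germ_of_repr u) !germ_scaleE.
rewrite [RHS]germ_addE.
by congr germ_of; apply/funext => z; rewrite mulrDl.
Qed.

HB.instance Definition _ := GRing.Zmodule_isLmodule.Build K germ
  germ_scaleA germ_scale1 germ_scaleDr germ_scaleDl.

End Germs.

Arguments germ {T} K p.

(* The complex numbers, packaged so that the topology and the norm of an
   abstract [numFieldType] apply to them and to ['rV[Cplx R]_m]. *)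
Definition Cplx (R : realType) : numClosedFieldType := R[i].

Section LauricellaC.
Context {R : realType} {m : nat}.
Local Notation C := (Cplx R).
Local Notation Cm := 'rV[Cplx R]_m.

Definition is_integer (z : C) : Prop := exists n : int, z = n%:~R.

Definition holomorphic_at (f : Cm -> C) (p : Cm) : Prop :=
  \forall z \near p, differentiable f z.

Definition pderiv (k : 'I_m) (f : Cm -> C) : Cm -> C :=
  fun x => 'D_(delta_mx 0 k) f x.

Definition theta_k (k : 'I_m) (f : Cm -> C) : Cm -> C :=
  fun x => x 0 k * pderiv k f x.

Definition theta (f : Cm -> C) : Cm -> C :=
  fun x => \sum_(k < m) theta_k k f x.

Definition E_C (a b : C) (c : 'I_m -> C) (k : 'I_m) (f : Cm -> C) : Cm -> C :=
  fun x =>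
    theta_k k (fun y => theta_k k f y + (c k - 1) * f y) x
    - x 0 k * (let g := fun y => theta f y + b * f y in theta g x + a * g x).

Definition solution_at (a b : C) (c : 'I_m -> C) (p : Cm) (f : Cm -> C) :
    Prop :=
  holomorphic_at f p /\ forall k, \forall z \near p, E_C a b c k f z = 0.

Definition Sol (a b : C) (c : 'I_m -> C) (p : Cm) : {pred germ C p} :=
  fun u => `[< exists2 f, solution_at a b c p f & u = germ_of p f >].

(* The product over all signs does not depend on the chosen square roots. *)
Definition R_poly (x : Cm) : C :=
  \prod_(e : {ffun 'I_m -> bool})
    (1 + \sum_(k < m) (-1) ^+ e k * sqrtC (x 0 k)).

Definition sing_locus : set Cm :=
  [set x : Cm | (\prod_(k < m) x 0 k) * R_poly x = 0].

Definition X_C : set Cm := ~` sing_locus.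

Definition xdot : Cm := const_mx (1 / (2 * m ^ 2)%:R).

Definition is_loop (X : set Cm) (p : Cm) (gamma : R -> Cm) : Prop :=
  [/\ {within `[0, 1], continuous gamma}, gamma 0 = p, gamma 1 = p
    & forall t : R, t \in `[0, 1] -> X (gamma t)].

(* [v] is obtained from [u] by analytic continuation along [gamma]: there is a
   family of holomorphic function elements [F t] at [gamma t] such that the
   germs at [gamma s] of [F s] and [F t] agree for all [s] close to [t]. *)
Definition continuation (p : Cm) (gamma : R -> Cm) (u v : germ C p) : Prop :=
  exists F : R -> Cm -> C,
    [/\ forall t : R, t \in `[0, 1] -> holomorphic_at (F t) (gamma t),
        forall t : R, t \in `[0, 1] -> \forall s \near (t : R), s \in `[0, 1] ->
          germ_of (gamma s) (F s) = germ_of (gamma s) (F t),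
        u = germ_of p (F 0)
      & v = germ_of p (F 1)].

(* By the identity theorem and the monodromy theorem, [continuation gamma] is,
   for a loop [gamma], the graph of the monodromy operator of the homotopy class
   of [gamma].  Every class is represented by a loop, so quantifying over loops
   amounts to quantifying over the fundamental group. *)
Definition monodromy_invariant (p : Cm) (W : {pred germ C p}) : Prop :=
  forall gamma, is_loop X_C p gamma ->
    forall u, u \in W -> exists2 v, v \in W & continuation gamma u v.

Definition monodromy_reducible (a b : C) (c : 'I_m -> C) : Prop :=
  exists W : {pred germ C xdot},
    [/\ GRing.submod_closed W,
        {subset W <= @Sol a b c xdot},
        exists2 u, u \in W & u != 0,
        exists2 u, u \in @Sol a b c xdot & u \notin W
      & monodromy_invariant W].

(* The parameter [a^I] (resp. [b^I]), a multi-index in {0,1}^m being a family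
   of booleans. *)
Definition shifted (c : 'I_m -> C) (a : C) (I : {ffun 'I_m -> bool}) : C :=
  a + \sum_(k < m) (I k)%:R * (1 - c k).

End LauricellaC.

(* Main.v *)
Require Import Defs.
From HB Require Import structures.
From mathcomp Require Import all_boot all_order all_algebra.
From mathcomp Require Import complex.
From mathcomp Require Import all_classical all_reals all_analysis.
From mathcomp Require mpoly. Import -(notations) mpoly.
From mathcomp Require Import ring lra zify.
Import Order.TTheory GRing.Theory Num.Theory.
Import numFieldNormedType.Exports.

(** Solutions are represented by their jets.  A jet at q is a linear functional
u on the ring A of differential operators with constant coefficients: u P is
the value at q of P f, and f (q + h) is the sum of the u ((h . d)^n) / n!.  The
Weyl algebra acts on jets, multiplication by x_k being
u |-> (P |-> q_k u P + u (dP / d(d_k))), so that E_C(a,b,c) becomes an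
algebraic condition [FSol] on u, that of being a formal solution.

Continuation of solutions rests on an estimate.  At a point p the principal
symbols of the equations are (p_k d_k)^2 - p_k (sum_j p_j d_j)^2.  Modulo these
symbols, p_k d_k and sqrt(p_k) times the total symbol sum_j p_j d_j have the
same square, and multiplying over all signs shows that R(p)^2 times a power of
the total symbol is 0.  Hence, when p is off
the singular locus, every monomial of high order lies in the ideal of the
symbols, with explicit constants ([top_bound]).  By induction on the order, the
derivatives of order n of a formal solution at q near p are at most K M^n n!
with the same M for all q near p ([FSol_bound]).  Solutions near p thus converge
on balls of a common radius, and re-expanding them from point to point
continues them along every path avoiding the singular locus ([jet_path]).

Reducibility comes from the shift operators: theta + a maps the solutions of
E_C(a,b,c) to those of E_C(a+1,b,c) ([FSol_shift]), and it commutes with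
continuation, so that kernels and images of products of such operators are
invariant subspaces.  As E_C(a,b,c) is symmetric in a and b, let a^I be the
integer.  Near the origin there are, for each J, the Frobenius solutions
x^e F_C(a^J,b^J) with e_k = 0 or 1 - c_k, and (theta+a) ... (theta+a+n-1)
multiplies the J-th one by the Pochhammer symbol (a^J)_n while raising a to
a + n.

If a^I = -n, the kernel of (theta+a) ... (theta+a+n) contains the I-th Frobenius
solution and no other one ([reducible_nonpos]).  If a^I = n+1, put
al = a - n - 1, so that al^I = 0, and take for invariant subspace the image
of D = (theta+al) ... (theta+al+n) on the solutions of E_C(al,b,c).  It is not
zero since D does not kill the J-th solution for J <> I.  It is proper: let v be
the I-th solution of E_C(al+1,b,c).  The product of the last n factors is
injective on the solutions of E_C(al+1,b,c) ([shifts_inj]), so a preimage under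
D of its value at v would be a solution g of E_C(al,b,c) with
(theta + al) g = v, which is impossible ([no_preimage]): its expansion at the
origin would involve a logarithm.  Both facts are obtained at a point of the
segment from the origin to the base point and carried to the latter by
continuation ([propagate_seg], [reducible_of_jets]). *)

Set Implicit Arguments.
Unset Strict Implicit.
Unset Printing Implicit Defensive.

Local Open Scope classical_set_scope.
Local Open Scope ring_scope.

(** * Modulus and geometrically dominated series *)

Section ComplexNorm.
Context {R : realType}.
Local Notation C := (Cplx R).
Implicit Types z w : C.

(** The modulus as an element of R, so that estimates are inequalities in a
real field. *)
Definition nrm (z : C) : R := Normc.normc (z : R[i]).

Lemma nrmE z : `|z| = (nrm z)%:C%C.
Proof. by []. Qed.

Lemma nrm0 : nrm 0 = 0. Proof. exact: Normc.normc0. Qed.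
Lemma nrm1 : nrm 1 = 1. Proof. exact: Normc.normc1. Qed.
Lemma nrmM z w : nrm (z * w) = nrm z * nrm w. Proof. exact: Normc.normcM. Qed.
Lemma nrmV z : nrm z^-1 = (nrm z)^-1. Proof. exact: Normc.normcV. Qed.
Lemma nrmD z w : nrm (z + w) <= nrm z + nrm w.
Proof. exact: le_normcD. Qed.
Lemma nrmN z : nrm (- z) = nrm z. Proof. exact: normcN. Qed.
Lemma nrmB z w : nrm (z - w) <= nrm z + nrm w.
Proof. by rewrite -(nrmN w); exact: nrmD. Qed.
Lemma nrm_ge0 z : 0 <= nrm z.
Proof. by rewrite -lecR -nrmE normr_ge0. Qed.
Lemma nrm_eq0 z : nrm z = 0 -> z = 0. Proof. exact: Normc.eq0_normc. Qed.
Lemma nrmX z n : nrm (z ^+ n) = nrm z ^+ n.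
Proof. by elim: n => [|n IH]; rewrite ?expr0 ?nrm1// !exprS nrmM IH. Qed.
Lemma nrm_real (x : R) : 0 <= x -> nrm x%:C%C = x.
Proof.
by move=> x0; apply: complexI; rewrite -nrmE ger0_norm// ler0c.
Qed.
Lemma nrm_nat n : nrm n%:R = n%:R.
Proof. by have := @nrm_real n%:R (ler0n _ n); rewrite rmorph_nat. Qed.
Lemma nrm_sum (I : Type) (r : seq I) (P : pred I) (F : I -> C) :
  nrm (\sum_(i <- r | P i) F i) <= \sum_(i <- r | P i) nrm (F i).
Proof.
elim/big_rec2: _ => [|i y1 y2 _ H]; first by rewrite nrm0.
by apply: le_trans (nrmD _ _) _; rewrite lerD2l.
Qed.
Lemma nrmC z w : nrm (z - w) = nrm (w - z).
Proof. by rewrite -nrmN opprB. Qed.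
Lemma nrm_tri z w t : nrm (z - t) <= nrm (z - w) + nrm (w - t).
Proof. by apply: le_trans (nrmD _ _); rewrite addrA subrK. Qed.

Lemma nrm_Re z : `|complex.Re z| <= nrm z.
Proof. by rewrite -lecR -nrmE normc_ge_Re. Qed.

Lemma nrm_Im z : `|complex.Im z| <= nrm z.
Proof.
case: z => x y; rewrite /nrm /= -sqrtr_sqr ler_wsqrtr//.
by rewrite lerDr sqr_ge0.
Qed.

Lemma nrm_ReIm z : nrm z <= `|complex.Re z| + `|complex.Im z|.
Proof.
case: z => x y; rewrite /nrm /=.
rewrite -[leRHS]ger0_norm ?addr_ge0// -sqrtr_sqr ler_wsqrtr// sqrrD !real_normK ?num_real//.
rewrite lerD2r lerDl -mulr_natl; do ![apply: mulr_ge0 => //].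
Qed.

Definition ccvg (u : nat -> C) (l : C) :=
  forall e : R, 0 < e -> exists N, forall n, (N <= n)%N -> nrm (u n - l) < e.

Lemma ccvg_unique u l l' : ccvg u l -> ccvg u l' -> l = l'.
Proof.
move=> ul ul'; apply/eqP; rewrite -subr_eq0; apply/eqP/nrm_eq0/eqP.
apply/negPn/negP => n0.
have e0 : 0 < nrm (l - l') / 2 by rewrite divr_gt0// lt_neqAle eq_sym n0 nrm_ge0.
have [N HN] := ul _ e0; have [N' HN'] := ul' _ e0.
have := HN (maxn N N') (leq_maxl _ _); have := HN' (maxn N N') (leq_maxr _ _).
set x := u _ => h1 h2.
have := nrm_tri l x l'; rewrite (nrmC l x); lra.
Qed.

Lemma ccvgD u v l l' : ccvg u l -> ccvg v l' ->
  ccvg (fun n => u n + v n) (l + l').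
Proof.
move=> ul vl e e0; have e2 : 0 < e / 2 by lra.
have [N HN] := ul _ e2; have [N' HN'] := vl _ e2.
exists (maxn N N') => n; rewrite geq_max => /andP[/HN h /HN' h'].
rewrite opprD addrACA; have := nrmD (u n - l) (v n - l'); lra.
Qed.

Lemma ccvgZ c u l : ccvg u l -> ccvg (fun n => c * u n) (c * l).
Proof.
move=> ul e e0; have c1 : 0 < nrm c + 1 by have := nrm_ge0 c; lra.
have e1 : 0 < e / (nrm c + 1) by rewrite divr_gt0.
have [N HN] := ul _ e1; exists N => n /HN.
rewrite -mulrBr nrmM ltr_pdivlMr// => h.
have := nrm_ge0 (u n - l); have := nrm_ge0 c; nra.
Qed.

Lemma ccvg_cst l : ccvg (fun=> l) l.
Proof. by move=> e e0; exists 0%N => n _; rewrite subrr nrm0. Qed.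

Lemma ccvg_le u l (B : R) N :
  ccvg u l -> (forall n, (N <= n)%N -> nrm (u n) <= B) -> nrm l <= B.
Proof.
move=> ul uB; rewrite leNgt; apply/negP => Bl.
have [N' HN] := ul (nrm l - B) ltac:(lra).
have := HN (maxn N N') (leq_maxr _ _); have := uB (maxn N N') (leq_maxl _ _).
set x := u _; have := nrm_tri l x 0; rewrite !subr0 (nrmC l x). by clear Bl; lra.
Qed.

Lemma geometric_small (e K : R) : 0 < e -> exists N, forall n, (N <= n)%N ->
  K * 2^-1 ^+ n < e.
Proof.
move=> e0; have K1 : 0 < `|K| + 1 by have := normr_ge0 K; lra.
have e1 : 0 < e / (`|K| + 1) by rewrite divr_gt0.
have c : (fun n => (2^-1 : R) ^+ n) @ \oo --> (0 : R).
  by apply: cvg_expr; rewrite ger0_norm; lra.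
have [N _ HN] := (@cvgrPdist_lt _ _ _ _ _ _ _).1 c _ e1.
exists N => n /HN /=; rewrite sub0r normrN ger0_norm ?exprn_ge0//.
rewrite ltr_pdivlMr// => h; have := ler_norm K.
have : 0 <= (2^-1 : R) ^+ n by rewrite exprn_ge0.
by nra.
Qed.

Lemma ccvg_near u v l (K : R) :
  (forall n, nrm (u n - v n) <= K * 2^-1 ^+ n) -> ccvg u l -> ccvg v l.
Proof.
move=> uv ul e e0; have e2 : 0 < e / 2 by lra.
have [N HN] := ul _ e2; have [N' HN'] := geometric_small K e2.
exists (maxn N N') => n; rewrite geq_max => /andP[/HN h /HN' h'].
have := nrm_tri (v n) (u n) l; rewrite (nrmC (v n) (u n)); have := uv n; lra.
Qed.

Definition psum (u : nat -> C) n := \sum_(i < n) u i.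

(** Domination by a geometric series of ratio 1/2 is the only convergence
criterion in use: all radii below are chosen so as to meet it. *)
Definition geo (K : R) (u : nat -> C) := forall n, nrm (u n) <= K * 2^-1 ^+ n.

(** The default value 0 is taken by divergent series. *)
Definition csum (u : nat -> C) : C := xget 0 [set l | ccvg (psum u) l].

Lemma csumE u l : ccvg (psum u) l -> csum u = l.
Proof. by move=> ul; apply: xget_unique => // l' /= /ccvg_unique; apply. Qed.

Lemma real_geo_cvg (K : R) (x : nat -> R) :
  (forall n, `|x n| <= K * 2^-1 ^+ n) ->
  exists l, forall e, 0 < e -> exists N, forall n, (N <= n)%N ->
   `|\sum_(i < n) x i - l| < e.
Proof.
move=> xK; have K0 : 0 <= K by have := xK 0%N; rewrite expr0; have := normr_ge0 (x 0%N); lra.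
have c : cvgn (series x).
  apply: normed_cvg; apply: (@series_le_cvg _ _ (geometric K (2^-1))) => //=.
  - by move=> n; rewrite mulr_ge0// exprn_ge0.
  - by apply: is_cvg_geometric_series; rewrite ger0_norm; lra.
exists (limn (series x)) => e e0.
have [N _ HN] := (@cvgrPdist_lt _ _ _ _ _ _ _).1 c _ e0.
by exists N => n /HN /=; rewrite distrC /series /= big_mkord.
Qed.

Lemma geo_cvg K u : geo K u -> exists l, ccvg (psum u) l.
Proof.
move=> uK.
have [x Hx] := real_geo_cvg (fun n => le_trans (nrm_Re (u n)) (uK n)).
have [y Hy] := real_geo_cvg (fun n => le_trans (nrm_Im (u n)) (uK n)).
exists (x +i* y)%C => e e0; have e2 : 0 < e / 2 by lra.
have [N HN] := Hx _ e2; have [N' HN'] := Hy _ e2.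
exists (maxn N N') => n; rewrite geq_max => /andP[/HN h /HN' h'].
apply: le_lt_trans (nrm_ReIm _) _.
have -> : complex.Re (psum u n - (x +i* y)%C : C) = \sum_(i < n) complex.Re (u i) - x.
  by rewrite raddfB /= raddf_sum.
have -> : complex.Im (psum u n - (x +i* y)%C : C) = \sum_(i < n) complex.Im (u i) - y.
  by rewrite raddfB /= raddf_sum.
by lra.
Qed.

Lemma csum_cvg K u : geo K u -> ccvg (psum u) (csum u).
Proof. by move=> /geo_cvg[l ul]; rewrite (csumE ul). Qed.

Lemma psum_le K u N k : geo K u ->
  nrm (\sum_(N <= i < N + k) u i) <= 2 * K * 2^-1 ^+ N.
Proof.
move=> uK.
suff : nrm (\sum_(N <= i < N + k) u i) <= 2 * K * 2^-1 ^+ N - 2 * K * 2^-1 ^+ (N + k).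
  have := uK (N + k)%N; have := nrm_ge0 (u (N + k)%N); lra.
elim: k => [|k IH]; first by rewrite addn0 big_geq// nrm0 subrr.
rewrite addnS big_nat_recr ?leq_addr//=.
have := nrmD (\sum_(N <= i < N + k) u i) (u (N + k)%N); have := uK (N + k)%N.
rewrite [2^-1 ^+ (N + k).+1]exprS; lra.
Qed.

Lemma csum_tail K u N : geo K u ->
  nrm (csum u - psum u N) <= 2 * K * 2^-1 ^+ N.
Proof.
move=> uK; have c := ccvgD (csum_cvg uK) (ccvg_cst (- psum u N)).
apply: (ccvg_le (N := N) c) => n /subnKC <-.
rewrite /psum -!(big_mkord xpredT) (big_cat_nat (n := N)) ?leq_addr//=.
by rewrite addrAC subrr add0r; exact: psum_le.
Qed.

Lemma csum_le K u : geo K u -> nrm (csum u) <= 2 * K.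
Proof. by move=> /(csum_tail 0); rewrite /psum big_ord0 subr0 expr0 mulr1. Qed.

Lemma csum_lin K K' c u v : geo K u -> geo K' v ->
  csum (fun n => c * u n + v n) = c * csum u + csum v.
Proof.
move=> uK vK; apply: csumE.
rewrite (_ : psum _ = (fun n => c * psum u n + psum v n)).
  by apply: ccvgD (csum_cvg vK); apply: ccvgZ; apply: csum_cvg uK.
by apply/funext => n; rewrite /psum big_split /= mulr_sumr.
Qed.

End ComplexNorm.

(** * Jets and Cauchy estimates *)

Section Jets.
Context {R : realType} {m : nat}.
Local Notation C := (Cplx R).
Local Notation Cm := 'rV[Cplx R]_m.
Local Notation A := (mpoly m (Cplx R)).
Implicit Types (P Q : A) (u v : A -> C) (h q : Cm) (w : seq 'I_m).

(** The variable d_k of A stands for the k-th partial derivation. *)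
Definition dvar (k : 'I_m) : A := mpolyX C (mnm1 k).
(** Monomials are indexed by words: a derivation prepends a letter, and
inductions on the order are inductions on the word. *)
Definition mon w : A := \prod_(i <- w) dvar i.

Lemma mon_nil : mon [::] = 1. Proof. by rewrite /mon big_nil. Qed.
Lemma mon_cons k w : mon (k :: w) = dvar k * mon w.
Proof. by rewrite /mon big_cons. Qed.
Lemma mon_cat w w' : mon (w ++ w') = mon w * mon w'.
Proof. by rewrite /mon big_cat. Qed.

Definition word_mnm w : multinom m := \big[mnm_add/mnm0]_(i <- w) mnm1 i.

Lemma monE w : mon w = mpolyX C (word_mnm w).
Proof.
elim: w => [|k w IH]; first by rewrite mon_nil /word_mnm big_nil mpolyX0.
by rewrite mon_cons IH /word_mnm big_cons mpolyXD.
Qed.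

Lemma word_mnmE w k : word_mnm w k = count_mem k w.
Proof.
elim: w => [|j w IH]; first by rewrite /word_mnm big_nil mnm0E.
by rewrite /word_mnm big_cons mnmDE -/(word_mnm w) IH mnm1E.
Qed.

Lemma word_mnm_surj (g : multinom m) : exists w, word_mnm w = g.
Proof.
exists (flatten [seq nseq (g i) i | i <- enum 'I_m]).
apply/mnmP => k; rewrite word_mnmE count_flatten -map_comp sumnE big_map big_enum /=.
rewrite (bigD1 k)//= count_nseq /= eqxx mul1n big1 ?addn0// => i ik.
by rewrite count_nseq /= (negbTE ik).
Qed.

Lemma mdeg_word_mnm w : mdeg (word_mnm w) = size w.
Proof.
elim: w => [|k w IH]; first by rewrite /word_mnm big_nil mdeg0.
by rewrite /word_mnm big_cons mdegD mdeg1 -/(word_mnm w) IH.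
Qed.

Lemma A_ind (Pr : A -> Prop) :
  Pr 0 -> (forall c P Q, Pr P -> Pr Q -> Pr (c *: P + Q)) ->
  (forall w, Pr (mon w)) -> forall P, Pr P.
Proof.
move=> P0 PD Pm; elim/mpolyind => // c g P _ _ PP.
by have [w <-] := word_mnm_surj g; rewrite -monE; apply: PD.
Qed.

(** A predicate on plain functions rather than a structure of linear maps, so
that sums and scalings of jets are the pointwise ones of A -> C. *)
Definition lin u := forall c P Q, u (c *: P + Q) = c * u P + u Q.

Section Lin.
Variable u : A -> C.
Hypothesis ul : lin u.
Lemma linD P Q : u (P + Q) = u P + u Q.
Proof. by have := ul 1 P Q; rewrite scale1r mul1r. Qed.
Lemma lin0 : u 0 = 0.
Proof. by have /eqP := linD 0 0; rewrite addr0 -subr_eq subrr => /eqP. Qed.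
Lemma linZ c P : u (c *: P) = c * u P.
Proof. by have := ul c P 0; rewrite !addr0 lin0 addr0. Qed.
Lemma linN P : u (- P) = - u P.
Proof. by rewrite -scaleN1r linZ mulN1r. Qed.
Lemma linB P Q : u (P - Q) = u P - u Q.
Proof. by rewrite linD linN. Qed.
Lemma lin_sum (I : Type) (r : seq I) (Pr : pred I) (F : I -> A) :
  u (\sum_(i <- r | Pr i) F i) = \sum_(i <- r | Pr i) u (F i).
Proof. exact: (big_morph u linD lin0). Qed.
Lemma linMn P n : u (P *+ n) = u P *+ n.
Proof. by rewrite -scaler_nat linZ mulr_natl. Qed.
End Lin.

Lemma lin_ext u v : lin u -> lin v -> (forall w, u (mon w) = v (mon w)) -> u = v.
Proof.
move=> ul vl uv; apply/funext; elim/A_ind => //.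
- by rewrite !lin0.
- by move=> c P Q HP HQ; rewrite ul vl HP HQ.
Qed.

Definition mulj P u : A -> C := fun Q => u (P * Q).

Lemma lin_mulj P u : lin u -> lin (mulj P u).
Proof. by move=> ul c Q Q'; rewrite /mulj mulrDr -scalerAr ul. Qed.

(** The directional derivative along h. *)
Definition lform h : A := \sum_k h 0 k *: dvar k.

Lemma lformD h h' : lform (h + h') = lform h + lform h'.
Proof. by rewrite -big_split; apply: eq_bigr => k _; rewrite mxE scalerDl. Qed.

Lemma lform0 : lform 0 = 0.
Proof. by rewrite /lform big1// => k _; rewrite mxE scale0r. Qed.

Definition l1norm h : R := \sum_k nrm (h 0 k).

Lemma l1norm_ge0 h : 0 <= l1norm h.
Proof. by apply: sumr_ge0 => k _; apply: nrm_ge0. Qed.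

Lemma l1normD h h' : l1norm (h + h') <= l1norm h + l1norm h'.
Proof.
by rewrite /l1norm -big_split; apply: ler_sum => k _; rewrite mxE; apply: nrmD.
Qed.

Lemma l1normN h : l1norm (- h) = l1norm h.
Proof. by apply: eq_bigr => k _; rewrite mxE nrmN. Qed.

Lemma l1norm0 : l1norm 0 = 0.
Proof. by rewrite /l1norm big1// => k _; rewrite mxE nrm0. Qed.

Lemma coord_le_l1norm h k : nrm (h 0 k) <= l1norm h.
Proof.
by rewrite /l1norm (bigD1 k)//= lerDl; apply: sumr_ge0 => j _; apply: nrm_ge0.
Qed.

(** The l1 norm is the one for which no multinomial coefficient appears: each
factor of the power contributes sum_k |h_k|. *)
Lemma lform_exp_le u h F n w : lin u ->
  (forall w', size w' = (n + size w)%N -> nrm (u (mon w')) <= F) ->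
  nrm (u (lform h ^+ n * mon w)) <= F * l1norm h ^+ n.
Proof.
move=> ul; elim: n w => [|n IH] w uF.
  by rewrite !expr0 mul1r mulr1; apply: uF.
have -> : lform h ^+ n.+1 * mon w = \sum_k h 0 k *: (lform h ^+ n * mon (k :: w)).
  rewrite exprSr -mulrA /lform mulr_suml mulr_sumr; apply: eq_bigr => k _.
  by rewrite mon_cons -scalerAl -scalerAr.
rewrite lin_sum//; apply: le_trans (nrm_sum _ _ _) _.
rewrite exprS mulrCA /l1norm mulr_suml; apply: ler_sum => k _.
rewrite linZ// nrmM ler_wpM2l ?nrm_ge0//; apply: IH => w' sw'.
by apply: uF; rewrite sw' addnS.
Qed.

Lemma fact_add_le (n k : nat) : ((n + k)`! <= 2 ^ (n + k) * (n`! * k`!))%N.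
Proof.
rewrite -(bin_fact (leq_addr k n)) addKn leq_mul2r.
rewrite -[2%N]/(1 + 1)%N expnDn (bigD1 (inord n : 'I_(n + k).+1))//=.
by rewrite inordK ?ltnS ?leq_addr// !exp1n !muln1 leq_addr orbT.
Qed.

(** The Cauchy estimate on derivatives of all orders.  The shift d of the order
makes room for a differential operator of order d without changing M, which
plays the role of an inverse radius of convergence. *)
Definition bd (M K : R) (d : nat) u := forall w,
  nrm (u (mon w)) <= K * M ^+ (size w + d) * (size w + d)`!%:R.

Definition Bd (M : R) u := exists K d, [/\ 0 <= K & bd M K d u].

Lemma bd_raise M K d d' u : 1 <= M -> 0 <= K -> (d <= d')%N ->
  bd M K d u -> bd M K d' u.
Proof.
move=> M1 K0 dd' uK w; apply: le_trans (uK w) _.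
rewrite -!mulrA ler_wpM2l// ler_pM ?exprn_ge0 ?ler0n ?(le_trans ler01)//.
- by rewrite ler_weXn2l// leq_add2l.
- by rewrite ler_nat leq_fact // leq_add2l.
Qed.

Lemma Bd_lin M c u v : 1 <= M -> Bd M u -> Bd M v ->
  Bd M (fun P => c * u P + v P).
Proof.
move=> M1 [K [d [K0 uK]]] [K' [d' [K0' vK]]].
exists (nrm c * K + K'), (maxn d d'); split.
  by rewrite addr_ge0// mulr_ge0// nrm_ge0.
move=> w; apply: le_trans (nrmD _ _) _; rewrite nrmM !mulrDl lerD//.
- rewrite -!mulrA ler_wpM2l ?nrm_ge0// mulrA.
  exact: (bd_raise M1 K0 (leq_maxl d d') uK).
- exact: (bd_raise M1 K0' (leq_maxr d d') vK).
Qed.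

Lemma Bd0 M : Bd M (fun=> 0).
Proof. by exists 0, 0%N; split => // w; rewrite nrm0 !mul0r. Qed.

Lemma Bd_mulj M P u : 1 <= M -> lin u -> Bd M u -> Bd M (mulj P u).
Proof.
move=> M1 ul uM; elim/A_ind: P.
- rewrite (_ : mulj 0 u = fun=> 0); first exact: Bd0.
  by apply/funext => Q; rewrite /mulj mul0r lin0.
- move=> c P Q HP HQ.
  rewrite (_ : mulj _ u = fun T => c * mulj P u T + mulj Q u T); first exact: Bd_lin.
  by apply/funext => T; rewrite /mulj mulrDl -scalerAl ul.
- move=> w; case: uM => K [d [K0 uK]]; exists K, (size w + d)%N; split => // w'.
  by rewrite /mulj -mon_cat; apply: le_trans (uK _) _; rewrite size_cat addnAC addnC addnA.
Qed.

Definition taylor_term u h n := u (lform h ^+ n) / n`!%:R.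
(** The value at q + h of the function whose jet at q is u. *)
Definition taylor u h := csum (taylor_term u h).
(** The jet at q + h of the function whose jet at q is u. *)
Definition reexp u h : A -> C := fun P => taylor (mulj P u) h.

(** The indices i and j belong to two successive directions of expansion and w
to the derivative taken afterwards.  The same bound serves for evaluation
(j = 0, w empty), for re-expansion (j = 0), and for the double series that
compares one expansion along h + h' with two successive ones. *)
Lemma taylor_term_le M K d u h h' w j i : lin u -> 0 <= M -> 0 <= K -> bd M K d u ->
  nrm (u (lform h' ^+ j * lform h ^+ i * mon w)) / (j`!%:R * i`!%:R) <=
  K * (2 * M) ^+ (size w + d) * (size w + d)`!%:R
   * (4 * M * l1norm h') ^+ j * (4 * M * l1norm h) ^+ i.
Proof.
move=> ul M0 K0 uK; set l := (size w + d)%N.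
set F : R := K * M ^+ (j + i + l) * (j + i + l)`!%:R.
have h1 : nrm (u (lform h' ^+ j * lform h ^+ i * mon w)) <= F * l1norm h' ^+ j * l1norm h ^+ i.
  have := @lform_exp_le (mulj (lform h' ^+ j) u) h (F * l1norm h' ^+ j) i w (lin_mulj _ ul).
  rewrite /mulj !mulrA; apply => w' sw'; apply: lform_exp_le => // w'' sw''.
  apply: le_trans (uK w'') _.
  by rewrite (_ : (size w'' + d = j + i + l)%N)// sw'' sw' /l !addnA.
have f0 : 0 < (j`!%:R * i`!%:R : R) by rewrite mulr_gt0// ltr0n fact_gt0.
rewrite ler_pdivrMr//; apply: le_trans h1 _.
have fl : ((j + i + l)`!%:R : R) <= 2 ^+ (j + i + l) * 2 ^+ (j + i) * (l`!%:R * (j`!%:R * i`!%:R)).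
  rewrite -!natrX -!natrM ler_nat; apply: leq_trans (fact_add_le _ _) _.
  rewrite -mulnA leq_mul2l [(l`! * _)%N]mulnC mulnA leq_mul2r; apply/orP; right.
  by apply/orP; right; apply: fact_add_le.
rewrite (_ : _ * (j`!%:R * i`!%:R) =
  K * M ^+ (j + i + l) * (2 ^+ (j + i + l) * 2 ^+ (j + i) * (l`!%:R * (j`!%:R * i`!%:R))) *
    l1norm h' ^+ j * l1norm h ^+ i).
  rewrite !ler_wpM2r ?exprn_ge0 ?l1norm_ge0// ler_wpM2l// mulr_ge0// exprn_ge0//.
rewrite !exprMn !exprD (_ : 4 = 2 * 2)%R; last by rewrite -natrM.
by rewrite !exprMn; ring.
Qed.

End Jets.

(** * Re-expansion at a nearby point *)

Section Reexpansion.
Context {R : realType} {m : nat}.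
Local Notation C := (Cplx R).
Local Notation Cm := 'rV[Cplx R]_m.
Local Notation A := (mpoly m (Cplx R)).
Implicit Types (P Q : A) (u v : A -> C) (h q : Cm) (w : seq 'I_m).

Lemma exp_half (x : R) n : 0 <= x -> x <= 2^-1 -> x ^+ n <= 2^-1 ^+ n.
Proof. by move=> x0 x1; rewrite lerXn2r// nnegrE. Qed.

Lemma taylor_term_geo M K d u h : 0 <= M -> lin u -> 0 <= K -> bd M K d u ->
  8 * M * l1norm h <= 1 -> geo (K * (2 * M) ^+ d * d`!%:R) (taylor_term u h).
Proof.
move=> M0 ul K0 uK Mh n; have := @taylor_term_le _ _ M K d u h 0 [::] 0%N n ul M0 K0 uK.
rewrite /taylor_term mon_nil mulr1 !expr0 !mul1r mulr1 /= add0n nrmM nrmV nrm_nat.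
move=> H; apply: le_trans H _; rewrite ler_wpM2l//.
  by rewrite !mulr_ge0// exprn_ge0// mulr_ge0.
have := l1norm_ge0 h => ?; apply: exp_half; first by rewrite !mulr_ge0.
lra.
Qed.

Lemma Bd_taylor_geo M u h : 0 <= M -> lin u -> Bd M u -> 8 * M * l1norm h <= 1 ->
  exists K, geo K (taylor_term u h).
Proof.
by move=> M0 ul [K [d [K0 uK]]] Mh; exists (K * (2 * M) ^+ d * d`!%:R); apply: taylor_term_geo.
Qed.

Lemma taylor_cvg M u h : 0 <= M -> lin u -> Bd M u -> 8 * M * l1norm h <= 1 ->
  ccvg (psum (taylor_term u h)) (taylor u h).
Proof. by move=> M0 ul uM /(Bd_taylor_geo M0 ul uM)[K]; apply: csum_cvg. Qed.

Lemma taylor_lin M c u v h : 1 <= M -> lin u -> lin v -> Bd M u -> Bd M v ->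
  8 * M * l1norm h <= 1 -> taylor (fun P => c * u P + v P) h = c * taylor u h + taylor v h.
Proof.
move=> M1 ul vl uM vM Mh; have M0 := le_trans ler01 M1.
have [K uK] := Bd_taylor_geo M0 ul uM Mh; have [K' vK] := Bd_taylor_geo M0 vl vM Mh.
rewrite /taylor -(csum_lin _ uK vK); congr csum; apply/funext => n.
by rewrite /taylor_term mulrDl mulrA.
Qed.

Lemma lin_reexp M u h : 1 <= M -> lin u -> Bd M u -> 8 * M * l1norm h <= 1 -> lin (reexp u h).
Proof.
move=> M1 ul uM Mh c P Q; rewrite /reexp -(taylor_lin (M := M))//; try exact: lin_mulj;
  try exact: Bd_mulj.
by congr (taylor _ h); apply/funext => T; rewrite /mulj mulrDl -scalerAl ul.
Qed.

Lemma reexp_bd M K d u h : 1 <= M -> lin u -> 0 <= K -> bd M K d u ->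
  8 * M * l1norm h <= 1 -> bd (2 * M) (2 * K) d (reexp u h).
Proof.
move=> M1 ul K0 uK Mh w; have M0 := le_trans ler01 M1; rewrite /reexp /taylor -!mulrA;
  apply: csum_le => n.
have := @taylor_term_le _ _ M K d u h 0 w 0%N n ul M0 K0 uK.
rewrite /taylor_term /mulj !expr0 !mul1r mulr1 nrmM nrmV nrm_nat (mulrC (mon w)).
move=> H; apply: le_trans H _; rewrite !mulrA ler_wpM2l//.
  by rewrite !mulr_ge0// exprn_ge0// mulr_ge0.
have := l1norm_ge0 h => ?; apply: exp_half; first by rewrite !mulr_ge0.
lra.
Qed.

Lemma Bd_reexp M u h : 1 <= M -> lin u -> Bd M u -> 8 * M * l1norm h <= 1 ->
  Bd (2 * M) (reexp u h).
Proof.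
move=> M1 ul [K [d [K0 uK]]] Mh; exists (2 * K), d; split; first by rewrite mulr_ge0.
exact: reexp_bd.
Qed.

Lemma triangle_sum (F : nat -> nat -> C) T :
  \sum_(N < T) \sum_(j < N.+1) F j (N - j)%N = \sum_(j < T) \sum_(i < T - j) F j i.
Proof.
elim: T => [|T IH]; first by rewrite !big_ord0.
rewrite big_ord_recr /= IH [RHS]big_ord_recr /= subSnn [X in _ = _ + X]big_ord1 /=.
rewrite [\sum_(j < T.+1) F j _]big_ord_recr /= subnn addrA -big_split /=; congr (_ + _).
by apply: eq_bigr => j _; rewrite subSn 1?ltnW// big_ord_recr.
Qed.

(** Both sides sum the same double series: the partial sums of the left-hand
side run over triangles i + j < T, those of the right-hand side over strips
j < T, and the tail missing from the j-th row is of size 2^-(T-j) 4^-j. *)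
Lemma taylor_comp M u h h' : 1 <= M -> lin u -> Bd M u ->
  16 * M * l1norm h <= 1 -> 16 * M * l1norm h' <= 1 -> taylor u (h + h') = taylor (reexp u h) h'.
Proof.
move=> M1 ul uM Mh Mh'; have M0 := le_trans ler01 M1.
have h0 := l1norm_ge0 h; have h'0 := l1norm_ge0 h'.
have Mhh : 8 * M * l1norm (h + h') <= 1.
  by have := ler_wpM2l M0 (l1normD h h'); lra.
have Mh8 : 8 * M * l1norm h <= 1 by have := mulr_ge0 M0 h0; lra.
have [K [d [K0 uK]]] := uM.
pose F j i := u (lform h' ^+ j * lform h ^+ i) / (j`!%:R * i`!%:R).
pose K1 := K * (2 * M) ^+ d * d`!%:R.
have K10 : 0 <= K1 by rewrite !mulr_ge0// exprn_ge0// mulr_ge0.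
have FK j : geo (K1 * 4^-1 ^+ j) (F j).
  move=> i; have := @taylor_term_le _ _ M K d u h h' [::] j i ul M0 K0 uK.
  rewrite mon_nil mulr1 add0n /F nrmM nrmV nrmM !nrm_nat => H.
  have x0 : 0 <= 4 * M * l1norm h' by rewrite !mulr_ge0.
  have y0 : 0 <= 4 * M * l1norm h by rewrite !mulr_ge0.
  apply: le_trans H _; rewrite -/K1 -(mulrA K1) -(mulrA K1) ler_wpM2l//.
  rewrite ler_pM ?exprn_ge0// lerXn2r ?nnegrE//; lra.
clearbody K1; symmetry; apply: csumE; apply: (ccvg_near (u := psum (taylor_term u (h + h'))) (K
  := 4 * K1)); last exact: taylor_cvg Mhh.
move=> T.
have -> : psum (taylor_term u (h + h')) T = \sum_(j < T) \sum_(i < T - j) F j i.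
  rewrite -triangle_sum /psum; apply: eq_bigr => N _.
  rewrite /taylor_term lformD exprDn lin_sum// mulr_suml; apply: eq_bigr => j _.
  have jN : (j <= N)%N by rewrite -ltnS.
  rewrite linMn// -(mulr_natr _ 'C(N, j)) /F [lform h' ^+ _ * _]mulrC -mulrA; congr (u _ * _).
  rewrite -(bin_fact jN) !natrM invfM mulrA divff ?mul1r//.
  by rewrite pnatr_eq0 -lt0n bin_gt0.
have -> : psum (taylor_term (reexp u h) h') T = \sum_(j < T) csum (F j).
  apply: eq_bigr => j _; rewrite /taylor_term /reexp /taylor.
  have uM' : Bd M (mulj (lform h' ^+ j) u) by apply: Bd_mulj.
  have [K' gK'] := @Bd_taylor_geo M _ h M0 (lin_mulj (lform h' ^+ j) ul) uM' Mh8.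
  have := @csum_lin _ K' 0 (j`!%:R)^-1 _ (fun=> 0) gK' => H.
  have {H} := H (fun n => ltac:(by rewrite nrm0 mul0r)).
  rewrite (_ : csum (fun=> 0) = 0); last first.
    by apply: csumE; rewrite (_ : psum _ = fun=> 0); [exact: ccvg_cst|apply/funext => n;
      rewrite /psum big1].
  rewrite addr0 mulrC => <-; congr csum; apply/funext => i.
  by rewrite addr0 /taylor_term /F /mulj invfM mulrCA mulrA mulrC !mulrA.
rewrite -sumrB; apply: le_trans (nrm_sum _ _ _) _.
apply: (@le_trans _ _ (\sum_(j < T) 2 * K1 * 2^-1 ^+ T * 2^-1 ^+ j)).
  apply: ler_sum => j _; rewrite nrmC.
  apply: le_trans (csum_tail (T - j) (FK j)) _; rewrite -!mulrA ler_wpM2l//.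
  rewrite ler_wpM2l// (_ : 2^-1 ^+ T = 2^-1 ^+ (T - j) * 2^-1 ^+ j).
    rewrite (_ : 4^-1 = 2^-1 * 2^-1 :> R); last by lra.
    by rewrite exprMn mulrC mulrA.
  by rewrite -exprD subnK// ltnW.
rewrite -mulr_sumr.
have : \sum_(j < T) (2^-1 : R) ^+ j <= 2.
  suff -> : \sum_(j < T) (2^-1 : R) ^+ j = 2 - 2 * 2^-1 ^+ T.
    by have : 0 <= (2^-1 : R) ^+ T; [rewrite exprn_ge0|lra].
  elim: (T) => [|n IH]; first by rewrite big_ord0 expr0; lra.
  by rewrite big_ord_recr /= IH exprS; lra.
have : 0 <= K1 * (2^-1 : R) ^+ T by rewrite mulr_ge0 // exprn_ge0.
by move=> /(ler_wpM2l (x := K1 * 2^-1 ^+ T)) H /H; lra.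
Qed.

Lemma mulj_mulj P Q u : mulj Q (mulj P u) = mulj (P * Q) u.
Proof. by apply/funext => T; congr (u _); exact: mulrA. Qed.

Lemma mulj_reexp P u h : mulj P (reexp u h) = reexp (mulj P u) h.
Proof.
apply/funext => Q.
rewrite -[LHS]/(taylor (mulj (P * Q) u) h) -[RHS]/(taylor (mulj Q (mulj P u)) h).
by rewrite mulj_mulj.
Qed.

Lemma reexp_comp M u h h' : 1 <= M -> lin u -> Bd M u ->
  16 * M * l1norm h <= 1 -> 16 * M * l1norm h' <= 1 -> reexp u (h + h') = reexp (reexp u h) h'.
Proof.
move=> M1 ul uM Mh Mh'; apply/funext => P; rewrite -[LHS]/(taylor (mulj P u) (h + h'))
  -[RHS]/(taylor (mulj P (reexp u h)) h') mulj_reexp.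
by apply: (taylor_comp (M := M)) => //; [exact: lin_mulj|exact: Bd_mulj].
Qed.

Lemma psum_shift (v : nat -> C) n :
  psum (fun n => if n is n'.+1 then v n' else 0) n.+1 = psum v n.
Proof. by rewrite /psum big_ord_recl /= add0r. Qed.

Lemma S0 u : lin u -> taylor u 0 = u 1.
Proof.
move=> ul; apply: csumE => e e0; exists 1%N => -[//|n] _.
rewrite /psum big_ord_recl big1 ?addr0 => [|i _]; rewrite /taylor_term lform0.
  by rewrite expr0 fact0 divr1 subrr nrm0.
by rewrite expr0n /= lin0// mul0r.
Qed.

Lemma reexp0 u : lin u -> reexp u 0 = u.
Proof.
by move=> ul; apply/funext => P; rewrite /reexp S0; [rewrite /mulj mulr1|exact: lin_mulj].
Qed.

(** Derivation of the function, read on its jet. *)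
Definition dd (k : 'I_m) u : A -> C := fun P => u (dvar k * P).
(** Multiplication by the coordinate x_k, read on the jet at q: the second
summand is the Leibniz rule P x_k = x_k P + dP / d(d_k). *)
Definition xx q (k : 'I_m) u : A -> C := fun P => q 0 k * u P + u (mderiv k P).

Lemma dd_mulj k u : dd k u = mulj (dvar k) u. Proof. by []. Qed.

Lemma lin_dd k u : lin u -> lin (dd k u). Proof. exact: lin_mulj. Qed.

Lemma lin_xx q k u : lin u -> lin (xx q k u).
Proof.
move=> ul c P Q; rewrite /xx linearP /= !ul; ring.
Qed.

Lemma reexp_dd k u h : reexp (dd k u) h = dd k (reexp u h).
Proof. by rewrite !dd_mulj mulj_reexp. Qed.

Lemma mderiv_dvar k j : mderiv k (dvar j) = (k == j)%:R :> A.
Proof.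
rewrite /dvar mderivX mnm1E eq_sym; case: eqP => [->|_]; last by rewrite scale0r.
by rewrite -[X in mnm_sub X _]add0m addmK mpolyX0 scale1r.
Qed.

Lemma mderiv_1 k : mderiv k (1 : A) = 0.
Proof. by rewrite -mpolyC1 mderivC. Qed.

Lemma mderiv_exp0 k P : mderiv k (P ^+ 0) = 0.
Proof. by rewrite expr0 mderiv_1. Qed.

Lemma mderiv_lform k h : mderiv k (lform h) = (h 0 k)%:A.
Proof.
rewrite /lform raddf_sum (bigD1 k)//= big1 ?addr0 => [|j jk]; rewrite mderivZ mderiv_dvar.
  by rewrite eqxx.
by rewrite eq_sym (negbTE jk) scaler0.
Qed.

Lemma mderiv_exp k P n : mderiv k (P ^+ n.+1) = mderiv k P * P ^+ n *+ n.+1.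
Proof.
elim: n => [|n IH]; first by rewrite expr0 mulr1 expr1.
by rewrite exprS mderivM IH mulrnAr mulrCA -exprS -mulrS.
Qed.

(** The coordinate takes the value q_k + h_k at the new centre; the term in h_k
comes from the Leibniz summand, as the derivative of lform h ^+ n / n! with
respect to d_k is h_k times the preceding term of the series. *)
Lemma reexp_xx M q k u h : 1 <= M -> lin u -> Bd M u -> 8 * M * l1norm h <= 1 ->
  reexp (xx q k u) h = xx (q + h) k (reexp u h).
Proof.
move=> M1 ul uM Mh; have M0 := le_trans ler01 M1; apply/funext => P.
have [K1 g1] := Bd_taylor_geo M0 (lin_mulj P ul) (Bd_mulj P M1 ul uM) Mh.
have [K2 g2] := Bd_taylor_geo M0 (lin_mulj (mderiv k P) ul) (Bd_mulj (mderiv k P) M1 ul uM) Mh.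
have c1 := csum_cvg g1; have c2 := csum_cvg g2.
have c3 : ccvg (psum (fun n => if n is n'.+1 then taylor_term (mulj P u) h n' else 0)) (csum
  (taylor_term (mulj P u) h)).
  by move=> e /c1[N HN]; exists N.+1 => -[//|n] Nn; rewrite psum_shift; apply: HN.
have c := ccvgD (ccvgD (ccvgZ (q 0 k) c1) c2) (ccvgZ (h 0 k) c3).
rewrite -[LHS]/(csum (taylor_term (mulj P (xx q k u)) h)).
rewrite -[RHS]/((q + h) 0 k * csum (taylor_term (mulj P u) h) + csum (taylor_term (mulj (mderiv
  k P) u) h)).
apply: csumE; rewrite mxE mulrDl addrAC; move: c; congr (ccvg _ _).
apply/funext => n; rewrite /psum !mulr_sumr -!big_split /=; apply: eq_bigr => -[i _] _ /=.
rewrite -[taylor_term (mulj P (xx q k u)) h i]/((q 0 k * u (P * lform h ^+ i) + u (mderiv k (P *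
  lform h ^+ i))) / i`!%:R).
rewrite -[taylor_term (mulj P u) h i]/(u (P * lform h ^+ i) / i`!%:R).
rewrite -[taylor_term (mulj (mderiv k P) u) h i]/(u (mderiv k P * lform h ^+ i) / i`!%:R).
rewrite mderivM (linD ul); case: i => [|i].
  have E0 : u (P * mderiv k (lform h ^+ 0)) = 0 by rewrite mderiv_exp0 mulr0 lin0.
  rewrite E0.
  move: (u _) (u _) (q 0 k) (h 0 k) => x y s t.
  by rewrite (mulr0 t) !addr0 mulrDl (mulrA s).
rewrite -[taylor_term (mulj P u) h i]/(u (P * lform h ^+ i) / i`!%:R).
rewrite mderiv_exp mderiv_lform mulr_algl.
have -> : P * (h 0 k *: lform h ^+ i *+ i.+1) = h 0 k *: (P * lform h ^+ i) *+ i.+1.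
  by rewrite mulrnAr -scalerAr.
rewrite (linMn ul) (linZ ul) -(mulr_natr _ i.+1) factS natrM invfM.
have : (i.+1%:R : C) != 0 by rewrite pnatr_eq0.
move: (u _) (u _) (u _) (i`!%:R^-1 : C) (i.+1%:R : C) (h 0 k) (q 0 k) => x y z f g s t g0.
rewrite (mulrDl (t * z)) (mulrDl y) -(mulrA t z) -[LHS]addrA; congr (_ + (_ + _)).
by rewrite -(mulrA (s * x) g) (mulVKf g0) -mulrA.
Qed.

End Reexpansion.

(** * The Weyl algebra acting on jets *)

Section Weyl.
Context {R : realType} {m : nat}.
Local Notation C := (Cplx R).
Local Notation Cm := 'rV[Cplx R]_m.
Local Notation A := (mpoly m (Cplx R)).
Implicit Types (P Q : A) (u v : A -> C) (h q : Cm) (w : seq 'I_m).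

Lemma jetD u v P : (u + v) P = u P + v P. Proof. by []. Qed.
Lemma jetZ (c : C) u P : (c *: u) P = c * u P. Proof. by []. Qed.
Lemma jetN u P : (- u) P = - u P. Proof. by []. Qed.
Lemma jet0 P : (0 : A -> C) P = 0. Proof. by []. Qed.
Definition jetE := (jetD, jetZ, jetN, jet0).
Lemma jet_sum (I : Type) (r : seq I) (F : I -> A -> C) P :
  (\sum_(i <- r) F i) P = \sum_(i <- r) F i P.
Proof. by elim: r => [|i r IH]; rewrite ?big_nil// !big_cons jetD IH. Qed.

Definition th q k u : A -> C := xx q k (dd k u).
Definition TH q u : A -> C := \sum_k th q k u.

Lemma ddD k u v : dd k (u + v) = dd k u + dd k v. Proof. by []. Qed.
Lemma ddZ k (c : C) u : dd k (c *: u) = c *: dd k u. Proof. by []. Qed.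
Lemma xxD q k u v : xx q k (u + v) = xx q k u + xx q k v.
Proof. by apply: funext => P; rewrite jetD /xx !jetD; ring. Qed.
Lemma xxZ q k (c : C) u : xx q k (c *: u) = c *: xx q k u.
Proof. by apply: funext => P; rewrite jetZ /xx !jetZ; ring. Qed.
Lemma xx0 q k : xx q k 0 = 0.
Proof. by rewrite -[X in xx _ _ X](scale0r 0) xxZ scale0r. Qed.
Lemma thD q k u v : th q k (u + v) = th q k u + th q k v.
Proof. by rewrite /th ddD xxD. Qed.
Lemma thZ q k (c : C) u : th q k (c *: u) = c *: th q k u.
Proof. by rewrite /th ddZ xxZ. Qed.
Lemma th0 q k : th q k 0 = 0.
Proof. by rewrite -[X in th _ _ X](scale0r 0) thZ scale0r. Qed.
Lemma THD q u v : TH q (u + v) = TH q u + TH q v.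
Proof. by rewrite /TH -big_split; apply: eq_bigr => k _; exact: thD. Qed.
Lemma THZ q (c : C) u : TH q (c *: u) = c *: TH q u.
Proof. by rewrite /TH scaler_sumr; apply: eq_bigr => k _; exact: thZ. Qed.
Lemma TH0 q : TH q 0 = 0.
Proof. by rewrite -[X in TH _ X](scale0r 0) THZ scale0r. Qed.

Lemma lin_comb c u v : lin u -> lin v -> lin (c *: u + v).
Proof.
by move=> ul vl d P Q; rewrite !jetE ul vl; ring.
Qed.
Lemma lin_zero : lin (0 : A -> C).
Proof. by move=> c P Q; rewrite !jetE mulr0 addr0. Qed.
Lemma lin_add u v : lin u -> lin v -> lin (u + v).
Proof. by move=> ul vl; rewrite -[u]scale1r; apply: lin_comb. Qed.
Lemma lin_scale c u : lin u -> lin (c *: u).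
Proof. by move=> ul; rewrite -[X in lin X]addr0; apply: lin_comb => //; apply: lin_zero. Qed.
Lemma lin_th q k u : lin u -> lin (th q k u).
Proof. by move=> ul; apply/lin_xx/lin_dd. Qed.
Lemma lin_big (I : Type) (r : seq I) (F : I -> A -> C) :
  (forall i, lin (F i)) -> lin (\sum_(i <- r) F i).
Proof.
move=> Fl; elim/big_ind: _ => //; first exact: lin_zero.
by move=> *; apply: lin_add.
Qed.
Lemma lin_TH q u : lin u -> lin (TH q u).
Proof. by move=> ul; apply: lin_big => k; apply: lin_th. Qed.

Lemma ddC j k u : dd j (dd k u) = dd k (dd j u).
Proof. by apply/funext => P; rewrite /dd mulrCA. Qed.

Lemma xxC q j k u : lin u -> xx q j (xx q k u) = xx q k (xx q j u).
Proof. by move=> ul; apply/funext => P; rewrite /xx mderiv_comm; ring. Qed.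

Lemma dd_xx q j k u : lin u ->
  dd j (xx q k u) = xx q k (dd j u) + (if j == k then u else 0).
Proof.
move=> ul; apply/funext => P; rewrite jetD /dd /xx mderivM mderiv_dvar (linD ul) eq_sym.
by case: (j == k); rewrite ?mul1r ?mul0r ?(lin0 ul) ?jet0; ring.
Qed.

Lemma th_xx q j k u : lin u ->
  th q j (xx q k u) = xx q k (th q j u) + (if j == k then xx q k u else 0).
Proof.
move=> ul; rewrite /th (dd_xx _ _ _ ul) xxD xxC; last exact: lin_dd.
by congr (_ + _); case: (altP (j =P k)) => [->|_] //; exact: xx0.
Qed.

Lemma TH_xx q k u : lin u -> TH q (xx q k u) = xx q k (TH q u) + xx q k u.
Proof.
move=> ul; rewrite /TH (eq_bigr _ (fun j _ => th_xx q j k ul)) big_split /=.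
rewrite (big_morph (xx q k) (xxD q k) (xx0 q k)); congr (_ + _).
by rewrite -big_mkcond big_pred1_eq.
Qed.

Lemma th_dd q j k u : lin u ->
  th q j (dd k u) = dd k (th q j u) - (if j == k then dd k u else 0).
Proof.
move=> ul; rewrite /th (dd_xx q k j (lin_dd j ul)) ddC eq_sym.
case: (altP (j =P k)) => [->|_]; first by rewrite addrK.
by rewrite addr0 subr0.
Qed.

Lemma thC q j k u : lin u -> th q j (th q k u) = th q k (th q j u).
Proof.
move=> ul; rewrite [th q k u]/th (th_xx _ _ _ (lin_dd k ul)) (th_dd _ _ _ ul).
rewrite xxD /th; case: (j == k); last by rewrite oppr0 xx0 !addr0.
by rewrite -[X in _ + xx _ _ X + _]scaleN1r xxZ scaleN1r subrK.
Qed.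

Lemma TH_th q k u : lin u -> TH q (th q k u) = th q k (TH q u).
Proof.
move=> ul; rewrite /TH (big_morph (th q k) (thD q k) (th0 q k)).
by apply: eq_bigr => j _; rewrite (thC _ _ _ ul).
Qed.

(** Formal power series solutions of E_C(a,b,c) at q, as jets. *)
Definition FSol q (a b : C) (c : 'I_m -> C) u := lin u /\ forall k,
  th q k (th q k u + (c k - 1) *: u) =
  xx q k (TH q (TH q u + b *: u) + a *: (TH q u + b *: u)).

Lemma TH2E q (a b : C) u : TH q (TH q u + b *: u) + a *: (TH q u + b *: u) =
  TH q (TH q u + a *: u) + b *: (TH q u + a *: u).
Proof. by rewrite !(THD, THZ); apply/funext => P; rewrite !jetE; ring. Qed.

Lemma FSol_sym q a b c u : FSol q a b c u <-> FSol q b a c u.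
Proof. by split=> -[ul H]; split=> // k; rewrite H TH2E. Qed.

Lemma lin_THs q (a : C) u : lin u -> lin (TH q u + a *: u).
Proof. by move=> ul; apply: lin_add; [exact: lin_TH|exact: lin_scale]. Qed.

Lemma shift_exchange (V : lmodType C) (x y z t : V) (a c : C) :
  (x + a *: y) + c *: (z + a *: t) = (x + c *: z) + a *: (y + c *: t).
Proof. by rewrite !scalerDr !scalerA [a * c]mulrC addrACA. Qed.

(** The operator theta + a commutes with theta_k (theta_k + c_k - 1), and moving
it past x_k replaces it by theta + a + 1. *)
Lemma FSol_shift q a b c u : FSol q a b c u -> FSol q (a + 1) b c (TH q u + a *: u).
Proof.
move=> [ul H]; have vl := lin_THs q a ul.
split=> // k; set v := TH q u + a *: u.
have wl := lin_THs q b vl; rewrite -/v in wl.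
have E : th q k (th q k v + (c k - 1) *: v) =
   TH q (th q k (th q k u + (c k - 1) *: u)) + a *: th q k (th q k u + (c k - 1) *: u).
  have ul' : lin (th q k u + (c k - 1) *: u) by apply: lin_add; [exact: lin_th|exact: lin_scale].
  have v1 : th q k v = th q k (TH q u) + a *: th q k u by rewrite thD thZ.
  rewrite (TH_th _ _ ul') (THD q (th q k u)) (TH_th _ _ ul) (THZ q (c k - 1)).
  rewrite !(thD q k (th q k _)) v1 (thD q k (th q k _)) !(thZ q k (c k - 1)) v1 (thZ q k a).
  exact: shift_exchange.
rewrite E H TH2E -/v (TH_xx _ _ wl) -xxZ -!xxD; congr (xx _ _ _).
by apply/funext => P; rewrite !jetE; ring.
Qed.

End Weyl.

(** * Cauchy estimates for differential operators *)

Section Symbol.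
Context {R : realType} {m : nat}.
Local Notation C := (Cplx R).
Local Notation Cm := 'rV[Cplx R]_m.
Local Notation A := (mpoly m (Cplx R)).
Implicit Types (P Q : A) (u v : A -> C) (h q : Cm) (w : seq 'I_m).

Lemma mderiv_mon k w :
  mderiv k (mon w) = (count_mem k w)%:R *: mon (rem k w) :> A.
Proof.
rewrite !monE mderivX word_mnmE; case: (posnP (count_mem k w)) => [->|k0];
  first by rewrite !scale0r.
congr (_ *: mpolyX _ _); apply/mnmP => j; rewrite mnmBE !word_mnmE mnm1E count_rem.
by have -> : k \in w by rewrite -has_pred1 has_count.
Qed.

(** Multiplication by x_k - q_k.  It lowers the order of derivatives by one, hence
counts as a term of lower order. *)
Definition dl (k : 'I_m) u : A -> C := fun P => u (mderiv k P).

Lemma lin_dl k u : lin u -> lin (dl k u).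
Proof. by move=> ul c P Q; rewrite /dl linearP ul. Qed.

Lemma xx_dl q k u : xx q k u = q 0 k *: u + dl k u. Proof. by []. Qed.

(** The Cauchy estimate for orders below N only, as it is available in the course
of an induction on the order. *)
Definition bdN (N : nat) (M K : R) (d : nat) u := forall w,
  (size w + d < N)%N ->
  nrm (u (mon w)) <= K * M ^+ (size w + d) * (size w + d)`!%:R.

Section bdN.
Variables (M : R) (M1 : 1 <= M).
Let M0 : 0 < M. Proof. exact: lt_le_trans ltr01 M1. Qed.

Lemma bdN_weaken N N' K K' d u : (N' <= N)%N -> K <= K' ->
  bdN N M K d u -> bdN N' M K' d u.
Proof.
move=> NN KK uK w wN; apply: le_trans (uK w (leq_trans wN NN)) _.
by rewrite -!mulrA ler_wpM2r// mulr_ge0// exprn_ge0// ltW.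
Qed.

Lemma bdN_dd N K d k u : bdN N M K d u -> bdN N M K d.+1 (dd k u).
Proof.
move=> uK w; rewrite addnS -addSn => wN.
by rewrite /dd -mon_cons; apply: (uK (k :: w)).
Qed.

(** The multiplicity of k in w is absorbed by one factor of the factorial; the
accompanying power of M is then a gain. *)
Lemma bdN_dl N K d k u : lin u -> 0 <= K -> bdN N M K d u ->
  bdN N.+1 M (K / M) d (dl k u).
Proof.
move=> ul K0 uK w wN; rewrite /dl mderiv_mon linZ// nrmM nrm_nat.
have cw := count_size (pred1 k) w.
case: (posnP (count_mem k w)) => [->|k0].
  by rewrite mul0r !mulr_ge0 ?invr_ge0 ?exprn_ge0// ltW.
have kw : k \in w by rewrite -has_pred1 has_count.
move: cw wN (size_rem kw); case: (size w) => [|n] cw wN sn; first by lia.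
have := uK (rem k w); rewrite sn /= => /(_ ltac:(lia)) H.
apply: le_trans (ler_pM (ler0n _ _) (nrm_ge0 _) (_ : _ <= n.+1%:R) H) _.
  by rewrite ler_nat.
rewrite addSn factS exprS natrM (_ : K / M * (M * _) = K * M ^+ (n + d)); last first.
  by rewrite mulrA divfK// gt_eqF.
rewrite mulrCA ler_wpM2l ?mulr_ge0 ?exprn_ge0 ?(ltW M0)//.
by rewrite ler_wpM2r// ler_nat ltnS leq_addr.
Qed.

(** Regarding an operator as one of higher order gains 1/M as well. *)
Lemma bdN_raise N K d u : 0 <= K -> bdN N M K d u -> bdN N.+1 M (K / M) d.+1 u.
Proof.
move=> K0 uK w wN; apply: le_trans (uK w _) _; first by lia.
rewrite addnS factS exprS natrM (_ : K / M * (M * _) = K * M ^+ (size w + d)); last first.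
  by rewrite mulrA divfK// gt_eqF.
rewrite ler_wpM2l ?mulr_ge0 ?exprn_ge0 ?(ltW M0)//.
by rewrite -natrM ler_nat leq_pmull.
Qed.

Lemma bdN_add N K K' d u v : bdN N M K d u -> bdN N M K' d v ->
  bdN N M (K + K') d (u + v).
Proof.
move=> uK vK w wN; rewrite jetD; apply: le_trans (nrmD _ _) _.
by rewrite !mulrDl lerD//; [exact: uK|exact: vK].
Qed.

Lemma bdN_scale N K B d (c : C) u : nrm c <= B -> 0 <= K -> bdN N M K d u ->
  bdN N M (B * K) d (c *: u).
Proof.
move=> cB K0 uK w wN; rewrite jetZ nrmM -!mulrA ler_pM ?nrm_ge0//.
by rewrite mulrA; exact: uK.
Qed.

Lemma bd_bdN K d u : bd M K d u <-> forall N, bdN N M K d u.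
Proof. by split => [uK N w _|uK w]; [exact: uK|apply: (uK (size w + d).+1)]. Qed.

Lemma Bd_dd k u : Bd M u -> Bd M (dd k u).
Proof.
move=> [K [d [K0 /bd_bdN uK]]]; exists K, d.+1; split=> //.
by apply/bd_bdN => N; apply: bdN_dd.
Qed.

Lemma Bd_dl k u : lin u -> Bd M u -> Bd M (dl k u).
Proof.
move=> ul [K [d [K0 /bd_bdN uK]]]; exists (K / M), d; split.
  by rewrite divr_ge0// ltW.
apply/bd_bdN => N; apply: (@bdN_weaken N.+1 _ (K / M)) => //.
exact: bdN_dl.
Qed.

Lemma Bd_comb (c : C) u v : Bd M u -> Bd M v -> Bd M (c *: u + v).
Proof. exact: Bd_lin. Qed.

Lemma Bd_zero : Bd M (0 : A -> C). Proof. exact: Bd0. Qed.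

Lemma Bd_add u v : Bd M u -> Bd M v -> Bd M (u + v).
Proof. by move=> uM vM; rewrite -[u]scale1r; apply: Bd_comb. Qed.

Lemma Bd_scale (c : C) u : Bd M u -> Bd M (c *: u).
Proof. by move=> uM; rewrite -[X in Bd _ X]addr0; apply: Bd_comb => //; exact: Bd_zero. Qed.

Lemma Bd_th q k u : lin u -> Bd M u -> Bd M (th q k u).
Proof.
move=> ul uM; rewrite /th xx_dl; apply: Bd_comb; first exact: Bd_dd.
by apply: Bd_dl; [exact: lin_dd|exact: Bd_dd].
Qed.

Lemma Bd_TH q u : lin u -> Bd M u -> Bd M (TH q u).
Proof.
move=> ul uM; rewrite /TH; elim/big_ind: _ => //; first exact: Bd_zero.
- by move=> *; apply: Bd_add.
- by move=> k _; apply: Bd_th.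
Qed.

Lemma reexp_comb (c : C) u v h : lin u -> lin v -> Bd M u -> Bd M v ->
  8 * M * l1norm h <= 1 -> reexp (c *: u + v) h = c *: reexp u h + reexp v h.
Proof.
move=> ul vl uM vM Mh; apply/funext => P.
rewrite -[LHS]/(taylor (fun Q => c * mulj P u Q + mulj P v Q) h).
by apply: (taylor_lin (M := M)) => //; try exact: lin_mulj; exact: Bd_mulj.
Qed.

Lemma reexp_zero h : reexp (0 : A -> C) h = 0.
Proof.
apply/funext => P; apply: csumE; rewrite (_ : psum _ = fun=> 0); first exact: ccvg_cst.
by apply/funext => n; rewrite /psum big1 // => i _; rewrite /taylor_term /mulj jet0 mul0r.
Qed.

Lemma reexp_add u v h : lin u -> lin v -> Bd M u -> Bd M v ->
  8 * M * l1norm h <= 1 -> reexp (u + v) h = reexp u h + reexp v h.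
Proof. by move=> ul vl uM vM Mh; have := reexp_comb 1 ul vl uM vM Mh; rewrite !scale1r. Qed.

Lemma reexp_scale (c : C) u h : lin u -> Bd M u ->
  8 * M * l1norm h <= 1 -> reexp (c *: u) h = c *: reexp u h.
Proof.
move=> ul uM Mh; have := reexp_comb c ul lin_zero uM Bd_zero Mh.
by rewrite reexp_zero !addr0.
Qed.

Lemma reexp_th q k u h : lin u -> Bd M u -> 8 * M * l1norm h <= 1 ->
  reexp (th q k u) h = th (q + h) k (reexp u h).
Proof.
move=> ul uM Mh.
have E := reexp_xx q k M1 (lin_dd k ul) (Bd_dd k uM) Mh.
by apply: etrans E _; rewrite reexp_dd.
Qed.

Lemma reexp_TH q u h : lin u -> Bd M u -> 8 * M * l1norm h <= 1 ->
  reexp (TH q u) h = TH (q + h) (reexp u h).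
Proof.
move=> ul uM Mh; rewrite /TH.
suff H s : reexp (\sum_(k <- s) th q k u) h = \sum_(k <- s) th (q + h) k (reexp u h) /\
   Bd M (\sum_(k <- s) th q k u) by case: (H (index_enum 'I_m)).
elim: s => [|k s [IH IB]].
  by rewrite !big_nil; split; [exact: reexp_zero|exact: Bd_zero].
rewrite !big_cons; split; last by apply: Bd_add IB; exact: Bd_th.
rewrite reexp_add ?IH ?reexp_th//; first exact: lin_th.
- by apply: lin_big => j; exact: lin_th.
- exact: Bd_th.
Qed.

Lemma Bd_THs q (a : C) u : lin u -> Bd M u -> Bd M (TH q u + a *: u).
Proof. by move=> ul uM; apply: Bd_add; [exact: Bd_TH|exact: Bd_scale]. Qed.

Lemma reexp_THs q (a : C) u h : lin u -> Bd M u -> 8 * M * l1norm h <= 1 ->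
  reexp (TH q u + a *: u) h = TH (q + h) (reexp u h) + a *: reexp u h.
Proof.
move=> ul uM Mh; rewrite reexp_add ?reexp_TH ?reexp_scale//; first exact: lin_TH.
- exact: lin_scale.
- exact: Bd_TH.
- exact: Bd_scale.
Qed.

Lemma reexp_FSol q a b c u h : FSol q a b c u -> Bd M u -> 8 * M * l1norm h <= 1 ->
  FSol (q + h) a b c (reexp u h).
Proof.
move=> [ul H] uM Mh; split=> [|k]; first exact: (lin_reexp M1).
have := congr1 (reexp ^~ h) (H k).
have gl := lin_THs q b ul; have gB := Bd_THs q b ul uM.
have tl : lin (th q k u + (c k - 1) *: u).
  by apply: lin_add; [exact: lin_th|exact: lin_scale].
have tB : Bd M (th q k u + (c k - 1) *: u).
  by apply: Bd_add; [exact: Bd_th|exact: Bd_scale].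
rewrite (reexp_th _ _ tl tB Mh) (reexp_xx _ _ M1 (lin_THs _ _ gl) (Bd_THs _ _ gl gB) Mh).
rewrite (reexp_THs _ _ gl gB Mh) (reexp_THs _ _ ul uM Mh) reexp_add ?reexp_th ?reexp_scale//.
- exact: lin_th.
- exact: lin_scale.
- exact: Bd_th.
- exact: Bd_scale.
Qed.

End bdN.
End Symbol.

(** * Lower-order terms and principal symbols *)

Section PrincipalSymbol.
Context {R : realType} {m : nat}.
Local Notation C := (Cplx R).
Local Notation Cm := 'rV[Cplx R]_m.
Local Notation A := (mpoly m (Cplx R)).
Implicit Types (P Q : A) (u v : A -> C) (h q : Cm) (w : seq 'I_m).

Variable (B : R).

(** Operators of order at most d, with a bound uniform in the centre q of
coordinates at most B and in the ratio M. *)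
Definition bnd d (F : Cm -> (A -> C) -> A -> C) := exists2 e : R, 0 <= e &
  forall q u M N K, (forall k, nrm (q 0 k) <= B) -> lin u -> 1 <= M -> 0 <= K ->
  bdN N M K 0 u -> lin (F q u) /\ bdN N M (e * K) d (F q u).

(** Terms of order lower than d: they gain a factor 1/M, and they give access to
one more order of derivatives than is known of u.  Both features drive the
induction on the order, in which M is taken large. *)
Definition sml d (F : Cm -> (A -> C) -> A -> C) := exists2 e : R, 0 <= e &
  forall q u M N K, (forall k, nrm (q 0 k) <= B) -> lin u -> 1 <= M -> 0 <= K ->
  bdN N M K 0 u -> lin (F q u) /\ bdN N.+1 M (e * K / M) d (F q u).

Lemma bnd_id : bnd 0 (fun q u => u).
Proof. by exists 1 => // q u M N K qB ul M1 K0 uK; rewrite mul1r. Qed.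

Lemma bnd_dd d k F : bnd d F -> bnd d.+1 (fun q u => dd k (F q u)).
Proof.
move=> [e e0 H]; exists e => // q u M N K qB ul M1 K0 uK.
have [Fl FK] := H _ _ _ _ _ qB ul M1 K0 uK.
by split; [exact: lin_dd|exact: bdN_dd].
Qed.

Lemma sml_dd d k F : sml d F -> sml d.+1 (fun q u => dd k (F q u)).
Proof.
move=> [e e0 H]; exists e => // q u M N K qB ul M1 K0 uK.
have [Fl FK] := H _ _ _ _ _ qB ul M1 K0 uK.
by split; [exact: lin_dd|exact: bdN_dd].
Qed.

Lemma bnd_dl d k F : bnd d F -> sml d (fun q u => dl k (F q u)).
Proof.
move=> [e e0 H]; exists e => // q u M N K qB ul M1 K0 uK.
have [Fl FK] := H _ _ _ _ _ qB ul M1 K0 uK.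
by split; [exact: lin_dl|apply: bdN_dl => //; exact: mulr_ge0].
Qed.

Lemma bnd_sml d F : bnd d F -> sml d.+1 F.
Proof.
move=> [e e0 H]; exists e => // q u M N K qB ul M1 K0 uK.
have [Fl FK] := H _ _ _ _ _ qB ul M1 K0 uK.
by split=> //; apply: bdN_raise => //; exact: mulr_ge0.
Qed.

Lemma sml_bnd d F : sml d F -> bnd d F.
Proof.
move=> [e e0 H]; exists e => // q u M N K qB ul M1 K0 uK.
have [Fl FK] := H _ _ _ _ _ qB ul M1 K0 uK.
split=> //; apply: bdN_weaken FK => //.
by rewrite ler_pdivrMr ?(lt_le_trans ltr01)// ler_peMr// mulr_ge0.
Qed.

Lemma bnd_add d F G : bnd d F -> bnd d G -> bnd d (fun q u => F q u + G q u).
Proof.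
move=> [e e0 H] [e' e'0 H']; exists (e + e'); first exact: addr_ge0.
move=> q u M N K qB ul M1 K0 uK.
have [Fl FK] := H _ _ _ _ _ qB ul M1 K0 uK.
have [Gl GK] := H' _ _ _ _ _ qB ul M1 K0 uK.
by split; [exact: lin_add|rewrite mulrDl; exact: bdN_add].
Qed.

Lemma sml_add d F G : sml d F -> sml d G -> sml d (fun q u => F q u + G q u).
Proof.
move=> [e e0 H] [e' e'0 H']; exists (e + e'); first exact: addr_ge0.
move=> q u M N K qB ul M1 K0 uK.
have [Fl FK] := H _ _ _ _ _ qB ul M1 K0 uK.
have [Gl GK] := H' _ _ _ _ _ qB ul M1 K0 uK.
by split; [exact: lin_add|rewrite !mulrDl; exact: bdN_add].
Qed.

Lemma bnd_scale d (g : Cm -> C) D F : 0 <= D ->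
  (forall q, (forall k, nrm (q 0 k) <= B) -> nrm (g q) <= D) ->
  bnd d F -> bnd d (fun q u => g q *: F q u).
Proof.
move=> D0 gD [e e0 H]; exists (D * e); first exact: mulr_ge0.
move=> q u M N K qB ul M1 K0 uK.
have [Fl FK] := H _ _ _ _ _ qB ul M1 K0 uK.
split; first exact: lin_scale.
by rewrite -mulrA; apply: bdN_scale => //; [exact: gD|exact: mulr_ge0].
Qed.

Lemma sml_scale d (g : Cm -> C) D F : 0 <= D ->
  (forall q, (forall k, nrm (q 0 k) <= B) -> nrm (g q) <= D) ->
  sml d F -> sml d (fun q u => g q *: F q u).
Proof.
move=> D0 gD [e e0 H]; exists (D * e); first exact: mulr_ge0.
move=> q u M N K qB ul M1 K0 uK.
have [Fl FK] := H _ _ _ _ _ qB ul M1 K0 uK.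
split; first exact: lin_scale.
rewrite -!mulrA; apply: bdN_scale => //; first exact: gD.
  by rewrite !mulr_ge0// invr_ge0 (le_trans ler01).
by rewrite mulrA.
Qed.

Lemma sml_cst d (z : C) F : sml d F -> sml d (fun q u => z *: F q u).
Proof. by apply: (@sml_scale _ (fun=> z) (nrm z)); rewrite ?nrm_ge0. Qed.

Lemma bnd_zero d : bnd d (fun q u => 0).
Proof.
exists 0 => // q u M N K qB ul M1 K0 uK; split; first exact: lin_zero.
by move=> w _; rewrite jet0 nrm0 !mul0r.
Qed.

Lemma sml_zero d : sml d (fun q u => 0).
Proof.
exists 0 => // q u M N K qB ul M1 K0 uK; split; first exact: lin_zero.
by move=> w _; rewrite jet0 nrm0 !mul0r.
Qed.

Lemma bnd_sum d (F : 'I_m -> Cm -> (A -> C) -> A -> C) :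
  (forall k, bnd d (F k)) -> bnd d (fun q u => \sum_k F k q u).
Proof.
move=> FB; elim: (index_enum _) => [|k s IH].
  by under [X in bnd _ X]eq_fun do under eq_fun do rewrite big_nil; exact: bnd_zero.
by under [X in bnd _ X]eq_fun do under eq_fun do rewrite big_cons; exact: bnd_add.
Qed.

Lemma sml_sum d (F : 'I_m -> Cm -> (A -> C) -> A -> C) :
  (forall k, sml d (F k)) -> sml d (fun q u => \sum_k F k q u).
Proof.
move=> FB; elim: (index_enum _) => [|k s IH].
  by under [X in sml _ X]eq_fun do under eq_fun do rewrite big_nil; exact: sml_zero.
by under [X in sml _ X]eq_fun do under eq_fun do rewrite big_cons; exact: sml_add.
Qed.

(** The principal parts of theta_k (here) and of theta (below): the coefficients
are frozen at q. *)
Definition pp q k u : A -> C := q 0 k *: dd k u.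
Definition PP q u : A -> C := \sum_k pp q k u.

Lemma thE q k u : th q k u = pp q k u + dl k (dd k u). Proof. by []. Qed.

Lemma THE q u : TH q u = PP q u + \sum_k dl k (dd k u).
Proof. by rewrite /PP -big_split. Qed.

Lemma ppD q k u v : pp q k (u + v) = pp q k u + pp q k v.
Proof. exact: scalerDr. Qed.

Lemma PPD q u v : PP q (u + v) = PP q u + PP q v.
Proof. by rewrite /PP -big_split; apply: eq_bigr => k _; exact: ppD. Qed.

Hypothesis B0 : 0 <= B.

Lemma bnd_pp d k F : bnd d F -> bnd d.+1 (fun q u => pp q k (F q u)).
Proof. by move=> FB; apply: (bnd_scale B0) => //; apply: bnd_dd. Qed.
Lemma sml_pp d k F : sml d F -> sml d.+1 (fun q u => pp q k (F q u)).
Proof. by move=> FB; apply: (sml_scale B0) => //; apply: sml_dd. Qed.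
Lemma bnd_PP d F : bnd d F -> bnd d.+1 (fun q u => PP q (F q u)).
Proof. by move=> FB; apply: bnd_sum => k; apply: bnd_pp. Qed.
Lemma sml_PP d F : sml d F -> sml d.+1 (fun q u => PP q (F q u)).
Proof. by move=> FB; apply: sml_sum => k; apply: sml_pp. Qed.

(** The principal part of the k-th equation. *)
Definition sigop q k u : A -> C := pp q k (pp q k u) - q 0 k *: PP q (PP q u).

(** After separating theta_k and theta into principal part and remainder, every
other summand of the k-th equation either contains some [dl] or has order at
most 1. *)
Lemma lower_terms (a b : C) (c : 'I_m -> C) k : exists2 F, sml 2 F &
  forall q u, FSol q a b c u -> sigop q k u = F q u.
Proof.
pose R1 q u := dl k (dd k u) + (c k - 1) *: u.
have R1s : sml 1 R1.
  by apply: sml_add; [apply/bnd_dl/bnd_dd/bnd_id|apply/sml_cst/bnd_sml/bnd_id].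
pose F1 q u := pp q k (R1 q u) + dl k (dd k (pp q k u + R1 q u)).
have F1s : sml 2 F1.
  apply: sml_add; first exact: sml_pp.
  by apply/bnd_dl/bnd_dd/bnd_add; [apply/bnd_pp/bnd_id|exact: sml_bnd].
have F1E q u : th q k (th q k u + (c k - 1) *: u) = pp q k (pp q k u) + F1 q u.
  have -> : th q k u + (c k - 1) *: u = pp q k u + R1 q u by rewrite thE -addrA.
  by rewrite thE ppD -addrA.
pose R2 q u := (\sum_j dl j (dd j u)) + b *: u.
have R2s : sml 1 R2.
  by apply: sml_add; [apply: sml_sum => j; apply/bnd_dl/bnd_dd/bnd_id|apply/sml_cst/bnd_sml/bnd_id].
pose G q u := PP q u + R2 q u.
have Gb : bnd 1 G by apply: bnd_add; [apply/bnd_PP/bnd_id|exact: sml_bnd].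
pose R3 q u := PP q (R2 q u) + ((\sum_j dl j (dd j (G q u))) + a *: G q u).
have R3s : sml 2 R3.
  apply: sml_add; first exact: sml_PP.
  by apply: sml_add; [apply: sml_sum => j; apply/bnd_dl/bnd_dd|apply/sml_cst/bnd_sml].
pose F2 q u := q 0 k *: R3 q u + dl k (PP q (PP q u) + R3 q u).
have F2s : sml 2 F2.
  apply: sml_add; first exact: (sml_scale B0).
  by apply/bnd_dl/bnd_add; [apply/bnd_PP/bnd_PP/bnd_id|exact: sml_bnd].
exists (fun q u => F2 q u + (-1) *: F1 q u); first by apply/sml_add/sml_cst.
move=> q u [_ /(_ k)]; rewrite F1E.
have -> : TH q u + b *: u = G q u by rewrite THE -addrA.
have -> : TH q (G q u) + a *: G q u = PP q (PP q u) + R3 q u.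
  by rewrite THE {1}/G PPD -!addrA.
rewrite xx_dl scalerDr -addrA -/(F2 q u) scaleN1r => E.
by rewrite /sigop; apply/eqP; rewrite subr_eq addrAC eq_sym subr_eq E addrC.
Qed.

Definition sigp q k : A := (q 0 k *: dvar k) ^+ 2 - q 0 k *: lform q ^+ 2.

Lemma PPE q u : lin u -> PP q u = mulj (lform q) u.
Proof.
move=> ul; apply/funext => P; rewrite /mulj /lform mulr_suml (lin_sum ul).
rewrite /PP; elim: (index_enum _) => [|k s IH]; first by rewrite !big_nil.
by rewrite !big_cons jetD IH -scalerAl (linZ ul).
Qed.

Lemma sigopE q k u : lin u -> sigop q k u = mulj (sigp q k) u.
Proof.
move=> ul; rewrite /sigop (PPE _ ul) (PPE _ (lin_mulj _ ul)) mulj_mulj -expr2.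
apply/funext => P; rewrite jetD jetN jetZ /mulj /sigp mulrBl (linB ul).
rewrite -(scalerAl _ (lform q ^+ 2)) (linZ ul) exprZn -scalerAl (linZ ul); congr (_ - _).
by rewrite /pp !jetZ /dd jetZ !mulrA -expr2.
Qed.

(** What the induction on the order uses of the equations: on multiples of the
symbols the estimate is gained at one more order, with a factor 1/M to spare. *)
Lemma symbol_estimate (a b : C) (c : 'I_m -> C) k : exists2 e : R, 0 <= e &
  forall q u M N K, (forall k, nrm (q 0 k) <= B) -> FSol q a b c u -> 1 <= M ->
  0 <= K -> bdN N M K 0 u -> forall w, (size w + 2 <= N)%N ->
  nrm (u (sigp q k * mon w)) <= e * K / M * M ^+ (size w + 2) * (size w + 2)`!%:R.
Proof.
have [F [e e0 H] FE] := lower_terms a b c k; exists e => // q u M N K qB uS M1 K0 uK w wN.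
have [_ Fb] := H _ _ _ _ _ qB uS.1 M1 K0 uK.
have -> : u (sigp q k * mon w) = F q u (mon w) by rewrite -FE// sigopE//; case: uS.
by apply: Fb; rewrite ltnS.
Qed.

End PrincipalSymbol.

(** * The ideal of principal symbols off the singular locus *)

Section Ideal.
Context {R : realType} {m : nat}.
Local Notation C := (Cplx R).
Local Notation Cm := 'rV[Cplx R]_m.
Local Notation A := (mpoly m (Cplx R)).
Implicit Types (P Q : A) (u v : A -> C) (h q : Cm) (w : seq 'I_m).

Variable p : Cm.

(** A quantitative form of the ideal generated by the principal symbols at p:
membership of P provides a constant G by which smallness of a jet on the
multiples of the symbols implies smallness on the multiples of P. *)
Definition symI P := exists2 G : R, 0 <= G & forall v T, lin v -> 0 <= T ->
  (forall w k, nrm (v (sigp p k * mon w)) <= T) ->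
  forall w, nrm (v (P * mon w)) <= G * T.

Lemma symI0 : symI 0.
Proof.
by exists 0 => // v T vl T0 H w; rewrite mul0r lin0// nrm0 mul0r.
Qed.

Lemma symID P Q : symI P -> symI Q -> symI (P + Q).
Proof.
move=> [G G0 HG] [G' G'0 HG']; exists (G + G'); first exact: addr_ge0.
move=> v T vl T0 H w; rewrite mulrDl linD//; apply: le_trans (nrmD _ _) _.
by rewrite mulrDl lerD//; [exact: HG|exact: HG'].
Qed.

Lemma symIZ c P : symI P -> symI (c *: P).
Proof.
move=> [G G0 HG]; exists (nrm c * G); first by rewrite mulr_ge0// nrm_ge0.
move=> v T vl T0 H w; rewrite -scalerAl (linZ vl) nrmM -mulrA ler_wpM2l ?nrm_ge0//.
exact: HG.
Qed.

Lemma symIM Q P : symI P -> symI (Q * P).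
Proof.
move=> PI; move: Q; apply: A_ind => [|c Q Q' HQ HQ'|w].
- by rewrite mul0r; exact: symI0.
- have -> : (c *: Q + Q') * P = c *: (Q * P) + Q' * P by rewrite mulrDl scalerAl.
  exact: symID (symIZ c HQ) HQ'.
- case: PI => G G0 HG; exists G => // v T vl T0 H w'.
  by rewrite (mulrC (mon w)) -mulrA -mon_cat; exact: HG.
Qed.

Lemma symI_sigp k : symI (sigp p k).
Proof. by exists 1 => // v T vl T0 H w; rewrite mul1r. Qed.

Lemma symI_prod (I : Type) (r : seq I) (F G : I -> A) :
  (forall i, symI (F i - G i)) -> symI (\prod_(i <- r) F i - \prod_(i <- r) G i).
Proof.
move=> FG; elim: r => [|i r IH]; first by rewrite !big_nil subrr; exact: symI0.
rewrite !big_cons; set x := F i; set y := G i; set X := \prod_(_ <- _) _.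
rewrite -/X; set Y := \prod_(_ <- _) _.
have -> : x * X - y * Y = X * (x - y) + y * (X - Y) by ring.
by apply: symID; apply: symIM => //; exact: FG.
Qed.

(** Modulo the symbols, the square of eta k is p_k times the square of the total
symbol et.  The terms eta k are replaced one after the other by r k times et, j
being the number of those already replaced: Pr 0 vanishes because of the factor
where all signs are -1, and in Pr m all factors are multiples of et. *)
Let eta k : A := p 0 k *: dvar k.
Let et : A := lform p.
Let r k : C := sqrtC (p 0 k).

Let x (j : nat) (k : 'I_m) : A := if (k < j)%N then r k *: et else eta k.
Let F j (e : {ffun 'I_m -> bool}) : A := et + \sum_k (-1) ^+ e k *: x j k.
Let flip (j : 'I_m) (e : {ffun 'I_m -> bool}) : {ffun 'I_m -> bool} :=
  [ffun k => if k == j then ~~ e k else e k].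

Lemma flipK j : involutive (flip j).
Proof. by move=> e; apply/ffunP => k; rewrite !ffunE; case: eqP; rewrite ?negbK. Qed.

(** Pairing each choice of signs with the one that differs at i makes the i-th
term occur through its square only, which can be replaced modulo the symbols.
This is why [Pr] enters squared below. *)
Lemma F_flip j (i : 'I_m) e : F j e * F j (flip i e) =
  (et + \sum_(k | k != i) (-1) ^+ e k *: x j k) ^+ 2 - x j i ^+ 2.
Proof.
rewrite /F (bigD1 i)//= [in X in _ * X](bigD1 i)//=.
have -> : \sum_(k | k != i) (-1) ^+ flip i e k *: x j k =
          \sum_(k | k != i) (-1) ^+ e k *: x j k.
  by apply: eq_bigr => k /negbTE ki; rewrite ffunE ki.
rewrite ffunE eqxx; set s := \sum_(_ | _) _.
by case: (e i); rewrite /= ?expr0 ?expr1 !(scaleN1r, scale1r); ring.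
Qed.

Let Pr j : A := \prod_(e : {ffun 'I_m -> bool}) F j e.

Lemma Pr_sq j (i : 'I_m) : Pr j ^+ 2 = \prod_e (F j e * F j (flip i e)).
Proof.
rewrite big_split /= expr2; congr (_ * _).
by rewrite /Pr (reindex_inj (inv_inj (flipK i))).
Qed.

Lemma Pr_step (i : 'I_m) : symI (Pr i.+1 ^+ 2 - Pr i ^+ 2).
Proof.
rewrite !(Pr_sq _ i); apply: symI_prod => e; rewrite !F_flip.
have -> : \sum_(k | k != i) (-1) ^+ e k *: x i.+1 k =
          \sum_(k | k != i) (-1) ^+ e k *: x i k.
  by apply: eq_bigr => k ki; rewrite /x ltnS leq_eqVlt (inj_eq val_inj) (negbTE ki).
have -> : forall z y t : A, z ^+ 2 - y - (z ^+ 2 - t) = t - y by move=> z y t; ring.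
rewrite /x /r ltnSn ltnn (exprZn (sqrtC _)) sqrtCK; exact: symI_sigp.
Qed.

Lemma Pr0 : Pr 0 = 0.
Proof.
rewrite /Pr (bigD1 [ffun => true])//= /F.
have -> : \sum_k (-1) ^+ ([ffun => true] : {ffun 'I_m -> bool}) k *: x 0 k = - et.
  by rewrite -sumrN; apply: eq_bigr => k _; rewrite ffunE expr1 scaleN1r.
by rewrite subrr mul0r.
Qed.

Lemma Pr_m : Pr m = R_poly p *: et ^+ #|{: {ffun 'I_m -> bool}}|.
Proof.
rewrite /Pr /R_poly -prodr_const -scaler_prod; apply: eq_bigr => e _.
rewrite scalerDl scale1r scaler_suml; congr (_ + _); apply: eq_bigr => k _.
by rewrite /x ltn_ord scalerA.
Qed.

Hypothesis pX : X_C p.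

Lemma R_neq0 : R_poly p != 0.
Proof. by apply/eqP => R0; apply: pX; rewrite /sing_locus /= R0 mulr0. Qed.

Lemma p_neq0 k : p 0 k != 0.
Proof.
by apply/eqP => p0; apply: pX; rewrite /sing_locus /= (bigD1 k)//= p0 !mul0r.
Qed.

Let E := (#|{: {ffun 'I_m -> bool}}| * 2)%N.

(** The product over the signs is 0 for j = 0 and R(p) times a power of the total
symbol for j = m, and R(p) is invertible. *)
Lemma symI_total : symI (et ^+ E).
Proof.
have : forall j, (j <= m)%N -> symI (Pr j ^+ 2).
  elim=> [|j IH] jm; first by rewrite Pr0 expr0n; exact: symI0.
  rewrite -[X in symI X](subrK (Pr j ^+ 2)); apply: symID; last by apply: IH; exact: ltnW.
  exact: (Pr_step (Ordinal jm)).
move=> /(_ m (leqnn m)); rewrite Pr_m exprZn -exprM => /(symIZ (R_poly p ^+ 2)^-1).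
by rewrite scalerA mulVf ?scale1r// expf_neq0// R_neq0.
Qed.

(** Modulo the symbols, (p_k d_k)^2 is p_k times the square of the total symbol,
which is nilpotent, and p_k is invertible. *)
Lemma symI_dvar k : symI (dvar k ^+ E).
Proof.
have : symI (eta k ^+ E).
  rewrite /E mulnC exprM -[X in symI X](subrK ((p 0 k *: et ^+ 2) ^+ #|{: {ffun 'I_m -> bool}}|)).
  apply: symID.
    by rewrite -!prodr_const; apply: symI_prod => _; exact: symI_sigp.
  by rewrite exprZn -exprM mulnC; apply/symIZ/symI_total.
rewrite exprZn => /(symIZ (p 0 k ^+ E)^-1).
by rewrite scalerA mulVf ?scale1r// expf_neq0// p_neq0.
Qed.

Lemma mon_split n k w : (n <= count_mem k w)%N ->
  exists w', mon w = dvar k ^+ n * mon w' :> A.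
Proof.
elim: n w => [|n IH] w nw; first by exists w; rewrite expr0 mul1r.
have kw : k \in w by rewrite -has_pred1 has_count (leq_trans _ nw).
have [|w' Hw'] := IH (rem k w).
  by rewrite count_rem kw /= eqxx; move: nw; case: (count_mem k w) => // c; rewrite subn1.
exists w'; rewrite exprS -mulrA -Hw' -mon_cons /mon.
exact: perm_big (perm_to_rem kw).
Qed.

(** By the pigeonhole principle a long word contains some letter often enough for
its monomial to lie in the ideal. *)
Lemma top_bound : exists N0, exists2 G : R, 0 <= G & forall v T, lin v -> 0 <= T ->
  (forall w k, nrm (v (sigp p k * mon w)) <= T) ->
  forall w, (N0 <= size w)%N -> nrm (v (mon w)) <= G * T.
Proof.
have /choice[g Hg] : forall k, exists G : R, 0 <= G /\ forall v T, lin v -> 0 <= T ->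
  (forall w k, nrm (v (sigp p k * mon w)) <= T) ->
  forall w, nrm (v (dvar k ^+ E * mon w)) <= G * T.
  by move=> k; have [G G0 HG] := symI_dvar k; exists G.
exists (m * E).+1, (\sum_k g k).
  by apply: sumr_ge0 => k _; case: (Hg k).
move=> v T vl T0 H w wN.
have [k Ek] : exists k, (E <= count_mem k w)%N.
  apply/existsP; rewrite -[X in is_true X]negbK negb_exists; apply/negP => /forallP kE.
  have : (size w <= m * E)%N; last by rewrite leqNgt wN.
  have -> : size w = (\sum_k count_mem k w)%N.
    elim: (w) => [|j s IH]; first by rewrite big1.
    by rewrite /= big_split /= -IH (bigD1 j)//= eqxx big1 ?addn0// => i /negbTE;
      rewrite eq_sym => ->.
  rewrite -[X in (X * _)%N]card_ord -sum_nat_const; apply: leq_sum => k _.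
  by have := kE k; rewrite -ltnNge => /ltnW.
have [w' ->] := mon_split Ek; have [g0 /(_ v T vl T0 H w') Hk] := Hg k.
apply: le_trans Hk _; rewrite ler_wpM2r// (bigD1 k)//= lerDl.
by apply: sumr_ge0 => j _; case: (Hg j).
Qed.

End Ideal.

Section LocalBound.
Context {R : realType} {m : nat}.
Local Notation C := (Cplx R).
Local Notation Cm := 'rV[Cplx R]_m.
Local Notation A := (mpoly m (Cplx R)).
Implicit Types (P Q : A) (u v : A -> C) (h q : Cm) (w : seq 'I_m).

Lemma sigp_mon q k w u : lin u -> u (sigp q k * mon w) =
  q 0 k ^+ 2 * u (mon [:: k, k & w]) -
  \sum_i \sum_j q 0 k * q 0 i * q 0 j * u (mon [:: i, j & w]).
Proof.
move=> ul; rewrite -[LHS]/(mulj (sigp q k) u (mon w)) -(sigopE _ _ ul) /sigop jetD jetN;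
  congr (_ - _).
  by rewrite /pp !jetZ /dd jetZ !mon_cons expr2 mulrA.
rewrite jetZ /PP.
rewrite jet_sum mulr_sumr; apply: eq_bigr => i _.
rewrite /pp jetZ /dd jet_sum !mulr_sumr; apply: eq_bigr => j _.
by rewrite jetZ /dd !mon_cons !mulrA (mulrC (dvar j)).
Qed.

(** The homogeneous component of order N of a jet.  The constants of [symI] apply
to it although bounds on u are available at order N alone. *)
Definition trunc (N : nat) u : A -> C := fun P => u (pihomog mdeg N P).

Lemma lin_trunc N u : lin u -> lin (trunc N u).
Proof. by move=> ul c P Q; rewrite /trunc linearP ul. Qed.

Lemma trunc_mon N u w : lin u ->
  trunc N u (mon w) = if size w == N then u (mon w) else 0.
Proof.
move=> ul; rewrite /trunc monE; case: eqP => [<-|sN].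
  by rewrite pihomog_dE// -mdeg_word_mnm dhomogX.
by rewrite (pihomog_ne0 (d := size w)) ?lin0//; [apply/eqP|rewrite -mdeg_word_mnm dhomogX].
Qed.

End LocalBound.

(** * Convergence of formal solutions *)

Section Estimate.
Context {R : realType} {m : nat}.
Local Notation C := (Cplx R).
Local Notation Cm := 'rV[Cplx R]_m.
Local Notation A := (mpoly m (Cplx R)).
Implicit Types (P Q : A) (u v : A -> C) (h q p : Cm) (w : seq 'I_m).

Lemma nrm_subl (x y : C) : nrm x <= nrm (x - y) + nrm y.
Proof. by apply: le_trans (nrmD _ _); rewrite subrK. Qed.

Lemma nrm_mulB (x y x' y' : C) (B s t : R) : nrm x <= B -> nrm y' <= s ->
  nrm (x - x') <= t -> nrm (y - y') <= t -> 0 <= t ->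
  nrm (x * y - x' * y') <= (B + s) * t.
Proof.
move=> xB ys xt yt t0.
have -> : x * y - x' * y' = x * (y - y') + (x - x') * y' by ring.
apply: le_trans (nrmD _ _) _; rewrite !nrmM mulrDl [X in _ <= _ + X]mulrC.
by rewrite lerD// ler_pM ?nrm_ge0.
Qed.

Lemma sum_le_const (F : 'I_m -> R) D : (forall i, F i <= D) ->
  \sum_i F i <= m%:R * D.
Proof.
move=> FD; apply: (@le_trans _ _ (\sum_(i < m) D)); first by apply: ler_sum.
by rewrite sumr_const card_ord mulr_natl.
Qed.

Lemma sigp_near p q k w u (B t T : R) : lin u -> 1 <= B -> 0 <= t ->
  (forall j, nrm (p 0 j) <= B) -> (forall j, nrm (q 0 j) <= B) ->
  (forall j, nrm (p 0 j - q 0 j) <= t) ->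
  (forall w', size w' = (size w + 2)%N -> nrm (u (mon w')) <= T) ->
  nrm (u (sigp p k * mon w) - u (sigp q k * mon w)) <=
   (2 * B + m%:R * (m%:R * (3 * B ^+ 2))) * t * T.
Proof.
move=> ul B1 t0 pB qB pq uT;
rewrite (congr2 (fun x y => x - y) (sigp_mon p k w ul) (sigp_mon q k w ul)).
have T0 : 0 <= T.
  by apply: le_trans (nrm_ge0 (u (mon [:: k, k & w]))) _; apply: uT; rewrite /= addn2.
have B0 : 0 <= B by exact: le_trans B1.
set X := u (mon [:: k, k & w]).
have XT : nrm X <= T by apply: uT; rewrite /= addn2.
set SP := \sum_i _; set SQ := \sum_i _.
have -> : p 0 k ^+ 2 * X - SP - (q 0 k ^+ 2 * X - SQ) =
   (p 0 k ^+ 2 - q 0 k ^+ 2) * X + (SQ - SP) by ring.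
apply: le_trans (nrmD _ _) _; rewrite (mulrDl (2 * B)) (mulrDl (2 * B * t)) lerD//.
  rewrite nrmM ler_pM ?nrm_ge0// !expr2.
  by have := nrm_mulB (pB k) (qB k) (pq k) (pq k) t0; lra.
rewrite /SP /SQ -sumrB -!mulrA; apply: le_trans (nrm_sum _ _ _) _.
apply: sum_le_const => i; rewrite -sumrB; apply: le_trans (nrm_sum _ _ _) _.
apply: sum_le_const => j; rewrite -mulrBl nrmM !mulrA ler_pM ?nrm_ge0//; last by apply: uT;
  rewrite /= addn2.
have H1 := nrm_mulB (qB k) (pB i) (_ : nrm (q 0 k - p 0 k) <= t) (_ : nrm (q 0 i - p 0 i) <= t) t0.
have {}H1 : nrm (q 0 k * q 0 i - p 0 k * p 0 i) <= (B + B) * t.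
  by apply: H1; rewrite nrmC.
have -> : q 0 k * q 0 i * q 0 j - p 0 k * p 0 i * p 0 j =
  (q 0 k * q 0 i - p 0 k * p 0 i) * q 0 j + p 0 k * p 0 i * (q 0 j - p 0 j) by ring.
apply: le_trans (nrmD _ _) _; rewrite !nrmM.
have -> : 3 * B * B * t = (B + B) * t * B + B * B * t by ring.
by rewrite lerD// ?ler_pM ?nrm_ge0 ?mulr_ge0 ?nrm_ge0// 1?nrmC.
Qed.

(** Induction on the order.  At order N the symbol estimate at q gives the values
of u on the multiples of the symbols at q, up to lower orders that gain 1/M.
Replacing the symbols at q by those at p costs at most D t times the largest
value of u at order N, where t bounds the distance from q to p, and
[top_bound] recovers all values at order N.  For small t the loss is absorbed,
for large M so are the lower orders. *)
Lemma FSol_bound (a b : C) (c : 'I_m -> C) p : X_C p ->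
  exists r M : R, [/\ 0 < r, 1 <= M & forall q, l1norm (q - p) < r ->
    forall u, FSol q a b c u -> Bd M u].
Proof.
move=> pX; have [N0 [G G0 HG]] := top_bound pX.
pose B := l1norm p + 1; have B1 : 1 <= B by rewrite lerDr l1norm_ge0.
have B0 : 0 <= B by exact: le_trans B1.
have /choice[e He] : forall k, exists e : R, 0 <= e /\
  forall q u M N K, (forall k, nrm (q 0 k) <= B) -> FSol q a b c u -> 1 <= M ->
  0 <= K -> bdN N M K 0 u -> forall w, (size w + 2 <= N)%N ->
  nrm (u (sigp q k * mon w)) <= e * K / M * M ^+ (size w + 2) * (size w + 2)`!%:R.
  by move=> k; have [e e0 H] := symbol_estimate B0 a b c k; exists e.
pose e1 := \sum_k e k.
have e10 : 0 <= e1 by apply: sumr_ge0 => k _; case: (He k).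
have ee k : e k <= e1.
  by rewrite /e1 (bigD1 k)//= lerDl; apply: sumr_ge0 => j _; case: (He j).
(* The Lipschitz constant of the symbols provided by sigp_near. *)
pose D := 2 * B + m%:R * (m%:R * (3 * B ^+ 2)).
have D0 : 0 <= D by rewrite addr_ge0 ?mulr_ge0 ?exprn_ge0.
have GD0 : 0 <= G * D by exact: mulr_ge0.
(* This makes G D t at most 1/2: the change of symbols from q to p is absorbed
by the left-hand side. *)
pose t := (2 * (G * D + 1))^-1.
have t0 : 0 < t by rewrite invr_gt0; lra.
have tE : (G * D + 1) * t = 2^-1.
  rewrite /t invfM mulrCA mulfV ?mulr1//; apply: lt0r_neq0; lra.
have t1 : t <= 1 by have := mulr_ge0 GD0 (ltW t0); lra.
(* With this ratio the lower-order terms contribute at most half of the bound. *)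
pose M := 2 * G * e1 + 1.
have M1 : 1 <= M by rewrite lerDr !mulr_ge0.
have M0 : 0 < M by exact: lt_le_trans M1.
exists t, M; split => // q pq u uS; have ul := uS.1.
have pqk j : nrm (p 0 j - q 0 j) <= t.
  by rewrite nrmC; have := coord_le_l1norm (q - p) j; rewrite !mxE; lra.
have pB j : nrm (p 0 j) <= B by have := coord_le_l1norm p j; rewrite /B; lra.
have qB j : nrm (q 0 j) <= B.
  have := nrm_tri (q 0 j) (p 0 j) 0; rewrite !subr0 (nrmC (q 0 j) (p 0 j)).
  by have := pqk j; have := coord_le_l1norm p j; rewrite /B; lra.
(* The constant that makes the estimate true at all orders below N0. *)
pose K := \sum_(n < N0) \sum_(s : n.-tuple 'I_m) nrm (u (mon s)).
have K0 : 0 <= K by apply: sumr_ge0 => n _; apply: sumr_ge0 => s _; exact: nrm_ge0.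
have base : bdN N0 M K 0 u.
  move=> w; rewrite addn0 => wN; apply: (@le_trans _ _ K).
    rewrite /K (bigD1 (Ordinal wN))//= (bigD1 (in_tuple w))//= -addrA lerDl addr_ge0//.
      by apply: sumr_ge0 => s _; exact: nrm_ge0.
    by apply: sumr_ge0 => n _; apply: sumr_ge0 => s _; exact: nrm_ge0.
  rewrite -mulrA ler_peMr// mulr_ege1 ?exprn_ege1//.
  by rewrite ler1n fact_gt0.
suff H N : bdN N M K 0 u.
  by exists K, 0%N; split=> //; apply/bd_bdN.
elim: N => [//|N IH].
have [NN|NN] := ltnP N N0; first by apply: bdN_weaken base.
pose Top := \big[Num.max/0]_(s : N.-tuple 'I_m) nrm (u (mon s)).
have TopP w : size w = N -> nrm (u (mon w)) <= Top.
  move=> wN; have wt : size w == N by exact/eqP.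
  exact: (le_bigmax _ (fun s : N.-tuple 'I_m => nrm (u (mon s))) (Tuple wt)).
have Top0 : 0 <= Top by exact: bigmax_ge_id.
set Y := M ^+ N * N`!%:R; have Y0 : 0 <= Y by rewrite mulr_ge0// exprn_ge0// ltW.
pose T := e1 * K / M * Y + D * t * Top.
have T0 : 0 <= T.
  apply: addr_ge0; last by rewrite (mulr_ge0 (mulr_ge0 D0 (ltW t0))).
  by rewrite mulr_ge0// mulr_ge0 ?invr_ge0 ?(ltW M0)// mulr_ge0.
have test w k : nrm (trunc N u (sigp p k * mon w)) <= T.
  rewrite sigp_mon; last exact: lin_trunc.
  have tE' i j : trunc N u (mon [:: i, j & w]) = if (size w + 2)%N == N then u (mon [:: i, j &
    w]) else 0.
    by rewrite trunc_mon//= addn2.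
  case: eqP tE' => wN tE'; last first.
    rewrite tE' mulr0 big1 ?subrr ?nrm0// => i _; rewrite big1// => j _.
    by rewrite tE' mulr0.
  rewrite tE' (eq_bigr (fun i => \sum_j p 0 k * p 0 i * p 0 j * u (mon [:: i, j & w]))); last first.
    by move=> i _; apply: eq_bigr => j _; rewrite tE'.
  rewrite -sigp_mon//.
  have H1 := @sigp_near p q k w u B t Top ul B1 (ltW t0) pB qB pqk (fun w' sw' => TopP w'
    (etrans sw' wN)).
  have [e0 H2] := He k; have {}H2 := H2 q u M N K qB uS M1 K0 IH w.
  rewrite wN -mulrA in H2; have {}H2 := H2 (leqnn N).
  apply: le_trans (nrm_subl (u (sigp p k * mon w)) (u (sigp q k * mon w))) _.
  rewrite addrC; apply: lerD; last exact: H1.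
  apply: le_trans H2 _; rewrite -/Y ler_wpM2r// ler_wpM2r ?invr_ge0 ?(ltW M0)//.
   by rewrite ler_wpM2r.
have main w : size w = N -> nrm (u (mon w)) <= G * T.
  move=> wN; have := HG _ T (lin_trunc N ul) T0 test w.
  by rewrite trunc_mon// wN eqxx; apply.
have TopT : Top <= G * T.
  apply: bigmax_le; first exact: mulr_ge0.
  by move=> s _; apply: main; rewrite size_tuple.
have Topf : Top <= K * Y.
  have h1 : G * (D * t * Top) <= 2^-1 * Top.
    by rewrite !mulrA ler_wpM2r//; lra.
  have h2 : 2 * (G * (e1 * K / M * Y)) <= K * Y.
    have -> : 2 * (G * (e1 * K / M * Y)) = 2 * G * e1 / M * (K * Y).
      by field; rewrite gt_eqF.
    rewrite ler_piMl//; first exact: mulr_ge0.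
    by rewrite ler_pdivrMr// mul1r /M lerDl.
  by move: TopT; rewrite /T mulrDr; lra.
move=> w; rewrite addn0 ltnS leq_eqVlt => /orP[/eqP wN|wN].
  by rewrite wN -mulrA; apply: le_trans Topf; exact: TopP.
by have := IH w; rewrite addn0; apply.
Qed.

End Estimate.

(** * Differentiability of Taylor series *)

Section Differentiability.
Context {R : realType} {m : nat}.
Local Notation C := (Cplx R).
Local Notation Cm := 'rV[Cplx R]_m.
Local Notation A := (mpoly m (Cplx R)).
Implicit Types (P Q : A) (u v : A -> C) (h q p x y : Cm) (w : seq 'I_m).

Lemma coord_le_norm h k : `|h 0 k| <= `|h|.
Proof.
rewrite real_leNgt ?normr_real//; apply/negP => hk.
have : ball h `|h 0 k| (0 : Cm) by rewrite mx_norm_ball /ball_ /= subr0.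
by case=> _ /(_ 0 k); rewrite -ball_normE /ball_ /= mxE subr0 ltxx.
Qed.

Lemma l1norm_le_norm h : (l1norm h)%:C%C <= m%:R * `|h|.
Proof.
rewrite rmorph_sum /=; apply: (@le_trans _ _ (\sum_(k < m) `|h|)).
  by apply: ler_sum => k _; rewrite -nrmE coord_le_norm.
by rewrite sumr_const card_ord mulr_natl.
Qed.

Lemma near_l1norm q (e : R) : 0 < e -> \forall x \near q, l1norm (x - q) < e.
Proof.
move=> e0; pose d : C := (e / (m.+1)%:R)%:C%C.
have d0 : 0 < d by rewrite ltcR divr_gt0.
have := @nbhsx_ballx _ _ q d d0.
apply: filterS => x; rewrite mx_norm_ball /ball_ /= => xd.
rewrite -ltcR; apply: le_lt_trans (l1norm_le_norm _) _; rewrite distrC.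
apply: (@le_lt_trans _ _ (m%:R * d)); first by rewrite ler_wpM2l// ltW.
rewrite /d -[m%:R : C](rmorph_nat (real_complex R)) -rmorphM ltcR.
by rewrite mulrC -mulrA gtr_pMr// mulrC ltr_pdivrMr// mul1r ltr_nat.
Qed.

Lemma taylor_quadratic M u : 1 <= M -> lin u -> Bd M u -> exists2 K : R, 0 <= K &
  forall h, 8 * M * l1norm h <= 1 -> nrm (taylor u h - u 1 - u (lform h)) <= K * l1norm h ^+ 2.
Proof.
move=> M1 ul uM; have M0 := le_trans ler01 M1.
have [K [d [K0 uK]]] := uM.
pose K1 := K * (2 * M) ^+ d * d`!%:R.
have K10 : 0 <= K1 by rewrite !mulr_ge0// exprn_ge0// mulr_ge0.
exists (8 * K1 * (4 * M) ^+ 2).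
  by apply: mulr_ge0; [exact: mulr_ge0|exact/exprn_ge0/mulr_ge0].
move=> h Mh; have h0 := l1norm_ge0 h.
set a := 4 * M * l1norm h; have a0 : 0 <= a by rewrite !mulr_ge0.
have aT n : nrm (taylor_term u h n) <= K1 * a ^+ n.
  have := @taylor_term_le _ _ M K d u h 0 [::] 0%N n ul M0 K0 uK.
  rewrite mon_nil mulr1 !expr0 mulr1 mul1r [_ * n`!%:R](_ : _ = n`!%:R) ?mul1r//.
  by rewrite /taylor_term nrmM nrmV nrm_nat.
pose v n := if (n < 2)%N then 0 else taylor_term u h n.
have vg : geo (4 * K1 * a ^+ 2) v.
  have Q0 : 0 <= 4 * K1 * a ^+ 2 by apply/mulr_ge0/exprn_ge0 => //; exact: mulr_ge0.
  have v0 : v 0%N = 0 by []. have v1 : v 1%N = 0 by [].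
  have v2 n : v n.+2 = taylor_term u h n.+2 by [].
  move=> [|[|n]]; rewrite ?v0 ?v1 ?v2; try by rewrite nrm0 mulr_ge0// exprn_ge0.
  apply: le_trans (aT _) _.
  have E2 (z : R) : z ^+ n.+2 = z ^+ 2 * z ^+ n by rewrite -exprD.
  have an : a ^+ n <= 2^-1 ^+ n by apply: exp_half => //; rewrite /a; lra.
  have an2 : K1 * a ^+ 2 * a ^+ n <= K1 * a ^+ 2 * 2^-1 ^+ n.
    by rewrite ler_wpM2l// mulr_ge0// exprn_ge0.
  have q4 : (2^-1 : R) ^+ 2 = 4^-1 by rewrite expr2; lra.
  rewrite !E2 q4; move: (a ^+ 2) (a ^+ n) (2^-1 ^+ n) an2 => x y z; lra.
(* The series v starts at order 2, so that the partial sums differ by the terms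
of order 0 and 1. *)
have PE k : psum (taylor_term u h) k.+2 + (- u 1 - u (lform h)) = psum v k.+2.
  rewrite /psum !big_ord_recl.
  have -> : taylor_term u h (@ord0 k.+1) = u 1 by rewrite /taylor_term expr0 fact0 divr1.
  have -> : taylor_term u h (lift ord0 (@ord0 k)) = u (lform h) by rewrite /taylor_term expr1 divr1.
  rewrite [in RHS]/v /= !add0r; set X := \sum_(i < k) _.
  by move: (u 1) (u (lform h)) X => z t s; ring.
have Sv : taylor u h - u 1 - u (lform h) = csum v.
  have c := ccvgD (taylor_cvg M0 ul uM Mh) (ccvg_cst (- u 1 - u (lform h))).
  symmetry; apply: csumE; rewrite -addrA => e /c[N HN].
  by exists (N + 2)%N => -[|[|n]] Nn; [lia|lia|rewrite -PE; apply: HN; lia].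
have := csum_le vg; rewrite Sv /a => H; apply: le_trans H _.
by rewrite !exprMn; lra.
Qed.

Definition dfl (f : 'I_m -> C) h : C := \sum_k h 0 k * f k.

Lemma dfl_is_linear f : linear (dfl f).
Proof.
move=> c h h'; rewrite /dfl scaler_sumr -big_split /=; apply: eq_bigr => k _.
by rewrite !mxE mulrDl -mulrA.
Qed.
HB.instance Definition _ f := GRing.isLinear.Build C Cm C _ (dfl f) (dfl_is_linear f).

Lemma dfl_continuous f : continuous (dfl f).
Proof.
move=> x; apply: differentiable_continuous.
have -> : dfl f = \sum_k (fun h : Cm => h 0 k * f k).
  apply/funext => h; rewrite /dfl; elim: (index_enum _) => [|k s IH]; first by rewrite !big_nil.
  by rewrite !big_cons IH.
apply: differentiable_sum => k; apply: differentiableM; last exact: differentiable_cst.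
exact: differentiable_coord.
Qed.

Lemma diff_quadratic (g : Cm -> C) (x : Cm) f (K e : R) : 0 <= K -> 0 < e ->
  (forall h, l1norm h < e -> nrm (g (x + h) - g x - dfl f h) <= K * l1norm h ^+ 2) ->
  differentiable g x /\ 'd g x = dfl f :> (_ -> _).
Proof.
move=> K0 e0 H.
have E : g \o shift x = cst (g x) + dfl f +o_ (0 : Cm) id.
  apply/eqaddoP => eps eps0.
  have epsE : eps = (nrm eps)%:C%C by rewrite -nrmE gtr0_norm.
  have n0 : 0 < nrm eps by rewrite -ltcR -epsE.
  have mK : 0 < m%:R * K + 1 by rewrite ltr_wpDl// mulr_ge0.
  have d0 : 0 < Num.min e (nrm eps / (m%:R * K + 1)) by rewrite lt_min e0 divr_gt0.
  have := near_l1norm 0 d0; apply: filterS => h; rewrite subr0 lt_min => /andP[he hd].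
  have := H h he; rewrite -lecR -nrmE => Hh.
  rewrite !fctE /= opprD addrA (addrC h); apply: le_trans Hh _.
  rewrite epsE expr2 mulrA rmorphM /=.
  apply: (@le_trans _ _ ((K * l1norm h)%:C%C * (m%:R * `|h|))).
    by rewrite ler_wpM2l ?l1norm_le_norm// lecR mulr_ge0// l1norm_ge0.
  rewrite mulrA ler_wpM2r// -[m%:R : C](rmorph_nat (real_complex R)) -rmorphM lecR.
  have := l1norm_ge0 h => h0; move: hd; rewrite ltr_pdivlMr// => hd; lra.
have dE := diff_unique (@dfl_continuous f) E.
split=> //; apply/diff_locallyP; rewrite dE; split=> //; exact: dfl_continuous.
Qed.

(** Re-expansion at x reduces the claim to the second-order remainder of a Taylor
series at its centre. *)
Lemma taylor_diff M u q x : 1 <= M -> lin u -> Bd M u -> 16 * M * l1norm (x - q) < 1 ->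
  differentiable (fun z => taylor u (z - q)) x /\
  forall k, 'D_(delta_mx 0 k) (fun z => taylor u (z - q)) x = taylor (dd k u) (x - q).
Proof.
move=> M1 ul uM Mx; have Mx' : 8 * M * l1norm (x - q) <= 1.
  by have := mulr_ge0 (le_trans ler01 M1) (l1norm_ge0 (x - q)); lra.
set y := x - q in Mx Mx' *.
have M21 : 1 <= 2 * M by lra.
have rl := lin_reexp M1 ul uM Mx'; have rB := Bd_reexp M1 ul uM Mx'.
have [K K0 HK] := @taylor_quadratic (2 * M) (reexp u y) M21 rl rB.
pose f k := taylor (dd k u) y.
have fE h : dfl f h = reexp u y (lform h).
  by rewrite /lform (lin_sum rl); apply: eq_bigr => k _; rewrite (linZ rl).
have e0 : 0 < (16 * M)^-1 by rewrite invr_gt0; lra.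
have H h : l1norm h < (16 * M)^-1 ->
    nrm (taylor u (x + h - q) - taylor u (x - q) - dfl f h) <= K * l1norm h ^+ 2.
  rewrite -[(16 * M)^-1]mul1r ltr_pdivlMr; last by lra.
  move=> hM; have hM' : 16 * M * l1norm h <= 1 by lra.
  have -> : x + h - q = y + h by rewrite addrAC.
  rewrite (taylor_comp M1 ul uM (ltW Mx) hM') fE.
  have -> : taylor u (x - q) = reexp u y 1 by congr (taylor _ _); apply/funext => P;
    rewrite /mulj mul1r.
  by apply: HK; lra.
have [df dE] := @diff_quadratic (fun z => taylor u (z - q)) x f K _ K0 e0 H.
split=> // k; rewrite deriveE// dE /dfl (bigD1 k)//= big1 ?addr0.
  by rewrite mxE !eqxx mul1r.
by move=> j jk; rewrite mxE (negbTE jk) andbF mul0r.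
Qed.

End Differentiability.

(** * From jets to germs of solutions *)

Section Germs.
Context {R : realType} {m : nat}.
Local Notation C := (Cplx R).
Local Notation Cm := 'rV[Cplx R]_m.
Local Notation A := (mpoly m (Cplx R)).
Implicit Types (P Q : A) (u v : A -> C) (h q p x y z : Cm) (w : seq 'I_m).

Definition jfun u q : Cm -> C := fun z => taylor u (z - q).

Lemma taylor_xx M q k u h : 1 <= M -> lin u -> Bd M u -> 8 * M * l1norm h <= 1 ->
  taylor (xx q k u) h = (q + h) 0 k * taylor u h.
Proof.
move=> M1 ul uM Mh.
have re1 v : taylor v h = reexp v h 1 by congr (taylor _ _); apply/funext => P; rewrite /mulj mul1r.
have E : reexp u h (mderiv k 1) = 0 by rewrite mderiv_1 (lin0 (lin_reexp M1 ul uM Mh)).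
by rewrite !re1 (reexp_xx q k M1 ul uM Mh) /xx E addr0.
Qed.

Section Local.
Variables (M : R) (q : Cm) (M1 : 1 <= M).
(** The ball where the series and its re-expansions converge. *)
Let U z := 16 * M * l1norm (z - q) < 1.

Lemma nearU z : U z -> \forall y \near z, U y.
Proof.
move=> Uz; have M0 : 0 < M by exact: lt_le_trans M1.
have d0 : 0 < (1 - 16 * M * l1norm (z - q)) / (16 * M).
  by rewrite divr_gt0 ?mulr_gt0// subr_gt0.
have := near_l1norm z d0; apply: filterS => y.
rewrite ltr_pdivlMr ?mulr_gt0// /U => yz.
have := l1normD (y - z) (z - q); rewrite addrA subrK => H.
by have := ler_wpM2l (ltW M0) H; lra.
Qed.

Lemma U8 z : U z -> 8 * M * l1norm (z - q) <= 1.
Proof.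
rewrite /U => Uz; have M0 : 0 <= M by exact: le_trans M1.
by have := mulr_ge0 M0 (l1norm_ge0 (z - q)); lra.
Qed.

Lemma nearU0 : \forall z \near q, U z.
Proof. by apply: nearU; rewrite /U subrr l1norm0 mulr0. Qed.

(** The function g only has to agree with the series near q, so that the lemma
applies to each of the nested theta_k and theta of E_C. *)
Lemma theta_kE (g : Cm -> C) v k : lin v -> Bd M v ->
  (forall z, U z -> g z = jfun v q z) ->
  forall z, U z -> theta_k k g z = jfun (th q k v) q z.
Proof.
move=> vl vM gv z Uz; rewrite /theta_k /pderiv.
rewrite (@near_eq_derive _ _ _ g (jfun v q)); last first.
  by have := nearU Uz; apply: filterS => y; exact: gv.
have [_ ->] := taylor_diff M1 vl vM Uz.
rewrite /jfun /th (taylor_xx _ _ M1 (lin_dd k vl) (Bd_dd k vM) (U8 Uz)).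
by rewrite (addrC q) subrK.
Qed.

Lemma jfun_comb c u v z : lin u -> lin v -> Bd M u -> Bd M v -> U z ->
  jfun (c *: u + v) q z = c * jfun u q z + jfun v q z.
Proof. by move=> ul vl uM vM Uz; apply: (taylor_lin (M := M)) => //; exact: U8. Qed.

Lemma jfun_add u v z : lin u -> lin v -> Bd M u -> Bd M v -> U z ->
  jfun (u + v) q z = jfun u q z + jfun v q z.
Proof.
move=> ul vl uM vM Uz; have := jfun_comb 1 ul vl uM vM Uz.
by rewrite scale1r mul1r.
Qed.

Lemma jfun_zero z : jfun (0 : A -> C) q z = 0.
Proof.
apply: csumE; rewrite (_ : psum _ = fun=> 0); first exact: ccvg_cst.
by apply/funext => n; rewrite /psum big1 // => i _; rewrite /taylor_term jet0 mul0r.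
Qed.

Lemma jfun_scale c u z : lin u -> Bd M u -> U z -> jfun (c *: u) q z = c * jfun u q z.
Proof.
move=> ul uM Uz; have := jfun_comb c ul lin_zero uM (Bd_zero _) Uz.
by rewrite addr0 jfun_zero addr0.
Qed.

Lemma thetaE (g : Cm -> C) v : lin v -> Bd M v ->
  (forall z, U z -> g z = jfun v q z) ->
  forall z, U z -> theta g z = jfun (TH q v) q z.
Proof.
move=> vl vM gv z Uz; rewrite /theta /TH.
suff H s : \sum_(k <- s) theta_k k g z = jfun (\sum_(k <- s) th q k v) q z /\
   Bd M (\sum_(k <- s) th q k v) by case: (H (index_enum 'I_m)).
elim: s => [|k s [IH IB]].
  by rewrite !big_nil jfun_zero; split=> //; exact: Bd_zero.
have kl := lin_th q k vl; have kB := Bd_th M1 q k vl vM.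
have sl : lin (\sum_(k <- s) th q k v) by apply: lin_big => j; exact: lin_th.
rewrite !big_cons; split; last by apply: Bd_add.
by rewrite jfun_add// IH (theta_kE k vl vM gv Uz).
Qed.

Lemma FSol_solution a b c u : FSol q a b c u -> Bd M u ->
  solution_at a b c q (jfun u q).
Proof.
move=> [ul H] uM; split.
  by have := nearU0; apply: filterS => z Uz; case: (taylor_diff M1 ul uM Uz).
move=> k; have := nearU0; apply: filterS => z Uz; rewrite /E_C.
pose v1 := th q k u + (c k - 1) *: u.
have kl := lin_th q k ul; have kB := Bd_th M1 q k ul uM.
have v1l : lin v1 by apply: lin_add => //; exact: lin_scale.
have v1B : Bd M v1 by apply: Bd_add => //; exact: Bd_scale.
rewrite (theta_kE k v1l v1B) //; last first.
  move=> y Uy; rewrite (theta_kE k ul uM)// /v1 jfun_add// ?jfun_scale//; first exact: lin_scale.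
  exact: Bd_scale.
pose v2 := TH q u + b *: u.
have v2l : lin v2 := lin_THs q b ul.
have v2B : Bd M v2 by exact: Bd_THs.
have gE y : U y -> theta (jfun u q) y + b * jfun u q y = jfun v2 q y.
  move=> Uy; rewrite (thetaE ul uM)// /v2 jfun_add// ?jfun_scale//.
  - exact: lin_TH.
  - exact: lin_scale.
  - exact: Bd_TH.
  - exact: Bd_scale.
rewrite /= (thetaE (v := v2) v2l v2B gE Uz) gE//.
pose v3 := TH q v2 + a *: v2.
have -> : jfun (TH q v2) q z + a * jfun v2 q z = jfun v3 q z.
  rewrite /v3 jfun_add// ?jfun_scale//.
  - exact: lin_TH.
  - exact: lin_scale.
  - exact: Bd_TH.
  - exact: Bd_scale.
have -> : z 0 k * jfun v3 q z = jfun (xx q k v3) q z.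
  rewrite /jfun (taylor_xx q k M1 _ _ (U8 Uz)) 1?(addrC q) ?subrK//; first exact: lin_THs.
  exact: Bd_THs.
by rewrite /v1 H subrr.
Qed.

Lemma jfun_holomorphic u : lin u -> Bd M u -> holomorphic_at (jfun u q) q.
Proof.
move=> ul uM; have := nearU0; apply: filterS => z Uz.
by case: (taylor_diff M1 ul uM Uz).
Qed.

(** All derivatives of the function vanish at q, and these are the values of u. *)
Lemma jfun_inj u : lin u -> Bd M u -> (\forall z \near q, jfun u q z = 0) -> u = 0.
Proof.
move=> ul uM u0; apply: lin_ext => // [|w]; first exact: lin_zero.
rewrite jet0; elim: w u ul uM u0 => [|k w IH] u ul uM u0.
  have := nbhs_singleton u0; rewrite /jfun subrr mon_nil => <-; symmetry; exact: S0.
rewrite mon_cons -[LHS]/(dd k u (mon w)); apply: IH; [exact: lin_dd|exact: Bd_dd|].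
have := near_join u0; have := nearU0; apply: filterS2 => z Uz z0.
have [_ H] := taylor_diff M1 ul uM Uz.
rewrite -[LHS]/(taylor (dd k u) (z - q)) -H.
rewrite (@near_eq_derive _ _ _ (fun z => taylor u (z - q)) (cst 0))//.
by rewrite derive_cst.
Qed.

Lemma jfun_reexp u p : lin u -> Bd M u -> 16 * M * l1norm (p - q) <= 1 ->
  germ_of p (jfun (reexp u (p - q)) p) = germ_of p (jfun u q).
Proof.
move=> ul uM Mp; apply/germ_ofP.
have e0 : 0 < (16 * M)^-1 by rewrite invr_gt0; move: M1; lra.
have := near_l1norm p e0; apply: filterS => z; rewrite -[_^-1]mul1r ltr_pdivlMr; last first.
  by move: M1; lra.
move=> zp; rewrite /jfun -(taylor_comp M1 ul uM Mp); last by lra.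
by rewrite addrC addrA subrK.
Qed.

End Local.

End Germs.

(** * Continuation of jets along paths *)

Section Paths.
Context {R : realType} {m : nat}.
Local Notation C := (Cplx R).
Local Notation Cm := 'rV[Cplx R]_m.
Local Notation A := (mpoly m (Cplx R)).
Implicit Types (h q p : Cm).

(** At the supremum T of the times where P holds, the hypothesis leads from a time
just below T to one just above it. *)
Lemma interval_induction (P : R -> Prop) : P 0 ->
  (forall t, 0 <= t <= 1 -> exists2 d, 0 < d & forall s u : R, 0 <= s -> s <= u ->
     u <= 1 -> `|s - t| < d -> `|u - t| < d -> P s -> P u) -> P 1.
Proof.
move=> P0 H; pose E := [set t : R | 0 <= t <= 1 /\ P t].
have E0 : E 0 by split; rewrite ?lexx ?ler01.
have Eub : ubound E 1 by move=> t [/andP[]].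
have supE : has_sup E by split; [exists 0|exists 1].
have T1 : sup E <= 1 by apply: ge_sup => //; exists 0.
have T0 : 0 <= sup E by apply: ub_le_sup => //; exists 1.
have [d d0 Hd] := H (sup E) ltac:(by rewrite T0).
have [s [s01 Ps] sT] := sup_adherent d0 supE.
have sE : s <= sup E by apply: ub_le_sup => //; exists 1.
have /andP[s0 s1] := s01.
pose u := Num.min 1 (sup E + d / 2).
have Pu : P u.
  apply: (Hd s) => //.
  - by rewrite /u le_min s1 /=; lra.
  - by rewrite /u ge_min lexx.
  - by rewrite ltr_norml; apply/andP; split; lra.
  - rewrite /u ltr_norml; case: (leP 1 (sup E + d / 2)) => ?; apply/andP; split; lra.
have uE : u <= sup E.
  apply: ub_le_sup; first by exists 1.
  split=> //; rewrite /u ge_min lexx andbT le_min ler01 /=; lra.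
have -> : 1 = u; last exact: Pu.
by move: uE; rewrite /u; case: (leP 1 (sup E + d / 2)) => // _; lra.
Qed.

Definition cont01 (gamma : R -> Cm) := forall t, 0 <= t <= 1 -> forall e, 0 < e ->
  exists2 d, 0 < d & forall s, 0 <= s <= 1 -> `|s - t| < d ->
    l1norm (gamma s - gamma t) < e.

Lemma within_cont01 gamma : {within `[(0 : R), 1], continuous gamma} -> cont01 gamma.
Proof.
move=> /subspace_continuousP gc t t01 e e0.
have := gc t; rewrite /= in_itv /= => /(_ t01) /(_ _ (near_l1norm (gamma t) e0)).
move=> /nbhs_ballP[d /= d0 H]; exists d => // s s01 st.
apply: H; last by rewrite /= in_itv.
by rewrite -ball_normE /ball_ /= distrC.
Qed.

Lemma propagate (Z : Cm -> Prop) gamma : cont01 gamma ->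
  (forall t, 0 <= t <= 1 -> X_C (gamma t)) ->
  (forall p, X_C p -> exists2 r, 0 < r & forall q q', l1norm (q - p) < r ->
     l1norm (q' - p) < r -> Z q -> Z q') ->
  Z (gamma 0) -> Z (gamma 1).
Proof.
move=> gc gX ZX Z0; apply: (interval_induction (P := fun t => Z (gamma t))) => // t t01.
have [r r0 Hr] := ZX _ (gX t t01); have [d d0 Hd] := gc t t01 r r0.
exists d => // s u s0 su u1 st ut; apply: Hr; apply: Hd => //.
  by rewrite s0 (le_trans su).
by rewrite u1 (le_trans s0).
Qed.

Section JetPath.
Variable Q : Cm -> (A -> C) -> Prop.
Hypothesis Qloc : forall p, X_C p -> exists r M : R, [/\ 0 < r, 1 <= M,
  32 * M * r <= 1 & forall q, l1norm (q - p) < r ->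
  forall u, Q q u -> lin u /\ Bd M u].
Hypothesis Qre : forall q u M h, 1 <= M -> Q q u -> lin u -> Bd M u ->
  8 * M * l1norm h <= 1 -> Q (q + h) (reexp u h).

Lemma small_diff (M r : R) p q q' : 1 <= M -> 32 * M * r <= 1 ->
  l1norm (q - p) < r -> l1norm (q' - p) < r -> 16 * M * l1norm (q' - q) <= 1.
Proof.
move=> M1 Mr qp q'p; have M0 : 0 <= M by exact: le_trans M1.
have := l1normD (q' - p) (- (q - p)); rewrite l1normN opprB addrA subrK => H.
have : M * l1norm (q' - q) <= M * (2 * r) by apply: ler_wpM2l => //; lra.
lra.
Qed.

(** Near each time t the jets in play share a radius of convergence larger than
the variation of the path, so that a family defined up to time s extends to
time u by re-expanding its last member at gamma s. *)
Lemma jet_path gamma u0 : cont01 gamma ->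
  (forall t, 0 <= t <= 1 -> X_C (gamma t)) -> Q (gamma 0) u0 ->
  exists B : R -> A -> C, B 0 = u0 /\ forall t, 0 <= t <= 1 ->
    Q (gamma t) (B t) /\ exists2 d, 0 < d & forall s, 0 <= s <= 1 ->
      `|s - t| < d -> B s = reexp (B t) (gamma s - gamma t).
Proof.
move=> gc gX Q0.
pose P T := exists B : R -> A -> C, B 0 = u0 /\ forall t, 0 <= t <= T ->
    Q (gamma t) (B t) /\ exists2 d, 0 < d & forall s, 0 <= s <= T ->
      `|s - t| < d -> B s = reexp (B t) (gamma s - gamma t).
suff : P 1 by [].
apply: interval_induction.
  exists (fun=> u0); split=> // t /le_anti <-; split=> //; exists 1 => // s /le_anti <- _.
  have [|r [M [r0 M1 Mr Hr]]] := Qloc (p := gamma 0); first by apply: gX; rewrite lexx ler01.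
  have [|ul _] := Hr (gamma 0) _ _ Q0; first by rewrite subrr l1norm0.
  by rewrite subrr reexp0.
move=> t t01; have [r [M [r0 M1 Mr Hr]]] := Qloc (gX t t01).
have [d d0 Hd] := gc t t01 r r0.
exists d => // s u s0 su u1 st ut [B [B0 HB]].
have rng v : s <= v <= u -> l1norm (gamma v - gamma t) < r.
  move=> /andP[sv vu]; apply: Hd; first by apply/andP; split; lra.
  by move: st ut; rewrite !ltr_norml => /andP[? ?] /andP[? ?]; apply/andP; split; lra.
have rs : l1norm (gamma s - gamma t) < r by apply: rng; rewrite lexx.
have [Qs [dS dS0 Hs]] := HB s ltac:(by rewrite s0 lexx).
have [Bl BM] := Hr _ rs _ Qs.
have M0 : 0 <= M by exact: le_trans M1.
have small v v' : s <= v <= u -> s <= v' <= u -> 16 * M * l1norm (gamma v' - gamma v) <= 1.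
  by move=> /rng hv /rng hv'; exact: small_diff M1 Mr hv hv'.
(* The two definitions agree at s, where re-expansion is trivial. *)
pose B' v := if v <= s then B v else reexp (B s) (gamma v - gamma s).
have B's v : s <= v -> B' v = reexp (B s) (gamma v - gamma s).
  move=> sv; rewrite /B'; case: leP => // vs.
  have -> : v = s by apply/eqP; rewrite eq_le vs.
  by rewrite subrr reexp0.
exists B'; split; first by rewrite /B' s0.
move=> v /andP[v0 vu]; case: (ltgtP v s) => [vs|sv|vs].
- rewrite /B' (ltW vs); have [|Qv [dv dv0 Hv]] := HB v; first by rewrite v0 ltW.
  split=> //; exists (Num.min dv (s - v)); first by rewrite lt_min dv0 subr_gt0.
  move=> x /andP[x0 xu]; rewrite lt_min => /andP[xd xs].
  have xs' : x <= s by move: xs; rewrite ltr_norml => /andP[_]; lra.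
  by rewrite xs'; apply: Hv => //; rewrite x0.
- have svu : s <= v <= u by rewrite (ltW sv).
  have suu : s <= s <= u by rewrite lexx.
  have h1 := small _ _ suu svu.
  split.
    rewrite B's ?(ltW sv)//; have := Qre (h := gamma v - gamma s) M1 Qs Bl BM.
    rewrite [_ + (_ - _)](_ : _ = gamma v); last by rewrite addrC subrK.
    apply; have := mulr_ge0 M0 (l1norm_ge0 (gamma v - gamma s)); lra.
  exists (v - s); first by rewrite subr_gt0.
  move=> x /andP[x0 xu]; rewrite ltr_norml => /andP[vx _].
  have sx : s <= x by lra.
  have h2 := small v x svu ltac:(by rewrite sx).
  rewrite (B's x sx) (B's v (ltW sv)) -(reexp_comp M1 Bl BM h1 h2); congr reexp.
  by rewrite [RHS]addrC [RHS]addrA subrK.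
- rewrite vs; have E : B' s = B s by rewrite /B' lexx.
  rewrite E; split=> //; exists dS => // x /andP[x0 xu] xs.
  case: (leP x s) => xs'; last by rewrite B's// ltW.
  by rewrite /B' xs'; apply: Hs => //; rewrite x0.
Qed.

End JetPath.

(** The product of the operators theta + z for z in s, the last entry of s acting
first. *)
Definition Dprod q (s : seq C) u : A -> C := foldr (fun z v => TH q v + z *: v) u s.

Lemma lin_Dprod q s (u : A -> C) : lin u -> lin (Dprod q s u).
Proof. by move=> ul; elim: s => //= z s IH; exact: lin_THs. Qed.

Lemma Bd_Dprod M q s (u : A -> C) : 1 <= M -> lin u -> Bd M u -> Bd M (Dprod q s u).
Proof.
by move=> M1 ul uM; elim: s => //= z s IH; apply: Bd_THs => //; exact: lin_Dprod.
Qed.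

Lemma reexp_Dprod M q s (u : A -> C) h : 1 <= M -> lin u -> Bd M u -> 8 * M * l1norm h <= 1 ->
  reexp (Dprod q s u) h = Dprod (q + h) s (reexp u h).
Proof.
move=> M1 ul uM Mh; elim: s => //= z s IH.
by rewrite (reexp_THs M1) ?IH//; [exact: lin_Dprod|exact: Bd_Dprod].
Qed.

Lemma Dprod_comb q s (c : C) (u v : A -> C) :
  Dprod q s (c *: u + v) = c *: Dprod q s u + Dprod q s v.
Proof.
elim: s => //= z s ->; rewrite THD THZ !scalerDr !scalerA [z * c]mulrC addrACA.
by [].
Qed.

Lemma Dprod0 q s : Dprod q s 0 = 0.
Proof. by elim: s => //= z s ->; rewrite TH0 scaler0 addr0. Qed.

End Paths.

(** * A criterion for reducibility *)

Section Criterion.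
Context {R : realType} {m : nat}.
Local Notation C := (Cplx R).
Local Notation Cm := 'rV[Cplx R]_m.
Local Notation A := (mpoly m (Cplx R)).
Implicit Types (h q p : Cm) (u v g : A -> C).

Lemma Bd_mono M M' u : 1 <= M -> M <= M' -> Bd M u -> Bd M' u.
Proof.
move=> M1 MM [K [d [K0 uK]]]; exists K, d; split=> // w; apply: le_trans (uK w) _.
rewrite ler_wpM2r// ler_wpM2l// lerXn2r// nnegrE; first exact: le_trans M1.
by apply: le_trans MM; exact: le_trans M1.
Qed.

Lemma FSol_local (a a1 b : C) (c : 'I_m -> C) p : X_C p ->
  exists r M : R, [/\ 0 < r, 1 <= M, 32 * M * r <= 1 &
    forall q, l1norm (q - p) < r -> forall u,
    (FSol q a b c u -> lin u /\ Bd M u) /\ (FSol q a1 b c u -> lin u /\ Bd M u)].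
Proof.
move=> pX; have [r [M [r0 M1 H]]] := FSol_bound a b c pX.
have [r' [M' [r'0 M'1 H']]] := FSol_bound a1 b c pX.
pose M2 := M + M'; have M20 : 0 < 32 * M2 by rewrite /M2; lra.
exists (Num.min (Num.min r r') (32 * M2)^-1), M2; split.
- by rewrite !lt_min r0 r'0 invr_gt0.
- by rewrite /M2; lra.
- by rewrite mulrC -ler_pdivlMr// div1r ge_min lexx orbT.
- move=> q; rewrite !lt_min => /andP[/andP[qr qr'] _] u; split=> uS; split; try by case: uS.
  + by apply: (Bd_mono M1); [rewrite /M2; lra|exact: H uS].
  + by apply: (Bd_mono M'1); [rewrite /M2; lra|exact: H' uS].
Qed.

Lemma reexpK M v h : 1 <= M -> lin v -> Bd M v -> 16 * M * l1norm h <= 1 ->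
  reexp (reexp v h) (- h) = v.
Proof.
move=> M1 vl vM Mh; have Mh' : 16 * M * l1norm (- h) <= 1 by rewrite l1normN.
by rewrite -(reexp_comp M1 vl vM Mh Mh') subrr reexp0.
Qed.

Lemma germ_comb p (k : C) (f g : Cm -> C) :
  k *: germ_of p f + germ_of p g = germ_of p (fun z => k * f z + g z).
Proof. by rewrite -[k *: _]/(germ_scale k _) germ_scaleE; exact: germ_addE. Qed.

Lemma FSol_comb q (a b : C) c (k : C) u u' : FSol q a b c u -> FSol q a b c u' ->
  FSol q a b c (k *: u + u').
Proof.
move=> [ul uE] [ul' uE']; split=> [|j]; first exact: lin_comb.
have Ej z : th q j (th q j (k *: u + u') + z *: (k *: u + u')) =
  k *: th q j (th q j u + z *: u) + th q j (th q j u' + z *: u').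
  rewrite -thZ -thD; congr (th _ _ _).
  by rewrite thD thZ !scalerDr !scalerA (mulrC z) addrACA.
have Et z : TH q (k *: u + u') + z *: (k *: u + u') =
  k *: (TH q u + z *: u) + (TH q u' + z *: u').
  by rewrite THD THZ !scalerDr !scalerA (mulrC z) addrACA.
rewrite Ej uE uE' Et -xxZ -xxD; congr (xx _ _ _).
move: (TH q u + b *: u) (TH q u' + b *: u') => x y.
by rewrite THD THZ !scalerDr !scalerA (mulrC a) addrACA.
Qed.

Section Transport.
Variables (a a1 b : C) (c : 'I_m -> C) (s1 s2 : seq C) (restricted : bool).

(** Kernels and images of products of shift operators are treated together.  The
invariant subspace is the image under [Dprod q s2] of [source q].  For a kernel,
a1 = a, s2 is empty and [restricted] holds; for an image, [restricted] is
false. *)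
Definition source q u := FSol q a1 b c u /\ (restricted -> Dprod q s1 u = 0).

(** That the invariant subspace is neither 0 nor everything are properties which
propagate along paths; it suffices to know them at one point. *)
Definition nonzero_image q := exists u, source q u /\ Dprod q s2 u <> 0.
Definition missed_solution q := exists u, FSol q a b c u /\ forall g, source q g ->
  Dprod q s2 g <> u.

Lemma source_reexp q u M h : 1 <= M -> source q u -> lin u -> Bd M u ->
  8 * M * l1norm h <= 1 -> source (q + h) (reexp u h).
Proof.
move=> M1 [uS u0] ul uM Mh; split; first exact: reexp_FSol uS uM Mh.
by move=> /u0 u0'; rewrite -(reexp_Dprod q s1 M1 ul uM Mh) u0' reexp_zero.
Qed.

Lemma source_local p : X_C p -> exists r M : R, [/\ 0 < r, 1 <= M,
  32 * M * r <= 1 & forall q, l1norm (q - p) < r ->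
  forall u, source q u -> lin u /\ Bd M u].
Proof.
move=> /(FSol_local a1 a1 b c)[r [M [r0 M1 Mr H]]]; exists r, M; split=> // q qp u [uS _].
exact: (H q qp u).2.
Qed.

Lemma nonzero_image_step p : X_C p -> exists2 r : R, 0 < r & forall q q',
  l1norm (q - p) < r -> l1norm (q' - p) < r -> nonzero_image q -> nonzero_image q'.
Proof.
move=> pX; have [r [M [r0 M1 Mr H]]] := source_local pX; exists r => // q q' qp qp' [u [uQ u0]].
have [ul uM] := H _ qp _ uQ.
have h16 := small_diff M1 Mr qp qp'.
have h8 : 8 * M * l1norm (q' - q) <= 1.
  by have := mulr_ge0 (le_trans ler01 M1) (l1norm_ge0 (q' - q)); lra.
have qE : q + (q' - q) = q' by rewrite addrC subrK.
exists (reexp u (q' - q)); split; first by have := source_reexp M1 uQ ul uM h8; rewrite qE.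
rewrite -{1}qE -(reexp_Dprod q s2 M1 ul uM h8) => E; apply: u0.
have Dl := lin_Dprod q s2 ul; have DM := Bd_Dprod q s2 M1 ul uM.
by rewrite -(reexpK M1 Dl DM h16) E reexp_zero.
Qed.

Lemma missed_solution_step p : X_C p -> exists2 r : R, 0 < r & forall q q',
  l1norm (q - p) < r -> l1norm (q' - p) < r -> missed_solution q -> missed_solution q'.
Proof.
move=> pX; have [r [M [r0 M1 Mr H]]] := FSol_local a a1 b c pX.
exists r => // q q' qp qp' [u [uS uD]].
have [ul uM] := (H _ qp u).1 uS.
have h16 := small_diff M1 Mr qp qp'.
have h8 : 8 * M * l1norm (q' - q) <= 1.
  by have := mulr_ge0 (le_trans ler01 M1) (l1norm_ge0 (q' - q)); lra.
have h8' : 8 * M * l1norm (- (q' - q)) <= 1 by rewrite l1normN.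
have qE : q + (q' - q) = q' by rewrite addrC subrK.
have qE' : q' + - (q' - q) = q by rewrite opprB addrC subrK.
exists (reexp u (q' - q)); split; first by have := reexp_FSol M1 uS uM h8; rewrite qE.
move=> g gQ gE; have [gl gM] := (H _ qp' g).2 gQ.1.
apply: (uD (reexp g (- (q' - q)))); first by have := source_reexp M1 gQ gl gM h8'; rewrite qE'.
rewrite -{1}qE' -(reexp_Dprod q' s2 M1 gl gM h8') gE.
exact: reexpK M1 ul uM h16.
Qed.

Hypothesis D_FSol : forall q u, FSol q a1 b c u -> FSol q a b c (Dprod q s2 u).

(** Shift operators commute with re-expansion, hence with continuation: the
continuation of D u along a loop is D applied to the jet at time 1 of the path
of jets that starts at u. *)
Lemma reducible_of_jets a' b' : X_C (xdot : Cm) ->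
  (forall u, FSol xdot a b c u -> FSol xdot a' b' c u) -> nonzero_image xdot ->
    missed_solution xdot ->
  monodromy_reducible a' b' c.
Proof.
move=> xX sol_ab [u1 [u1Q u10]] [u2 [u2S u2D]].
pose W : {pred germ C (xdot : Cm)} := fun e => `[< exists u, source xdot u /\
  e = germ_of xdot (jfun (Dprod xdot s2 u) xdot) >].
have WP e : reflect (exists u, source xdot u /\ e = germ_of xdot (jfun (Dprod xdot s2 u) xdot))
  (e \in W).
  exact: asboolP.
have [r [M [r0 M1 Mr H]]] := FSol_local a a1 b c xX.
have x0 : l1norm ((xdot : Cm) - xdot) < r by rewrite subrr l1norm0.
have Qlin u : source xdot u -> lin u /\ Bd M u by move=> [uS _]; exact: (H _ x0 u).2.
have Dlin u : source xdot u -> lin (Dprod xdot s2 u) /\ Bd M (Dprod xdot s2 u).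
  by move=> /Qlin[ul uM]; split; [exact: lin_Dprod|exact: Bd_Dprod].
have solS u : FSol xdot a b c u -> germ_of xdot (jfun u xdot) \in @Sol R m a' b' c xdot.
  move=> uS; apply/asboolP; exists (jfun u xdot) => //.
  by apply: (@FSol_solution _ _ M xdot M1 _ _ _ _ (sol_ab u uS)); case: ((H _ x0 u).1 uS).
have inj u v : lin u -> Bd M u -> lin v -> Bd M v ->
  germ_of xdot (jfun u xdot) = germ_of xdot (jfun v xdot) -> u = v.
  move=> ul uM vl vM /germ_ofP uv; apply/eqP; rewrite -subr_eq0; apply/eqP.
  have vl' := lin_scale (-1) vl; have vM' := Bd_scale M1 (-1) vM.
  rewrite -scaleN1r; apply: (@jfun_inj _ _ M xdot M1); [exact: lin_add|exact: Bd_add|].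
  apply: filterS2 uv (nearU0 xdot M1) => z uv Uz.
  by rewrite (jfun_add M1)// (jfun_scale M1)// uv mulN1r subrr.
exists W; split.
- split.
    apply/WP; exists 0; split.
      split; last by rewrite Dprod0.
      split=> [|k]; first exact: lin_zero.
      by rewrite th0 TH0 !scaler0 !addr0 th0 TH0 scaler0 addr0 xx0.
    by rewrite Dprod0; apply/germ_ofP; near=> z; rewrite jfun_zero.
  move=> k g g' /WP[u [uQ ->]] /WP[u' [u'Q ->]]; apply/WP; exists (k *: u + u'); split.
    have [uS u0] := uQ; have [uS' u0'] := u'Q.
    by split; [exact: FSol_comb|move=> f; rewrite Dprod_comb u0// u0'// scaler0 addr0].
  rewrite germ_comb; apply/germ_ofP; apply: (filterS _ (nearU0 xdot M1)) => z Uz.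
  have [Dl DM] := Dlin _ uQ; have [Dl' DM'] := Dlin _ u'Q.
  by rewrite Dprod_comb (jfun_comb M1 k Dl Dl' DM DM' Uz).
- by move=> g /WP[u [uQ ->]]; apply/solS/D_FSol; case: uQ.
- exists (germ_of xdot (jfun (Dprod xdot s2 u1) xdot)); first by apply/WP; exists u1.
  apply/eqP => E; apply: u10; have [Dl DM] := Dlin _ u1Q.
  apply: inj => //; [exact: lin_zero|exact: Bd_zero|].
  by rewrite E; apply/germ_ofP; near=> z; rewrite jfun_zero.
- exists (germ_of xdot (jfun u2 xdot)); first exact: solS.
  apply/negP => /WP[g [gQ gE]]; have [Dl DM] := Dlin _ gQ.
  have [ul uM] := (H _ x0 u2).1 u2S.
  by apply: (u2D g gQ); apply: inj.
- move=> gamma [gc g0 g1 gX] _ /WP[u [uQ ->]].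
  have gc' := within_cont01 gc.
  have gX' t : 0 <= t <= 1 -> X_C (gamma t) by move=> t01; apply: gX; rewrite in_itv.
  have [|B [B0 HB]] := jet_path source_local (fun q u M h => @source_reexp q u M h) (u0 := u)
    gc' gX'.
    by rewrite g0.
  have Q1 : source xdot (B 1) by have := (HB 1 ltac:(by rewrite ler01 lexx)).1; rewrite g1.
  exists (germ_of xdot (jfun (Dprod xdot s2 (B 1)) xdot)); first by apply/WP; exists (B 1).
  exists (fun t => jfun (Dprod (gamma t) s2 (B t)) (gamma t)); split.
  + move=> t; rewrite in_itv /= => t01; have [Qt _] := HB t t01.
    have [r' [M' [r'0 M'1 _ H']]] := source_local (gX' t t01).
    have [|tl tM] := H' (gamma t) _ _ Qt; first by rewrite subrr l1norm0.
    by apply: (jfun_holomorphic _ M'1); [exact: lin_Dprod|exact: Bd_Dprod].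
  + move=> t; rewrite in_itv /= => t01; have [Qt [d d0 Hd]] := HB t t01.
    have [r' [M' [r'0 M'1 Mr' H']]] := source_local (gX' t t01).
    have rt : l1norm (gamma t - gamma t) < r' by rewrite subrr l1norm0.
    have [tl tM] := H' (gamma t) rt _ Qt.
    have [d' d'0 Hd'] := gc' t t01 r' r'0.
    have dd0 : 0 < Num.min d d' by rewrite lt_min d0.
    have := nbhsx_ballx t (Num.min d d') dd0; apply: filterS => s.
    rewrite -ball_normE /ball_ /= distrC lt_min => /andP[sd sd'].
    rewrite in_itv /= => s01; have st := Hd' s s01 sd'.
    have h16 := small_diff M'1 Mr' rt st.
    have h8 : 8 * M' * l1norm (gamma s - gamma t) <= 1.
      by have := mulr_ge0 (le_trans ler01 M'1) (l1norm_ge0 (gamma s - gamma t)); lra.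
    rewrite (Hd s s01 sd).
    have -> : Dprod (gamma s) s2 (reexp (B t) (gamma s - gamma t)) =
       reexp (Dprod (gamma t) s2 (B t)) (gamma s - gamma t).
      by rewrite (reexp_Dprod _ _ M'1 tl tM h8); congr (Dprod _ _ _); rewrite addrC subrK.
    by apply: (@jfun_reexp _ _ M' _ M'1) => //; [exact: lin_Dprod|exact: Bd_Dprod].
  + by rewrite B0 g0.
  + by rewrite g1.
Unshelve. all: by end_near.
Qed.

End Transport.

End Criterion.

(** * Lauricella series at the origin *)

Section Hypergeometric.
Context {R : realType} {m : nat}.
Local Notation C := (Cplx R).
Local Notation Cm := 'rV[Cplx R]_m.
Local Notation A := (mpoly m (Cplx R)).
Implicit Types (P Q : A) (h q p : Cm) (u : A -> C) (g : multinom m).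

(** The jet with prescribed values on the monomials. *)
Definition lext (v : multinom m -> C) : A -> C :=
  fun P => \sum_(g <- msupp P) mcoeff g P * v g.

Lemma lextE v P (s : seq (multinom m)) : uniq s -> {subset msupp P <= s} ->
  lext v P = \sum_(g <- s) mcoeff g P * v g.
Proof.
move=> us sub; rewrite (bigID (mem (msupp P))) /= [X in _ + X]big1 ?addr0; last first.
  by move=> g /memN_msupp_eq0 ->; rewrite mul0r.
rewrite -big_filter /lext; apply: perm_big; apply: uniq_perm.
- exact: msupp_uniq.
- exact: filter_uniq.
- by move=> g; rewrite mem_filter /=; case gP: (g \in msupp P); rewrite ?(sub _ gP).
Qed.

Lemma lin_lext v : lin (lext v).
Proof.
move=> c P Q; pose s := undup (msupp (c *: P + Q) ++ msupp P ++ msupp Q).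
have us : uniq s by exact: undup_uniq.
rewrite (lextE v (P := c *: P + Q) us) ?(lextE v (P := P) us) ?(lextE v (P := Q) us).
- rewrite mulr_sumr -big_split /=; apply: eq_bigr => g _.
  by rewrite mcoeffD mcoeffZ mulrDl -mulrA.
- by move=> g gs; rewrite mem_undup !mem_cat gs !orbT.
- by move=> g gs; rewrite mem_undup !mem_cat gs !orbT.
- by move=> g gs; rewrite mem_undup !mem_cat gs.
Qed.

Lemma lextX v g : lext v (mpolyX C g) = v g.
Proof. by rewrite /lext msuppX big_seq1 mcoeffX eqxx mul1r. Qed.

Lemma lin_extX u v : lin u -> lin v -> (forall g, u (mpolyX C g) = v (mpolyX C g)) -> u = v.
Proof. by move=> ul vl H; apply: lin_ext => // w; rewrite monE. Qed.

Lemma dvarM k g : dvar k * mpolyX C g = mpolyX C (mnm_add (mnm1 k) g) :> A.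
Proof. by rewrite mpolyXD. Qed.

Lemma mnm_split g k : (0 < g k)%N -> g = mnm_add (mnm1 k) (mnm_sub g (mnm1 k)).
Proof.
move=> gk; apply/mnmP => j; rewrite mnmDE mnmBE mnm1E.
by case: eqP => [<-|]; rewrite ?subnKC// add0n subn0.
Qed.

(** At the origin theta_k is diagonal on monomials; the system becomes a recursion
on coefficients. *)
Lemma th0X k u g : lin u -> th 0 k u (mpolyX C g) = (g k)%:R * u (mpolyX C g).
Proof.
move=> ul; rewrite /th /xx mxE mul0r add0r mderivX /dd -scalerAr (linZ ul) dvarM.
case: (posnP (g k)) => [->|gk]; first by rewrite !mul0r.
by rewrite -(mnm_split gk).
Qed.

Lemma TH0X u g : lin u -> TH 0 u (mpolyX C g) = (mdeg g)%:R * u (mpolyX C g).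
Proof.
move=> ul; rewrite /TH jet_sum mdegE natr_sum mulr_suml.
by apply: eq_bigr => k _; rewrite th0X.
Qed.

Lemma xx0X k u g : lin u -> xx 0 k u (mpolyX C g) =
  (g k)%:R * u (mpolyX C (mnm_sub g (mnm1 k))).
Proof. by move=> ul; rewrite /xx mxE mul0r add0r mderivX (linZ ul). Qed.

Definition poch (x : C) n := \prod_(i < n) (x + i%:R).

Lemma pochS x n : poch x n.+1 = poch x n * (x + n%:R).
Proof. by rewrite /poch big_ord_recr. Qed.

Lemma pochSl x n : poch x n.+1 = x * poch (x + 1) n.
Proof.
rewrite /poch big_ord_recl addr0; congr (_ * _); apply: eq_bigr => i _.
by rewrite -addrA -[1 + _](natrD _ 1).
Qed.

Section Series.
Variable c : 'I_m -> C.
Hypothesis c_nat : forall k n, c k + n%:R != 0.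

(** Lauricella's coefficients without the factorials of g: the jet takes the
derivatives, not the Taylor coefficients, as values. *)
Definition FC_coef (a b : C) g : C :=
  poch a (mdeg g) * poch b (mdeg g) / \prod_k poch (c k) (g k).

Definition FC a b : A -> C := lext (FC_coef a b).

Lemma poch_c k n : poch (c k) n != 0.
Proof. by apply/prodf_neq0 => i _; exact: c_nat. Qed.

Lemma FC_coefS a b g k : FC_coef a b (mnm_add (mnm1 k) g) =
  FC_coef a b g * ((a + (mdeg g)%:R) * (b + (mdeg g)%:R) / (c k + (g k)%:R)).
Proof.
rewrite /FC_coef mdegD mdeg1 add1n !pochS.
rewrite [in LHS](bigD1 k)//= mnmDE mnm1E eqxx add1n pochS.
rewrite (eq_bigr (fun j => poch (c j) (g j))); last first.
  by move=> j jk; rewrite mnmDE mnm1E eq_sym (negbTE jk).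
rewrite [in RHS](bigD1 k)//=.
have P0 : \prod_(j | j != k) poch (c j) (g j) != 0.
  by apply/prodf_neq0 => j _; exact: poch_c.
have := poch_c k (g k); have := c_nat k (g k); move: P0.
move: (poch (c k) (g k)) (c k + _) (\prod_(_ | _) _) => x y z z0 y0 x0.
move: (poch a _) (poch b _) (a + _) (b + _) => A1 B1 A2 B2.
by rewrite !invfM; ring.
Qed.

Lemma FC_FSol a b : FSol 0 a b c (FC a b).
Proof.
have hl := lin_lext (FC_coef a b); split=> // k; rewrite -/(FC a b) in hl *.
have l1 : lin (th 0 k (FC a b) + (c k - 1) *: FC a b).
  by apply: lin_add; [exact: lin_th|exact: lin_scale].
have l2 := lin_THs 0 b hl; have l3 := lin_THs 0 a l2.
apply: lin_extX => [||g]; [exact: lin_th|exact: lin_xx|].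
rewrite (th0X k g l1) (xx0X k g l3) jetD jetZ (th0X k g hl).
case: (posnP (g k)) => [->|gk]; first by rewrite !mul0r.
congr (_ * _); rewrite /FC lextX.
have := mnm_split gk; set g' := mnm_sub _ _ => gE.
rewrite jetD jetZ (TH0X _ l2) jetD jetZ (TH0X _ hl) /FC lextX.
have -> : (g k)%:R = (g' k)%:R + 1 :> C.
  by rewrite -(natrD _ _ 1) /g' mnmBE mnm1E eqxx subnK.
rewrite gE FC_coefS; have := c_nat k (g' k).
move: (FC_coef a b g') (mdeg g')%:R (g' k)%:R (c k) => v n j d dj.
have -> : (j + 1) * (v * ((a + n) * (b + n) / (d + j))) + (d - 1) * (v * ((a + n) * (b + n) / (d
  + j))) =
  v * ((a + n) * (b + n)) * ((d + j) / (d + j)) by ring.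
by rewrite divff// mulr1; ring.
Qed.

Lemma FC_shift a b : TH 0 (FC a b) + a *: FC a b = a *: FC (a + 1) b.
Proof.
have hl := lin_lext (FC_coef a b).
apply: lin_extX => [||g]; [exact: lin_THs|exact/lin_scale/lin_lext|].
rewrite jetD !jetZ (TH0X _ hl) /FC !lextX /FC_coef.
have := pochSl a (mdeg g); rewrite pochS.
move: (poch a _) (poch (a + 1) _) (poch b _) (\prod_k _)^-1 (mdeg g)%:R => x y z t n E.
have -> : a * (y * z * t) = a * y * (z * t) by ring.
by rewrite -E; ring.
Qed.

Lemma FC_at1 a b : FC a b 1 = 1.
Proof.
rewrite -mpolyX0 /FC lextX /FC_coef mdeg0 /poch !big_ord0 mul1r big1 ?divr1// => k _.
by rewrite mnm0E big_ord0.
Qed.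

Lemma poch_bound (x : C) n : nrm (x + n%:R) <= (nrm x + 1) * n.+1%:R.
Proof.
apply: le_trans (nrmD _ _) _; rewrite nrm_nat -natr1.
have := mulr_ge0 (nrm_ge0 x) (ler0n R n); lra.
Qed.

(** For large n the constant 2 would do; the finitely many small n, where c_k + n
could be small, are covered by the sum of the quotients. *)
Lemma c_bound : exists2 D : R, 1 <= D & forall k n, n.+1%:R <= D * nrm (c k + n%:R).
Proof.
have /choice[D HD] : forall k, exists D : R, 0 <= D /\ forall n, n.+1%:R <= D * nrm (c k + n%:R).
  move=> k; pose J := (Num.truncn (2 * nrm (c k) + 1)).+1.
  pose F n := n.+1%:R / nrm (c k + n%:R).
  have F0 n : 0 <= F n by rewrite divr_ge0// nrm_ge0.
  have c0 n : 0 < nrm (c k + n%:R).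
    rewrite lt_neqAle nrm_ge0 andbT eq_sym; apply/eqP => /nrm_eq0 /eqP.
    exact/negP/c_nat.
  exists (\sum_(n < J) F n + 2); split; first by rewrite addr_ge0 ?sumr_ge0.
  move=> n; rewrite mulrDl; set y := nrm (c k + n%:R); have y0 : 0 <= y := nrm_ge0 _.
  have S0 : 0 <= \sum_(n < J) F n by exact: sumr_ge0.
  have [nJ|Jn] := ltnP n J.
    have FS : F n <= \sum_(n < J) F n.
      by rewrite (bigD1 (Ordinal nJ))//= lerDl; exact: sumr_ge0.
    have -> : n.+1%:R = F n * y by rewrite divfK// gt_eqF.
    by have := ler_wpM2r y0 FS; lra.
  have h1 : nrm (n%:R : C) <= y + nrm (c k).
    by have := nrmB (c k + n%:R) (c k); rewrite addrAC subrr add0r.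
  have h2 : 2 * nrm (c k) + 1 < n%:R.
    by apply: lt_le_trans (truncnS_gt _) _; rewrite ler_nat; exact: Jn.
  rewrite nrm_nat in h1; have := mulr_ge0 S0 y0.
  by rewrite -natr1; lra.
exists (1 + \sum_k D k); first by rewrite lerDl sumr_ge0// => k _; case: (HD k).
move=> k n; have [D0 /(_ n) H] := HD k; apply: le_trans H _.
rewrite ler_wpM2r ?nrm_ge0// (bigD1 k)//= addrCA lerDl addr_ge0//.
by apply: sumr_ge0 => j _; case: (HD j).
Qed.

Lemma max_coord g : (0 < mdeg g)%N -> exists k, (mdeg g <= m * g k)%N /\ (0 < g k)%N.
Proof.
move=> g0; have [k kg] : exists k, (mdeg g <= m * g k)%N.
  apply/existsP; rewrite -[X in is_true X]negbK negb_exists; apply/negP => /forallP H.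
  have : (m * mdeg g < m * mdeg g)%N; last by rewrite ltnn.
  rewrite {1}mdegE big_distrr /=.
  have -> : (m * mdeg g = \sum_(k < m) mdeg g)%N by rewrite sum_nat_const card_ord.
  have m0 : (0 < m)%N.
    by case: (posnP m) (g0) => // m0; rewrite mdegE big1// => -[i im] _; exfalso; move: (im);
      rewrite m0.
  rewrite (bigD1 (Ordinal m0))//= [ltnRHS](bigD1 (Ordinal m0))//=.
  rewrite -addSn leq_add//; first by have := H (Ordinal m0); rewrite -ltnNge.
  by apply: leq_sum => k _; have := H k; rewrite -ltnNge => /ltnW.
exists k; split=> //; rewrite lt0n; apply/eqP => gk.
by move: kg; rewrite gk muln0 leqNgt g0.
Qed.

(** Stepping down in a direction k with g_k at least 1/m times the order, the ratio
of successive coefficients is quadratic over linear in the order, that is,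
of linear growth, which the factorial of the Cauchy estimate absorbs. *)
Lemma FC_Bd a b : exists2 M : R, 1 <= M & Bd M (FC a b).
Proof.
have [D D1 HD] := c_bound.
pose M := (nrm a + 1) * (nrm b + 1) * D * m%:R + 1.
have AB0 : 0 <= (nrm a + 1) * (nrm b + 1) by rewrite mulr_ge0// addr_ge0// nrm_ge0.
have D0 : 0 <= D by exact: le_trans D1.
have M1 : 1 <= M by rewrite lerDr mulr_ge0// mulr_ge0.
have M0 : 0 <= M by exact: le_trans M1.
exists M => //; exists 1, 0%N; split=> // w; rewrite monE /FC lextX addn0 mul1r -mdeg_word_mnm.
move: (word_mnm w) => {w}g; move: {2}(mdeg g) (erefl (mdeg g)) => n.
elim: n g => [|n IH] g gn.
  have -> : g = mnm0 by apply/eqP; rewrite -mdeg_eq0 gn.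
  have := FC_at1 a b; rewrite /FC -mpolyX0 lextX => ->.
  by rewrite nrm1 mdeg0 expr0 mul1r.
have [|k [kg gk]] := @max_coord g _; first by rewrite gn.
have gE := mnm_split gk; set g' := mnm_sub g (mnm1 k) in gE.
have gn' : mdeg g' = n by move: gn; rewrite {1}gE mdegD mdeg1 add1n => -[].
have gk' : g k = (g' k).+1 by rewrite {1}gE mnmDE mnm1E eqxx add1n.
rewrite gn {1}gE FC_coefS nrmM.
have := IH g' gn'; rewrite gn' => Hg.
rewrite exprS factS natrM mulrACA mulrC.
set f := nrm (_ / _); apply: (@le_trans _ _ (M ^+ n * n`!%:R * (M * n.+1%:R))); last first.
  by rewrite mulrC.
rewrite mulrC; apply: ler_pM; rewrite ?nrm_ge0//.
rewrite /f !nrmM nrmV.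
have y0 : 0 < nrm (c k + (g' k)%:R).
  rewrite lt_neqAle nrm_ge0 andbT eq_sym; apply/eqP => /nrm_eq0 /eqP; exact/negP/c_nat.
rewrite ler_pdivrMr//.
apply: (@le_trans _ _ ((nrm a + 1) * n.+1%:R * ((nrm b + 1) * n.+1%:R))).
  by apply: ler_pM; rewrite ?nrm_ge0// poch_bound.
have h1 : n.+1%:R <= m%:R * (g k)%:R :> R by rewrite -natrM ler_nat -gn.
have h2 := HD k (g' k); rewrite -gk' in h2.
have h3 : n.+1%:R <= m%:R * D * nrm (c k + (g' k)%:R).
  by apply: le_trans h1 _; rewrite -mulrA ler_wpM2l.
have := ler_wpM2l (mulr_ge0 AB0 (ler0n R n.+1)) h3.
have := mulr_ge0 (ler0n R n.+1) (ltW y0); rewrite /M; lra.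
Qed.

End Series.

End Hypergeometric.

(** * Multiplication by powers of the coordinates *)

Section Twist.
Context {R : realType} {m : nat}.
Local Notation C := (Cplx R).
Local Notation Cm := 'rV[Cplx R]_m.
Local Notation A := (mpoly m (Cplx R)).
Implicit Types (P Q : A) (h q p : Cm) (u v : A -> C) (g : multinom m).

Local Notation msize P := (mmeasure mdeg P).

(** The list is arranged so that [Dprod] applies theta + al first, then
theta + al + 1, and so on: each factor acts on the solutions of the system with
the corresponding parameter. *)
Fixpoint shifts (al : C) n : seq C := if n is n'.+1 then rcons (shifts (al + 1) n') al else [::].

Lemma Dprod_rcons q s z u : Dprod q (rcons s z) u = Dprod q s (TH q u + z *: u).
Proof. by rewrite /Dprod foldr_rcons. Qed.

Lemma FSol_shifts q (al b : C) c n u :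
  FSol q al b c u -> FSol q (al + n%:R) b c (Dprod q (shifts al n) u).
Proof.
elim: n al u => [|n IH] al u uS; first by rewrite addr0.
have -> : al + n.+1%:R = (al + 1) + n%:R by rewrite -natr1 addrAC addrA.
by rewrite [shifts _ _]/= Dprod_rcons; apply: IH; exact: FSol_shift.
Qed.

Lemma FC_shifts (c : 'I_m -> C) (c_nat : forall k n, c k + n%:R != 0) (al b : C) n :
  Dprod 0 (shifts al n) (FC c al b) = poch al n *: FC c (al + n%:R) b.
Proof.
elim: n al => [|n IH] al; first by rewrite addr0 /poch big_ord0 scale1r.
rewrite [shifts _ _]/= Dprod_rcons FC_shift// -[X in Dprod _ _ X]addr0.
rewrite Dprod_comb Dprod0 addr0 IH scalerA -pochSl.
by have -> : al + n.+1%:R = (al + 1) + n%:R by rewrite -natr1 addrAC addrA.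
Qed.

Lemma map_shifts s al n : [seq z + s | z <- shifts al n] = shifts (al + s) n :> seq C.
Proof. by elim: n al => //= n IH al; rewrite map_rcons IH addrAC. Qed.

Section OneVariable.
Variables (k : 'I_m).

Let dk : A -> A := mderiv k.

(** Multiplication by the power series of coefficients f in x_k - q_k.  The sum is
finite because iterating the derivation with respect to d_k kills P. *)
Definition ser (f : nat -> C) u : A -> C := fun P => \sum_(i < msize P) f i * u (iter i dk P).

Lemma iter_dk0 i : iter i dk 0 = 0.
Proof. by elim: i => //= i ->; rewrite /dk mderiv0. Qed.

Lemma iter_dkX i g : (g k < i)%N -> iter i dk (mpolyX C g) = 0.
Proof.
elim: i g => // i IH g gi; rewrite iterSr /dk mderivX -/dk.
case: (posnP (g k)) => [->|gk]; first by rewrite scale0r iter_dk0.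
have H := IH (mnm_sub g (mnm1 k)) _.
have {}H : iter i dk (mpolyX C (mnm_sub g (mnm1 k))) = 0.
  by apply: H; rewrite mnmBE mnm1E eqxx; lia.
move: H; elim: i {IH gi} (mpolyX C _) => [|i IH] P; first by move=> /= ->; rewrite scaler0.
by rewrite !iterSr /dk mderivZ -/dk; exact: IH.
Qed.

Lemma iter_dkD i (c : C) P Q : iter i dk (c *: P + Q) = c *: iter i dk P + iter i dk Q.
Proof. by elim: i => //= i ->; rewrite /dk linearP. Qed.

Lemma iter_dkZ i (c : C) P : iter i dk (c *: P) = c *: iter i dk P.
Proof. by elim: i => //= i ->; rewrite /dk mderivZ. Qed.

Lemma iter_dk_big i P : (msize P <= i)%N -> iter i dk P = 0.
Proof.
move=> Pi; rewrite (mpolyE P); move: (fun g => @msize_mdeg_lt m C P g) => H.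
have {}H g : g \in msupp P -> (g k < i)%N.
  move=> /H gP; apply: leq_trans Pi; apply: leq_ltn_trans gP.
  by rewrite mdegE (bigD1 k)//= leq_addr.
elim: (msupp P) H => [|g s IH] H; first by rewrite big_nil iter_dk0.
rewrite big_cons iter_dkD IH ?addr0; last by move=> g' g's; apply: H; rewrite inE g's orbT.
by rewrite iter_dkX ?scaler0// H// mem_head.
Qed.

Lemma serE f u P N : lin u -> (msize P <= N)%N ->
  ser f u P = \sum_(i < N) f i * u (iter i dk P).
Proof.
move=> ul PN; rewrite /ser -(subnKC PN) big_split_ord /= [X in _ + X]big1 ?addr0// => i _.
by rewrite iter_dk_big ?leq_addr// lin0// mulr0.
Qed.

Lemma lin_ser f u : lin u -> lin (ser f u).
Proof.
move=> ul c P Q; pose N := (msize (c *: P + Q) + (msize P + msize Q))%N.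
rewrite !(serE f (N := N) ul) /N; try lia.
rewrite mulr_sumr -big_split /=; apply: eq_bigr => i _; rewrite iter_dkD ul; ring.
Qed.

Lemma ser_comb f (c : C) u v : ser f (c *: u + v) = c *: ser f u + ser f v.
Proof.
apply/funext => P; rewrite jetD jetZ /ser mulr_sumr -big_split /=.
by apply: eq_bigr => i _; rewrite jetD jetZ; ring.
Qed.

Lemma iter_dk_mderiv i j P : iter i dk (mderiv j P) = mderiv j (iter i dk P).
Proof. by elim: i => //= i ->; rewrite /dk mderiv_comm. Qed.

Lemma ser_xx f q j u : lin u -> ser f (xx q j u) = xx q j (ser f u).
Proof.
move=> ul; apply/funext => P; rewrite [RHS]/xx.
pose N := (msize P + msize (mderiv j P))%N.
rewrite !(serE f (N := N)) /N//; try lia; last exact: lin_xx.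
rewrite mulr_sumr -big_split /=; apply: eq_bigr => i _; rewrite /xx iter_dk_mderiv; ring.
Qed.

Lemma iter_dk_dvar i j P : iter i dk (dvar j * P) =
  dvar j * iter i dk P + (if k == j then iter i.-1 dk P *+ i else 0).
Proof.
elim: i => [|i IH]; first by rewrite mulr0n if_same addr0.
rewrite iterS IH [LHS]mderivD mderivM mderiv_dvar.
case: eqP => [<-|_]; last by rewrite mul0r add0r mderiv0 addr0.
rewrite mul1r addrAC addrC; congr (_ + _); rewrite mderivMn mulrS; congr (_ + _).
by case: i {IH} => [|i].
Qed.

Lemma ser_dd f j u : lin u -> j != k -> ser f (dd j u) = dd j (ser f u).
Proof.
move=> ul jk; apply/funext => P; rewrite [RHS]/dd.
pose N := (msize P + msize (dvar j * P))%N.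
rewrite !(serE f (N := N)) /N//; try lia; last exact: lin_dd.
by apply: eq_bigr => i _; rewrite iter_dk_dvar eq_sym (negbTE jk) addr0.
Qed.

Lemma ser_dd_k f u : lin u -> dd k (ser f u) =
  ser f (dd k u) + ser (fun i => i.+1%:R * f i.+1) u.
Proof.
move=> ul; apply/funext => P; rewrite [LHS]/dd jetD.
pose N := (msize P + msize (dvar k * P))%N.
rewrite (serE _ (N := N.+1) ul) ?(serE _ (P := P) (N := N.+1) (lin_dd k ul)) ?(serE _ (P := P)
  (N := N) ul) /N; try lia.
rewrite !big_ord_recl -addrA; congr (_ + _).
rewrite -big_split; apply: eq_bigr => i _; rewrite !lift0.
rewrite -[dd k u (iter i.+1 dk P)]/(u (dvar k * iter i.+1 dk P)).
rewrite iter_dk_dvar eqxx [_.-1]/= (linD ul) (linMn ul) -(mulr_natl (u _)) mulrDr mulrA (mulrC _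
  i.+1%:R).
by []. Qed.

Lemma ser_shift f u P : lin u -> ser f u (dk P) = ser (fun i => if i is i'.+1 then f i' else 0) u P.
Proof.
move=> ul; pose N := (msize P + msize (dk P))%N.
rewrite (serE _ (N := N) ul) ?(serE _ (N := N.+1) ul) /N; try lia.
rewrite big_ord_recl mul0r add0r; apply: eq_bigr => i _.
by rewrite lift0 iterSr.
Qed.

(** With f 0 invertible the operator is triangular for the degree in d_k. *)
Lemma ser_inj f u : f 0%N != 0 -> lin u -> ser f u = 0 -> u = 0.
Proof.
move=> f0 ul E; apply: lin_extX => // [|g]; first exact: lin_zero.
rewrite jet0; move: {2}(g k) (leqnn (g k)) => n; elim: n g => [|n IH] g gn.
  have := congr1 (fun v => v (mpolyX C g)) E; rewrite jet0 /ser.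
  have [N ->] : exists N, msize (mpolyX C g) = N.+1.
    by exists (mdeg g); rewrite msizeX.
  rewrite big_ord_recl big1 ?addr0 => [/eqP|i _].
    by rewrite mulf_eq0 (negbTE f0) => /eqP.
  by rewrite lift0 iter_dkX ?(lin0 ul) ?mulr0// ltnS (leq_trans gn).
have H i g' : (g' k <= n)%N -> u (iter i dk (mpolyX C g')) = 0.
  elim: i g' => [|i IHi] g' g'n; first exact: IH.
  rewrite iterSr {2}/dk mderivX iter_dkZ (linZ ul) IHi ?mulr0//.
  by rewrite mnmBE; apply: leq_trans (leq_subr _ _) g'n.
have [gn'|gk] := leqP (g k) n; first exact: IH.
have := congr1 (fun v => v (mpolyX C g)) E; rewrite jet0 /ser.
have [N ->] : exists N, msize (mpolyX C g) = N.+1.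
  by exists (mdeg g); rewrite msizeX.
rewrite big_ord_recl big1 ?addr0 => [/eqP|i _].
  by rewrite mulf_eq0 (negbTE f0) => /eqP.
rewrite lift0 iterSr {2}/dk mderivX iter_dkZ (linZ ul) H ?mulr0//.
by rewrite mnmBE mnm1E eqxx; lia.
Qed.

End OneVariable.

Definition gbin (s : C) i : C := \prod_(j < i) (s - j%:R) / i`!%:R.

Lemma gbin0 s : gbin s 0 = 1.
Proof. by rewrite /gbin big_ord0 fact0 divr1. Qed.

Lemma gbinS s i : i.+1%:R * gbin s i.+1 = (s - i%:R) * gbin s i.
Proof.
rewrite /gbin big_ord_recr /= factS natrM invfM.
have : (i.+1%:R : C) != 0 by rewrite pnatr_eq0.
move: (\prod_(_ < _) _) (i.+1%:R : C) (i`!%:R^-1) (s - _) => x y z t y0.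
have -> : y * (x * t * (y^-1 * z)) = (y / y) * (t * (x * z)) by ring.
by rewrite divff// mul1r.
Qed.

Lemma ser_add k f u v : ser k f (u + v) = ser k f u + ser k f v.
Proof. by have := ser_comb k f 1 u v; rewrite !scale1r. Qed.

(** Multiplication by (x_k / q_k)^s, given by its binomial series at q; being
formal, it requires no choice of a branch of the power. *)
Definition twist1 q k (s : C) u := ser k (fun i => gbin s i * (q 0 k)^-1 ^+ i) u.

Lemma twist1_comb q k s (c : C) u v : twist1 q k s (c *: u + v) =
  c *: twist1 q k s u + twist1 q k s v.
Proof. exact: ser_comb. Qed.

Lemma lin_twist1 q k s u : lin u -> lin (twist1 q k s u). Proof. exact: lin_ser. Qed.

Lemma twist1_inj q k s u : lin u -> twist1 q k s u = 0 -> u = 0.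
Proof. by apply: ser_inj; rewrite gbin0 mul1r expr0 oner_neq0. Qed.

Lemma twist1_xx q j k s u : lin u -> twist1 q k s (xx q j u) = xx q j (twist1 q k s u).
Proof. exact: ser_xx. Qed.

Lemma th_twist1_neq q j k s u : lin u -> j != k ->
  th q j (twist1 q k s u) = twist1 q k s (th q j u).
Proof.
move=> ul jk; rewrite /th /twist1 -(ser_dd _ ul jk).
by rewrite -(ser_xx _ _ _ _ (lin_dd j ul)).
Qed.

Lemma ser_lincomb k f f' (c : C) u P :
  c * ser k f u P + ser k f' u P = ser k (fun i => c * f i + f' i) u P.
Proof.
rewrite /ser mulr_sumr -big_split /=; apply: eq_bigr => i _.
by rewrite mulrDl mulrA.
Qed.

(** The rule theta_k x_k^s = x_k^s (theta_k + s), that is, the recursion of the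
generalized binomial coefficients. *)
Lemma th_twist1 q k s u : lin u -> q 0 k != 0 ->
  th q k (twist1 q k s u) = twist1 q k s (th q k u + s *: u).
Proof.
move=> ul qk; rewrite {1}/th /twist1 (ser_dd_k _ _ ul) xxD -(ser_xx _ _ _ _ (lin_dd k ul)).
rewrite ser_add; congr (_ + _).
apply/funext => P; rewrite /xx (ser_shift _ _ _ ul) ser_lincomb.
have -> : ser k (fun i => gbin s i * (q 0 k)^-1 ^+ i) (s *: u) P =
  ser k (fun i => s * (gbin s i * (q 0 k)^-1 ^+ i)) u P.
  by apply: eq_bigr => i _; rewrite jetZ; ring.
congr (ser k _ u P); apply/funext => i.
have cbx j x : j.+1%:R * (gbin s j.+1 * x) = (s - j%:R) * gbin s j * x by rewrite mulrA gbinS.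
have qq x : q 0 k * (x * ((q 0 k)^-1 * (q 0 k)^-1 ^+ i)) = x * (q 0 k)^-1 ^+ i.
  by rewrite mulrCA mulVKf.
rewrite cbx exprS qq; case: i {qq} => [|i]; first by rewrite subr0 addr0 mulrA.
rewrite cbx -(gbinS s i); move: (gbin s i.+1) (_ ^+ i.+1) (i.+1%:R : C) => x y z; ring.
Qed.

Section AllVariables.
Variables (q : Cm) (e : 'I_m -> C).
Hypothesis q0 : forall k, q 0 k != 0.

Definition twistL (L : seq 'I_m) u : A -> C := foldr (fun k v => twist1 q k (e k) v) u L.

Lemma lin_twistL L u : lin u -> lin (twistL L u).
Proof. by move=> ul; elim: L => //= k L; exact: lin_twist1. Qed.

Lemma twistL_comb L (c : C) u v : twistL L (c *: u + v) = c *: twistL L u + twistL L v.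
Proof. by elim: L => //= k L ->; exact: twist1_comb. Qed.

Lemma twistL_inj L u : lin u -> twistL L u = 0 -> u = 0.
Proof.
move=> ul; elim: L => //= k L IH H; apply: IH.
exact: twist1_inj (lin_twistL L ul) H.
Qed.

Lemma twistL_xx L j u : lin u -> twistL L (xx q j u) = xx q j (twistL L u).
Proof. by move=> ul; elim: L => //= k L ->; rewrite twist1_xx//; exact: lin_twistL. Qed.

Lemma th_twistL L j u : uniq L -> lin u ->
  th q j (twistL L u) = twistL L (th q j u + (if j \in L then e j else 0) *: u).
Proof.
move=> + ul; elim: L => [|k L IH] /=; first by rewrite scale0r addr0.
move=> /andP[kL uL]; have Ll := lin_twistL L ul; rewrite inE.
have := IH uL; case: (altP (j =P k)) => [->|jk] H /=; last by rewrite (th_twist1_neq _ _ Ll jk) H.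
rewrite (th_twist1 _ Ll (q0 k)); congr (twist1 _ _ _ _).
rewrite [th q k u + _]addrC twistL_comb addrC; congr (_ + _).
by rewrite H (negbTE kL) scale0r addr0.
Qed.

Definition twist u := twistL (enum 'I_m) u.

Lemma lin_twist u : lin u -> lin (twist u). Proof. exact: lin_twistL. Qed.
Lemma twist_comb (c : C) u v : twist (c *: u + v) = c *: twist u + twist v.
Proof. exact: twistL_comb. Qed.
Lemma twist_inj u : lin u -> twist u = 0 -> u = 0. Proof. exact: twistL_inj. Qed.
Lemma twist_add u v : twist (u + v) = twist u + twist v.
Proof. by rewrite -[u]scale1r twist_comb !scale1r. Qed.
Lemma twist0 : twist 0 = 0.
Proof. by have := twist_comb (-1) 0 0; rewrite scaler0 addr0 scaleN1r addNr. Qed.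
Lemma twist_scale (c : C) u : twist (c *: u) = c *: twist u.
Proof. by rewrite -[X in twist X]addr0 twist_comb twist0 addr0. Qed.
Lemma twist_xx j u : lin u -> twist (xx q j u) = xx q j (twist u).
Proof. exact: twistL_xx. Qed.
Lemma th_twist j u : lin u -> th q j (twist u) = twist (th q j u + e j *: u).
Proof. by move=> ul; rewrite /twist th_twistL ?enum_uniq// mem_enum. Qed.

Lemma TH_twist u : lin u -> TH q (twist u) = twist (TH q u + (\sum_j e j) *: u).
Proof.
move=> ul; rewrite /TH scaler_suml -big_split (big_morph twist twist_add twist0) /=.
by apply: eq_bigr => j _; rewrite th_twist.
Qed.

Lemma THs_twist z u : lin u -> TH q (twist u) + z *: twist u =
  twist (TH q u + (z + \sum_j e j) *: u).
Proof. by move=> ul; rewrite (TH_twist ul) -twist_scale -twist_add scalerDl addrAC addrA. Qed.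

Lemma Dprod_twist s u : lin u -> Dprod q s (twist u) =
  twist (Dprod q [seq z + \sum_j e j | z <- s] u).
Proof. by move=> ul; elim: s => //= z s ->; rewrite THs_twist//; exact: lin_Dprod. Qed.

(** The indicial roots of the k-th equation are 0 and 1 - c_k.  Dividing solutions
by x^e subtracts e_k from both: for e_k = 1 - c_k they become c_k - 1 and 0, the
roots for 2 - c_k.  It also adds the sum of e to a and b. *)
Lemma FSol_twist (a b : C) (c c' : 'I_m -> C) u :
  (forall k, (e k = 0 /\ c' k = c k) \/ (e k = 1 - c k /\ c' k = 2 - c k)) ->
  FSol q (a + \sum_j e j) (b + \sum_j e j) c' u -> FSol q a b c (twist u).
Proof.
move=> ec [ul H]; split=> [|k]; first exact: lin_twist.
have l2 := lin_THs q (b + \sum_j e j) ul.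
have l3 := lin_THs q (a + \sum_j e j) l2.
have kl := lin_th q k ul.
rewrite (THs_twist b ul) (THs_twist a l2) -twist_xx// -H.
rewrite (th_twist k ul) -twist_scale -twist_add th_twist; last first.
  by apply: lin_add; [apply: lin_add => //; exact: lin_scale|exact: lin_scale].
congr (twist _); rewrite !(thD q k) !(thZ q k).
move: (th q k (th q k u)) (th q k u) => x y.
case: (ec k) => -[-> ->]; apply/funext => P; rewrite !jetE; ring.
Qed.

End AllVariables.

End Twist.

(** * Kernels of shift operators and Frobenius solutions *)

Section Kernels.
Context {R : realType} {m : nat}.
Local Notation C := (Cplx R).
Local Notation Cm := 'rV[Cplx R]_m.
Local Notation A := (mpoly m (Cplx R)).
Implicit Types (P Q : A) (h q p : Cm) (u v g : A -> C).

Lemma th_sum q k (L : seq 'I_m) (F : 'I_m -> A -> C) :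
  th q k (\sum_(j <- L) F j) = \sum_(j <- L) th q k (F j).
Proof. exact: (big_morph (th q k) (thD q k) (th0 q k)). Qed.

Lemma split_shift (V : lmodType C) (x x' y : V) (z t : C) : x = x' ->
  x + (z + t) *: y = t *: y + x' + z *: y.
Proof.
by move->; rewrite scalerDl [X in _ + X = _]addrC addrA; congr (_ + _); exact: addrC.
Qed.

Lemma factor_exponents (V : lmodType C) (x y z : V) (r t d : C) : t * r = 0 -> t + r = 1 - d ->
  x + (- r) *: y + (- t) *: (y + (- r) *: z) = x + (d - 1) *: y.
Proof.
move=> tr tDr; rewrite scalerDr scalerA mulrNN tr scale0r addr0 -addrA -scalerDl.
by congr (_ + _ *: _); rewrite -opprD addrC tDr opprB.
Qed.

(** The operators theta_k with k in L commute, and each is annihilated by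
X (X + c_k - 1) on u, so that -z would be a sum of exponents 0 or 1 - c_k.  The
induction first treats theta_k u, on which theta_k is 1 - c_k, and then u
itself, on which theta_k is then 0. *)
Lemma joint_kernel q (c : 'I_m -> C) (L : seq 'I_m) z u : uniq L -> lin u ->
  (forall k, k \in L -> th q k (th q k u + (c k - 1) *: u) = 0) ->
  \sum_(k <- L) th q k u + z *: u = 0 ->
  (forall J : 'I_m -> bool, z + \sum_(k <- L) (J k)%:R * (1 - c k) != 0) -> u = 0.
Proof.
elim: L z u => [|k L IH] z u /= uL ul Hk Hs HJ.
  have := HJ (fun=> true); rewrite big_nil addr0 => z0.
  move: Hs; rewrite big_nil add0r => /(congr1 (GRing.scale z^-1)).
  by rewrite scalerA mulVf// scale1r scaler0.
have /andP[kL uL'] := uL.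
have Hk' j : j \in L -> th q j (th q j u + (c j - 1) *: u) = 0.
  by move=> jL; apply: Hk; rewrite inE jL orbT.
have kl := lin_th q k ul.
have u1 : th q k u = 0.
  apply: (IH (z + (1 - c k))) => //.
  - move=> j jL; rewrite (thC _ _ _ ul) -thZ -thD.
    have jl := lin_th q j ul.
    have l2 : lin (th q j u + (c j - 1) *: u) by apply: lin_add => //; exact: lin_scale.
    by rewrite (thC _ _ _ l2) (Hk' j jL) th0.
  - have := Hk k (mem_head _ _); rewrite thD thZ => E.
    have {}E : th q k (th q k u) = (1 - c k) *: th q k u.
      by apply/eqP; rewrite -subr_eq0 -scaleNr opprB E.
    have Hs' : th q k (th q k u) + \sum_(j <- L) th q k (th q j u) + z *: th q k u = 0.
      have := congr1 (th q k) Hs.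
      rewrite big_cons th0 (thD q k (th q k u + _) (z *: u)).
      by rewrite (thD q k (th q k u) (\sum_(j <- L) th q j u)) (thZ q k z u) th_sum.
    have Hs'' := etrans (congr1 (fun y => y + \sum_(j <- L) th q k (th q j u) + z *: th q k u)
      (esym E)) Hs'.
    have S1 : \sum_(j <- L) th q j (th q k u) = \sum_(j <- L) th q k (th q j u).
      by apply: eq_bigr => j _; exact: thC.
    by apply: etrans Hs''; exact: split_shift S1.
  - move=> J; have := HJ (fun j => if j == k then true else J j).
    rewrite big_cons eqxx mul1r addrA (eq_big_seq (fun j => (J j)%:R * (1 - c j)))//.
    by move=> j jL; case: eqP => // jk; rewrite jk (negbTE kL) in jL.
apply: (IH z) => //; first by move: Hs; rewrite big_cons u1 add0r.
move=> J; have := HJ (fun j => if j == k then false else J j).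
rewrite big_cons eqxx mul0r add0r (eq_big_seq (fun j => (J j)%:R * (1 - c j)))//.
by move=> j jL; case: eqP => // jk; rewrite jk (negbTE kL) in jL.
Qed.

(** If theta + al kills u then the right-hand sides of all equations vanish and u
is a joint eigenvector as in [joint_kernel]. *)
Lemma shift_inj q (al b : C) c u : FSol q al b c u -> TH q u + al *: u = 0 ->
  (forall J, shifted c al J != 0) -> u = 0.
Proof.
move=> [ul H] Hs HJ; apply: (@joint_kernel q c (index_enum 'I_m) al) => //.
- exact: index_enum_uniq.
- by move=> k _; rewrite H TH2E Hs TH0 scaler0 addr0 xx0.
- move=> J; have := HJ [ffun k => J k]; rewrite /shifted.
  by under eq_bigr do rewrite ffunE.
Qed.

Lemma shifts_inj q (al b : C) c n u : FSol q al b c u -> Dprod q (shifts al n) u = 0 ->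
  (forall i J, (i < n)%N -> shifted c (al + i%:R) J != 0) -> u = 0.
Proof.
elim: n al u => [|n IH] al u uS //= D0 HJ.
rewrite Dprod_rcons in D0.
apply: (shift_inj uS); last by move=> J; have := HJ 0%N J; rewrite addr0; apply.
apply: (IH (al + 1)) => //; first exact: FSol_shift.
by move=> i J ni; rewrite -addrA -(natrD _ 1); exact: HJ.
Qed.

Section FrobeniusAtZero.
Variables (q : Cm) (e : 'I_m -> C) (M : R).
Hypotheses (q0 : forall k, q 0 k != 0) (M1 : 1 <= M) (Mq : 16 * M * l1norm q <= 1).

(** The jet at q of x^e times the function whose jet at the origin is u. *)
Definition frob u := twist q e (reexp u q).

Let s := \sum_k e k.

Lemma Mq8 : 8 * M * l1norm q <= 1.
Proof. by have := mulr_ge0 (le_trans ler01 M1) (l1norm_ge0 q); move: Mq; lra. Qed.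

Lemma frob_scale (c : C) u : lin u -> Bd M u -> frob (c *: u) = c *: frob u.
Proof. by move=> ul uM; rewrite /frob (reexp_scale M1 c ul uM Mq8) twist_scale. Qed.

Lemma frob_add u v : lin u -> lin v -> Bd M u -> Bd M v -> frob (u + v) = frob u + frob v.
Proof. by move=> ul vl uM vM; rewrite /frob (reexp_add M1 ul vl uM vM Mq8) twist_add. Qed.

Lemma frob_inj u : lin u -> Bd M u -> frob u = 0 -> u = 0.
Proof.
move=> ul uM /(twist_inj (lin_reexp M1 ul uM Mq8)) E.
by rewrite -(reexpK M1 ul uM Mq) E reexp_zero.
Qed.

Lemma th_frob k z u : lin u -> Bd M u ->
  th q k (frob u) + z *: frob u = frob (th 0 k u + (z + e k) *: u).
Proof.
move=> ul uM; have rl := lin_reexp M1 ul uM Mq8.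
rewrite /frob (th_twist e q0 k rl) -twist_scale -twist_add; congr (twist _ _ _).
rewrite (reexp_add M1 (lin_th 0 k ul) (lin_scale _ ul) (Bd_th M1 0 k ul uM) (Bd_scale M1 _ uM) Mq8).
rewrite (reexp_th M1 0 k ul uM Mq8) (reexp_scale M1 _ ul uM Mq8) add0r.
by rewrite scalerDl addrAC addrA.
Qed.

Lemma THs_frob z u : lin u -> Bd M u ->
  TH q (frob u) + z *: frob u = frob (TH 0 u + (z + s) *: u).
Proof.
move=> ul uM; have rl := lin_reexp M1 ul uM Mq8.
by rewrite /frob (THs_twist e q0 z rl) (reexp_THs M1 0 _ ul uM Mq8) add0r.
Qed.

Lemma xx_frob k u : lin u -> Bd M u -> xx q k (frob u) = frob (xx 0 k u).
Proof.
move=> ul uM; have rl := lin_reexp M1 ul uM Mq8.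
by rewrite /frob (reexp_xx 0 k M1 ul uM Mq8) add0r twist_xx.
Qed.

Lemma Dprod_frob t u : lin u -> Bd M u ->
  Dprod q t (frob u) = frob (Dprod 0 [seq z + s | z <- t] u).
Proof.
move=> ul uM; have rl := lin_reexp M1 ul uM Mq8.
by rewrite /frob (Dprod_twist e q0 _ rl) (reexp_Dprod 0 _ M1 ul uM Mq8) add0r.
Qed.

Lemma FSol_frob (a b : C) (c c' : 'I_m -> C) u :
  (forall k, (e k = 0 /\ c' k = c k) \/ (e k = 1 - c k /\ c' k = 2 - c k)) ->
  FSol 0 (a + s) (b + s) c' u -> Bd M u -> FSol q a b c (frob u).
Proof.
move=> ec uS uM; apply: (FSol_twist q0 ec).
by have := reexp_FSol M1 uS uM Mq8; rewrite add0r.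
Qed.

Lemma Bd_xx k u : lin u -> Bd M u -> Bd M (xx 0 k u).
Proof. by move=> ul uM; rewrite xx_dl; apply: Bd_comb => //; exact: Bd_dl. Qed.

Section NoPreimage.
Variables (b : C) (c t : 'I_m -> C) (be g : A -> C).
Hypotheses (te : forall k, t k * e k = 0) (tDe : forall k, t k + e k = 1 - c k)
  (te_neq : forall k, e k - t k != 0).
Hypotheses (bl : lin be) (bM : Bd M be) (be1 : be 1 != 0).
Hypothesis gS : FSol q (- s) b c g.

(** The jets of x^e H with H in the maximal ideal of the local ring at the origin. *)
Definition frob_max v := exists H, [/\ lin H, Bd M H, H 1 = 0 & v = frob H].

(** The operator theta_k - t_k, and below the product of these over L. *)
Let op k v := th q k v + (- t k) *: v.
Let T (L : seq 'I_m) v := foldr op v L.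

Lemma frob_max_add u v : frob_max u -> frob_max v -> frob_max (u + v).
Proof.
move=> [H [Hl HM H1 ->]] [H' [Hl' HM' H1' ->]]; exists (H + H'); split.
- exact: lin_add.
- exact: Bd_add.
- by rewrite jetD H1 H1' addr0.
- by rewrite frob_add.
Qed.

Lemma th01 k u : lin u -> th 0 k u 1 = 0.
Proof. by move=> ul; rewrite -mpolyX0 th0X// mnm0E mul0r. Qed.

Lemma frob_max_op k v : frob_max v -> frob_max (op k v).
Proof.
move=> [H [Hl HM H1 ->]]; exists (th 0 k H + (- t k + e k) *: H); split.
- by apply: lin_add; [exact: lin_th|exact: lin_scale].
- by apply: Bd_add => //; [exact: Bd_th|exact: Bd_scale].
- by rewrite jetD jetZ H1 mulr0 addr0 th01.
- exact: th_frob.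
Qed.

Lemma frob_max_T L v : frob_max v -> frob_max (T L v).
Proof. by move=> vZ; elim: L => //= k L; exact: frob_max_op. Qed.

Lemma op_D k u v : op k (u + v) = op k u + op k v.
Proof. by rewrite /op thD scalerDr addrACA. Qed.

Lemma T_D L u v : T L (u + v) = T L u + T L v.
Proof. by elim: L => //= k L ->; rewrite op_D. Qed.

Lemma lin_op k v : lin v -> lin (op k v).
Proof. by move=> vl; apply: lin_add; [exact: lin_th|exact: lin_scale]. Qed.

Lemma lin_T L v : lin v -> lin (T L v).
Proof. by move=> vl; elim: L => //= k L; exact: lin_op. Qed.

Lemma opC j k v : lin v -> op j (op k v) = op k (op j v).
Proof.
move=> vl.
have Eop i l : op i (op l v) =
    th q i (th q l v) + (- t l) *: th q i v + ((- t i) *: th q l v + (t i * t l) *: v).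
  by rewrite /op (thD q i (th q l v)) (thZ q i (- t l)) (scalerDr (- t i)) scalerA mulrNN.
by rewrite !Eop (thC _ j k vl) (mulrC (t j)); exact: addrACA.
Qed.

Lemma T_op L k v : lin v -> T L (op k v) = op k (T L v).
Proof. by move=> vl; elim: L => //= j L ->; rewrite opC//; exact: lin_T. Qed.

(** For each k let t_k be the exponent other than e_k.  The k-th equation says that
(theta_k - t_k) (theta_k - e_k) g is x_k times the operator theta + b applied to
(theta - sum e) g = x^e be, hence lies in x^e times the maximal ideal.  As
theta - sum e is the sum of the theta_k - e_k, the product of all theta_k - t_k
sends x^e be into x^e times the maximal ideal.  But this product multiplies the
constant term of be by the product of the e_k - t_k, which is not 0. *)
Lemma no_preimage : TH q g + (- s) *: g <> frob be.
Proof.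
have gl := gS.1 => E.
have H1 k : frob_max (op k (th q k g + (- e k) *: g)).
  have -> : op k (th q k g + (- e k) *: g) = xx q k (TH q (frob be) + b *: frob be).
    have := gS.2 k; rewrite TH2E E => <-.
    rewrite /op (thD q k (th q k g) ((c k - 1) *: g)) (thZ q k (c k - 1)).
    rewrite (thD q k (th q k g) ((- e k) *: g)) (thZ q k (- e k)).
    by apply: factor_exponents; [exact: te|exact: tDe].
  have wl : lin (TH 0 be + (b + s) *: be) := lin_THs 0 _ bl.
  have wM : Bd M (TH 0 be + (b + s) *: be) := Bd_THs M1 0 _ bl bM.
  rewrite (THs_frob b bl bM) (xx_frob k wl wM); exists (xx 0 k (TH 0 be + (b + s) *: be)).
  split=> //; [exact: lin_xx|exact: Bd_xx|].
  by rewrite -mpolyX0 xx0X// mnm0E mul0r.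
have HL L : frob_max (T L (\sum_(j <- L) (th q j g + (- e j) *: g))).
  elim: L => [|k L IH].
    rewrite big_nil; exists 0; split => //=; [exact: lin_zero|exact: Bd_zero|].
    by rewrite /frob reexp_zero twist0.
  have kl : lin (th q k g + (- e k) *: g).
    by apply: lin_add; [exact: lin_th|exact: lin_scale].
  rewrite big_cons /= T_D op_D -(T_op _ _ kl); apply: frob_max_add; last exact: frob_max_op.
  exact: frob_max_T.
have := HL (index_enum 'I_m); rewrite big_split /= -scaler_suml sumrN -/s.
rewrite -/(TH q g) E.
(* The operator T seen through x^e, which turns theta_k into theta_k + e_k. *)
pose T0 (L : seq 'I_m) v := foldr (fun k v => th 0 k v + (- t k + e k) *: v) v L.
have HT L : [/\ lin (T0 L be), Bd M (T0 L be), T0 L be 1 != 0 & T L (frob be) = frob (T0 L be)].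
  elim: L => [|k L [Tl TM T1 IH]]; first by split.
  split=> /=.
  - by apply: lin_add; [exact: lin_th|exact: lin_scale].
  - by apply: Bd_add => //; [exact: Bd_th|exact: Bd_scale].
  - by rewrite jetD jetZ (th01 k Tl) add0r mulf_neq0// addrC.
  - by rewrite IH; exact: th_frob.
have [Tl TM T1 ->] := HT (index_enum 'I_m) => -[H [Hl HM H10 EH]].
have : T0 (index_enum 'I_m) be + (-1) *: H = 0.
  have Hl' := lin_scale (-1) Hl; have HM' := Bd_scale M1 (-1) HM.
  apply: frob_inj; [exact: lin_add|exact: Bd_add|].
  by rewrite frob_add// frob_scale// EH scaleN1r subrr.
move=> /(congr1 (fun v => v 1)); rewrite jetD jetZ H10 mulr0 addr0 jet0 => T10.
by rewrite T10 eqxx in T1.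
Qed.

End NoPreimage.
End FrobeniusAtZero.
End Kernels.

(** * The segment from the origin to the base point *)

Section Segment.
Context {R : realType} {m : nat}.
Local Notation C := (Cplx R).
Local Notation Cm := 'rV[Cplx R]_m.
Local Notation A := (mpoly m (Cplx R)).
Implicit Types (P Q : A) (h q p : Cm) (u v g : A -> C).

Hypothesis m_ge1 : (1 <= m)%N.

Definition seg (t : R) : Cm := t%:C%C *: xdot.

Let y0 : R := (2 * m%:R ^+ 2)^-1.

Lemma y0_gt0 : 0 < y0.
Proof. by rewrite invr_gt0 mulr_gt0// exprn_gt0// ltr0n. Qed.

Lemma segE t k : seg t 0 k = (t * y0)%:C%C.
Proof.
rewrite !mxE div1r -(rmorph_nat (real_complex R)) -fmorphV -rmorphM.
by rewrite /y0 natrM natrX.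
Qed.

Lemma seg1 : seg 1 = xdot.
Proof. by rewrite /seg scale1r. Qed.

Lemma l1norm_seg (s t : R) : l1norm (seg s - seg t) = `|s - t| * l1norm (xdot : Cm).
Proof.
rewrite /seg -scalerBl -rmorphB /l1norm mulr_sumr; apply: eq_bigr => k _.
rewrite mxE nrmM; congr (_ * _).
by apply: complexI; rewrite -nrmE normc_def /= expr0n /= addr0 sqrtr_sqr.
Qed.

(** Since the coordinates are at most 1/(2 m^2), the square roots add up to at most
1/sqrt 2, and no factor of R vanishes. *)
Lemma seg_X (t : R) : 0 < t <= 1 -> X_C (seg t).
Proof.
move=> /andP[t0 t1]; have ty : 0 < t * y0 by rewrite mulr_gt0// y0_gt0.
rewrite /X_C /sing_locus /= => /eqP; rewrite mulf_eq0 => /orP[|].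
  apply/negP/prodf_neq0 => k _; rewrite segE -(rmorph0 (real_complex R)).
  by apply/eqP => /complexI /eqP; rewrite gt_eqF.
apply/negP/prodf_neq0 => e _; apply/eqP => E.
have m0 : (0 : R) < m%:R by rewrite ltr0n.
have sq : (nrm (sqrtC (t * y0)%:C%C : C)) ^+ 2 = t * y0.
  by rewrite -nrmX sqrtCK nrm_real// ltW.
have h1 : (m%:R * nrm (sqrtC (t * y0)%:C%C : C)) ^+ 2 <= 2^-1.
  rewrite exprMn sq mulrCA /y0 invfM mulrA mulrC !mulrA.
  rewrite [X in X <= _](_ : _ = t * 2^-1); first by lra.
  by rewrite mulrC; field; rewrite gt_eqF.
have h2 : nrm (\sum_(k < m) (-1) ^+ e k * sqrtC (seg t 0 k)) <=
  m%:R * nrm (sqrtC (t * y0)%:C%C : C).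
  apply: le_trans (nrm_sum _ _ _) _; apply: sum_le_const => k.
  by rewrite nrmM nrmX nrmN nrm1 expr1n mul1r segE.
have h3 : 1 <= nrm (\sum_(k < m) (-1) ^+ e k * sqrtC (seg t 0 k)).
  have /eqP := E; rewrite addrC addr_eq0 => /eqP ->; rewrite nrmN nrm1 //.
have h4 := le_trans h3 h2.
have : 1 <= (m%:R * nrm (sqrtC (t * y0)%:C%C : C)) ^+ 2 by rewrite exprn_ege1.
by move: h1; lra.
Qed.

Lemma propagate_seg (Z : Cm -> Prop) t0 : 0 < t0 <= 1 ->
  (forall p, X_C p -> exists2 r, 0 < r & forall q q', l1norm (q - p) < r ->
     l1norm (q' - p) < r -> Z q -> Z q') ->
  Z (seg t0) -> Z xdot.
Proof.
move=> /andP[t00 t01] ZX Z0; pose ga (t : R) := seg (t0 + t * (1 - t0)).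
have -> : xdot = ga 1 by rewrite /ga mul1r subrKC seg1.
apply: (propagate (gamma := ga)) => //.
- move=> t _ e e0; exists (e / (l1norm (xdot : Cm) + 1)).
    by rewrite divr_gt0// ltr_wpDl// l1norm_ge0.
  move=> s _; rewrite ltr_pdivlMr; last by rewrite ltr_wpDl// l1norm_ge0.
  move=> st; rewrite /ga l1norm_seg opprD addrACA subrr add0r -mulrBl normrM.
  have h : `|1 - t0| <= 1 by rewrite ger0_norm; lra.
  have := l1norm_ge0 (xdot : Cm); have := normr_ge0 (s - t); have := normr_ge0 (1 - t0) => h0 h2 h3.
  have := mulr_ge0 h2 h3; move: (ler_wpM2r (mulr_ge0 h2 h3) h); lra.
- move=> t /andP[t0' t1']; apply: seg_X; apply/andP; split; last by nra.
  by rewrite ltr_pwDl// mulr_ge0// subr_ge0.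
- by rewrite /ga mul0r addr0.
Qed.

End Segment.

(** * Reducibility *)

Section Main.
Context {R : realType} {m : nat}.
Local Notation C := (Cplx R).
Local Notation Cm := 'rV[Cplx R]_m.
Local Notation A := (mpoly m (Cplx R)).
Implicit Types (P Q : A) (h q p : Cm) (u v g : A -> C).

Lemma is_integerD (x y : C) : is_integer x -> is_integer y -> is_integer (x + y).
Proof. by move=> [i ->] [j ->]; exists (i + j); rewrite rmorphD. Qed.
Lemma is_integerN (x : C) : is_integer x -> is_integer (- x).
Proof. by move=> [i ->]; exists (- i); rewrite rmorphN. Qed.
Lemma is_integer_nat n : is_integer (n%:R : C).
Proof. by exists n; rewrite pmulrn. Qed.
Lemma is_integerB (x y : C) : is_integer x -> is_integer y -> is_integer (x - y).
Proof. by move=> ix iy; apply: is_integerD => //; exact: is_integerN. Qed.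
Section Core.
Variables (a b : C) (c : 'I_m -> C) (I : {ffun 'I_m -> bool}).
Hypothesis m_ge1 : (1 <= m)%N.
Hypothesis aI : is_integer (shifted c a I).
Hypothesis aJ : forall J : {ffun 'I_m -> bool}, J <> I -> ~ is_integer (shifted c a J).

Let flip k : {ffun 'I_m -> bool} := [ffun j => if j == k then ~~ I j else I j].

Lemma flip_neq k : flip k <> I.
Proof. by move=> /ffunP /(_ k); rewrite ffunE eqxx; case: (I k). Qed.

(** Flipping the k-th entry of I changes a^I by 1 - c_k up to sign, and only a^I is
an integer. *)
Lemma c_nonint k : ~ is_integer (c k).
Proof.
move=> ck; apply: (aJ (@flip_neq k)); move: aI; rewrite /shifted.
rewrite (bigD1 k)//= [X in _ -> is_integer (_ + X)](bigD1 k)//= ffunE eqxx.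
rewrite [X in _ -> is_integer (_ + (_ + X))](eq_bigr (fun j => (I j)%:R * (1 - c j))); last first.
  by move=> j /negbTE jk; rewrite ffunE jk.
set X := \sum_(_ | _) _ => aX.
have c1 : is_integer (1 - c k) by apply: is_integerB => //; exact: (is_integer_nat 1).
case: (I k) aX => /=; rewrite ?mul0r ?mul1r => aX.
  have -> : a + (0 + X) = a + (1 - c k + X) - (1 - c k) by ring.
  exact: is_integerB.
have -> : a + (1 - c k + X) = a + (0 + X) + (1 - c k) by ring.
exact: is_integerD.
Qed.

(** The exponents of the Frobenius solution indexed by J, followed by the parameters
c of its Lauricella series. *)
Definition frob_exp (J : {ffun 'I_m -> bool}) k : C := (J k)%:R * (1 - c k).
Definition frob_par (J : {ffun 'I_m -> bool}) k : C := if J k then 2 - c k else c k.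

Lemma frob_exp_par J k : (frob_exp J k = 0 /\ frob_par J k = c k) \/ (frob_exp J k =
  1 - c k /\ frob_par J k = 2 - c k).
Proof.
by rewrite /frob_exp /frob_par; case: (J k); [right; rewrite mul1r|left; rewrite mul0r].
Qed.

Lemma frob_par_int J k n : frob_par J k + n%:R != 0.
Proof.
apply/eqP => E; apply: (@c_nonint k); move: E; rewrite /frob_par; case: (J k) => E.
  have -> : c k = (2 + n)%:R by apply/eqP; rewrite -subr_eq0 natrD -oppr_eq0 opprB addrAC E.
  exact: is_integer_nat.
have -> : c k = - n%:R by apply/eqP; rewrite -subr_eq0 opprK E.
exact/is_integerN/is_integer_nat.
Qed.

Lemma shiftedE al J : shifted c al J = al + \sum_k frob_exp J k. Proof. by []. Qed.

Definition frob_sol q J (al : C) : A -> C :=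
  frob q (frob_exp J) (FC (frob_par J) (shifted c al J) (shifted c b J)).

Definition frob_radius (M : R) J al := Bd M (FC (frob_par J) (shifted c al J) (shifted c b J)).

Lemma frob_radius_ex J al : exists2 M : R, 1 <= M & frob_radius M J al.
Proof. by apply: FC_Bd; exact: frob_par_int. Qed.

Section AtQ.
Variables (q : Cm) (M : R).
Hypotheses (q0 : forall k, q 0 k != 0) (M1 : 1 <= M) (Mq : 16 * M * l1norm q <= 1).

Lemma frob_sol_FSol J al : frob_radius M J al -> FSol q al b c (frob_sol q J al).
Proof.
move=> gM; apply: (@FSol_frob _ _ q _ M q0 M1 Mq _ _ _ (frob_par J)) => //;
  first exact: frob_exp_par.
by apply: FC_FSol; exact: frob_par_int.
Qed.

(** The product of shifts multiplies the solution by a Pochhammer symbol and raises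
al by n. *)
Lemma frob_sol_Dprod J al n : frob_radius M J al ->
  Dprod q (shifts al n) (frob_sol q J al) = 0 <-> poch (shifted c al J) n = 0.
Proof.
move=> gM; have hl : lin (FC (frob_par J) (shifted c al J) (shifted c b J)) by exact: lin_lext.
rewrite /frob_sol (Dprod_frob _ q0 M1 Mq _ hl gM) map_shifts -shiftedE.
have E := FC_shifts (@frob_par_int J) (shifted c al J) (shifted c b J) n.
have Dl := lin_Dprod 0 (shifts (shifted c al J) n) hl.
have DM := Bd_Dprod 0 (shifts (shifted c al J) n) M1 hl gM.
split=> [/(frob_inj M1 Mq Dl DM)|p0].
  by rewrite E => /(congr1 (fun v => v 1)); rewrite jetZ FC_at1 mulr1.
by rewrite E p0 scale0r /frob reexp_zero twist0.
Qed.

End AtQ.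

Lemma poch_nonint (x : C) n : ~ is_integer x -> poch x n != 0.
Proof.
move=> xi; apply/prodf_neq0 => i _; apply/eqP => E; apply: xi.
have -> : x = - i%:R by apply/eqP; rewrite -subr_eq0 opprK E.
exact/is_integerN/is_integer_nat.
Qed.

(** Any index other than I serves; there is one because m is positive. *)
Let J := flip (Ordinal m_ge1).

Lemma seg_small (M : R) : 1 <= M -> exists2 t0 : R, 0 < t0 <= 1 &
  16 * M * l1norm (seg t0 : Cm) <= 1.
Proof.
move=> M1; pose D := 16 * M * (l1norm (xdot : Cm) + 1).
have n0 := l1norm_ge0 (xdot : Cm).
have D1 : 1 <= D by rewrite /D; nra.
exists D^-1; first by apply/andP; split; [rewrite invr_gt0; lra|rewrite invf_le1; lra].
have -> : l1norm (seg D^-1 : Cm) = D^-1 * l1norm (xdot : Cm).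
  have := @l1norm_seg R m D^-1 0; rewrite subr0 ger0_norm; last by rewrite invr_ge0; lra.
  by rewrite /seg scale0r subr0.
rewrite mulrCA mulrC ler_pdivrMr; last by lra.
by rewrite /D mul1r; nra.
Qed.

Lemma seg_neq0 (t : R) k : 0 < t -> (seg t : Cm) 0 k != 0.
Proof.
move=> t0; rewrite segE -(rmorph0 (real_complex R)); apply/eqP => /complexI /eqP.
by rewrite gt_eqF// mulr_gt0// y0_gt0.
Qed.

Lemma ab_sym a' b' : (a', b') = (a, b) \/ (a', b') = (b, a) ->
  forall u, FSol xdot a b c u -> FSol xdot a' b' c u.
Proof. by move=> [|] [-> ->] u // /FSol_sym. Qed.

Lemma xdot_X : X_C (xdot : Cm).
Proof. by rewrite -seg1; apply: seg_X; rewrite // ltr01 lexx. Qed.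

(** The invariant subspace is the kernel of (theta + a) ... (theta + a + n): it
contains the I-th Frobenius solution because (a^I)_(n+1) = 0, and not the J-th
because a^J is not an integer. *)
Lemma reducible_nonpos a' b' n : (a', b') = (a, b) \/ (a', b') = (b, a) ->
  shifted c a I = - n%:R -> monodromy_reducible a' b' c.
Proof.
move=> ab' aIn.
have [MI MI1 gI] := frob_radius_ex I a; have [MJ MJ1 gJ] := frob_radius_ex J a.
pose M := MI + MJ; have M1 : 1 <= M by rewrite /M; lra.
have gI' : frob_radius M I a by apply: (Bd_mono MI1) gI; rewrite /M; lra.
have gJ' : frob_radius M J a by apply: (Bd_mono MJ1) gJ; rewrite /M; lra.
have [t0 t01 Mt] := seg_small M1.
have q0 k : (seg t0 : Cm) 0 k != 0 by apply: seg_neq0; case/andP: t01.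
have sI := frob_sol_FSol q0 M1 Mt gI'; have sJ := frob_sol_FSol q0 M1 Mt gJ'.
have DI := (frob_sol_Dprod q0 M1 Mt n.+1 gI').
apply: (@reducible_of_jets _ _ a a b c (shifts a n.+1) [::] true) => //.
- exact: xdot_X.
- exact: ab_sym.
- apply: (propagate_seg m_ge1 t01 (@nonzero_image_step _ _ a b c (shifts a n.+1) [::] true)).
  exists (frob_sol (seg t0) I a); split.
    split=> // _; apply/DI; rewrite aIn pochS addNr mulr0 //.
  move=> /= E; have /(frob_sol_Dprod q0 M1 Mt 0 gI').1 := E.
  by rewrite /poch big_ord0 => /eqP; rewrite oner_eq0.
- apply: (propagate_seg m_ge1 t01 (@missed_solution_step _ _ a a b c (shifts a n.+1) [::] true)).
  exists (frob_sol (seg t0) J a); split=> // g [_ /(_ isT) g0] /= gE.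
  move: g0; rewrite gE => /(frob_sol_Dprod q0 M1 Mt n.+1 gJ').1 /eqP.
  by apply/negP/poch_nonint/aJ/flip_neq.
Qed.

(** The invariant subspace is the image of (theta + al) ... (theta + al + n) with
al = a - n - 1.  The missed solution is the image of the I-th Frobenius solution
of E_C(al+1,b,c) under all factors but the first. *)
Lemma reducible_pos a' b' n : (a', b') = (a, b) \/ (a', b') = (b, a) ->
  shifted c a I = n.+1%:R -> monodromy_reducible a' b' c.
Proof.
move=> ab' aIn; pose al := a - n.+1%:R.
have alE : al + n.+1%:R = a by rewrite /al subrK.
have alE1 : al + 1 + n%:R = a by rewrite -[RHS]alE -natr1 addrAC addrA.
have alI : shifted c al I = 0 by rewrite /shifted /al addrAC -/(shifted c a I) aIn subrr.
have alJ K : K <> I -> ~ is_integer (shifted c al K).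
  move=> KI iK; apply: (aJ KI).
  have -> : shifted c a K = shifted c al K + n.+1%:R by rewrite /shifted addrAC alE.
  by apply: is_integerD => //; exact: is_integer_nat.
have [MI MI1 gI] := frob_radius_ex I (al + 1); have [MJ MJ1 gJ] := frob_radius_ex J al.
pose M := MI + MJ; have M1 : 1 <= M by rewrite /M; lra.
have gI' : frob_radius M I (al + 1) by apply: (Bd_mono MI1) gI; rewrite /M; lra.
have gJ' : frob_radius M J al by apply: (Bd_mono MJ1) gJ; rewrite /M; lra.
have [t0 t01 Mt] := seg_small M1.
have q0 k : (seg t0 : Cm) 0 k != 0 by apply: seg_neq0; case/andP: t01.
have sI := frob_sol_FSol q0 M1 Mt gI'; have sJ := frob_sol_FSol q0 M1 Mt gJ'.
apply: (@reducible_of_jets _ _ a al b c [::] (shifts al n.+1) false) => //.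
- by move=> q u /(FSol_shifts n.+1); rewrite alE.
- exact: xdot_X.
- exact: ab_sym.
- apply: (propagate_seg m_ge1 t01 (@nonzero_image_step _ _ al b c [::] (shifts al n.+1) false)).
  exists (frob_sol (seg t0) J al); split; first by [].
  move=> /(frob_sol_Dprod q0 M1 Mt n.+1 gJ').1 /eqP.
  by apply/negP/poch_nonint/alJ/flip_neq.
- apply: (propagate_seg m_ge1 t01 (@missed_solution_step _ _ a al b c [::] (shifts al n.+1) false)).
  exists (Dprod (seg t0) (shifts (al + 1) n) (frob_sol (seg t0) I (al + 1))); split.
    by have := FSol_shifts n sI; rewrite alE1.
  move=> g [gS _]; rewrite [shifts al n.+1]/= Dprod_rcons => gE.
  have gS1 := FSol_shift gS.
  (* The difference of (theta + al) g and the Frobenius solution is killed by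
  the remaining n factors, which are injective. *)
  pose w := (-1) *: frob_sol (seg t0) I (al + 1) + (TH (seg t0) g + al *: g).
  have wS : FSol (seg t0) (al + 1) b c w by exact: FSol_comb.
  have w0 : w = 0.
    apply: (shifts_inj wS (n := n)); first by rewrite /w Dprod_comb gE scaleN1r addNr.
    move=> i K ni; apply/eqP.
    have -> : shifted c (al + 1 + i%:R) K = shifted c al K + i.+1%:R.
      by rewrite /shifted -[i.+1]add1n natrD; ring.
    move=> E; case: (eqVneq K I) => [KI|/eqP KI].
      by move: E; rewrite KI alI add0r => /eqP; rewrite pnatr_eq0.
    apply: (alJ K KI); have -> : shifted c al K = - i.+1%:R.
      by apply/eqP; rewrite -subr_eq0 opprK E.
    exact/is_integerN/is_integer_nat.
  have gX : TH (seg t0) g + al *: g = frob_sol (seg t0) I (al + 1).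
    by apply/eqP; rewrite -subr_eq0 addrC -scaleN1r -/w w0.
  have alN : al = - \sum_k frob_exp I k by apply/eqP; rewrite -subr_eq0 opprK -shiftedE alI.
  have gS' : FSol (seg t0) (- \sum_k frob_exp I k) b c g by rewrite -alN.
  have gX' : TH (seg t0) g + - (\sum_k frob_exp I k) *: g = frob_sol (seg t0) I (al + 1) by
    rewrite -alN.
  (* The exponent other than the one of the I-th Frobenius solution. *)
  pose t k : C := (~~ I k)%:R * (1 - c k).
  have c1 k : 1 - c k != 0.
    rewrite subr_eq0 eq_sym; apply/eqP => ck; apply: (@c_nonint k); rewrite ck.
    exact: (is_integer_nat 1).
  apply: (@no_preimage _ _ (seg t0) (frob_exp I) M q0 M1 Mt b c t _ g _ _ _ _ gI' _ gS' gX').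
  + by move=> k; rewrite /t /frob_exp; case: (I k); rewrite ?mul0r ?mulr0.
  + by move=> k; rewrite /t /frob_exp; case: (I k); rewrite /= ?mul0r ?mul1r ?add0r ?addr0.
  + move=> k; rewrite /t /frob_exp; case: (I k); rewrite /= ?mul0r ?mul1r ?subr0//.
    by rewrite sub0r oppr_eq0.
  + exact: lin_lext.
  + by rewrite FC_at1 oner_neq0.
Qed.

Lemma reducible_core a' b' : (a', b') = (a, b) \/ (a', b') = (b, a) ->
  monodromy_reducible a' b' c.
Proof.
move=> ab'; have [[n|n] E] := aI; last first.
  by apply: (@reducible_nonpos a' b' n.+1 ab'); rewrite E NegzE rmorphN.
case: n E => [|n] E; first by apply: (@reducible_nonpos a' b' 0 ab'); rewrite E oppr0.
by apply: (@reducible_pos a' b' n ab'); rewrite E pmulrn.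
Qed.

End Core.
End Main.

Theorem theorem5p1 (R : realType) (m : nat) (m_ge1 : (1 <= m)%N)
    (a b : Cplx R) (c : 'I_m -> Cplx R) (I : {ffun 'I_m -> bool})
    (aI_bI : (is_integer (shifted c a I) /\ ~ is_integer (shifted c b I)) \/
             (~ is_integer (shifted c a I) /\ is_integer (shifted c b I)))
    (nonint : forall I' : {ffun 'I_m -> bool}, I' <> I ->
       ~ is_integer (shifted c a I') /\ ~ is_integer (shifted c b I')) :
  monodromy_reducible a b c.
Proof.
case: aI_bI => -[aI bI].
- by apply: (reducible_core (a := a) (b := b) m_ge1 aI) => [J /nonint[]|]; [|left].
- by apply: (reducible_core (a := b) (b := a) m_ge1 bI) => [J /nonint[]|]; [|right].
Qed.
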